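(* Let $k$ be a field, and let $\mathfrak{C}_1,\dots,\mathfrak{C}_4$ be the Delannoy categories over $k$. Write $\mathcal{C}_i(\mathbf{R})$ for the ordered étale algebra $\mathcal{C}(\mathbf{R})$ in $\mathfrak{C}_i$. There are tensor functors $$\mathfrak{C}_2\to\mathfrak{C}_1,\quad \mathcal{C}_2(\mathbf{R})\mapsto\mathcal{C}_1(\mathbf{R})\oplus\mathbf{1},$$ $$\mathfrak{C}_3\to\mathfrak{C}_1,\quad \mathcal{C}_3(\mathbf{R})\mapsto\mathbf{1}\oplus\mathcal{C}_1(\mathbf{R}),$$ $$\mathfrak{C}_4\to\mathfrak{C}_1,\quad \mathcal{C}_4(\mathbf{R})\mapsto\mathbf{1}\oplus\mathcal{C}_1(\mathbf{R})\oplus\mathbf{1},$$ $$\mathfrak{C}_4\to\mathfrak{C}_2,\quad \mathcal{C}_4(\mathbf{R})\mapsto\mathbf{1}\oplus\mathcal{C}_2(\mathbf{R}),$$ $$\mathfrak{C}_4\to\mathfrak{C}_3,\quad \mathcal{C}_4(\mathbf{R})\mapsto\mathcal{C}_3(\mathbf{R})\oplus\mathbf{1},$$ where the algebras on the right are all lexicographic sums (and the assignments are as ordered étale algebras, up to isomorphism).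
   Context: **Tensor categories.** A tensor category is an additive $k$-linear category with a $k$-bilinear symmetric monoidal structure, with unit $\mathbf{1}$. A tensor functor is a $k$-linear symmetric monoidal functor. **Ordered étale algebras.** Algebras are commutative, associative, unital. For a rigid algebra $A$ with multiplication $m_A$, $\epsilon_A\colon A\to\mathbf{1}$ is the trace map (composite of $A\to A\otimes A^\vee$, adjoint to multiplication, with evaluation); $A$ is étale if it is rigid and $\epsilon_A\circ m_A$ is a perfect pairing. $\mathrm{Et}(\mathfrak{T})$ is the category of étale algebras and algebra maps; for $\mathfrak{T}$ Karoubian, $\mathrm{Et}(\mathfrak{T})^{\mathrm{op}}$ is lextensive (finite limits, and finite coproducts such that $\mathcal{S}_{/X}\times\mathcal{S}_{/Y}\to\mathcal{S}_{/(X\amalg Y)}$ is an equivalence). A total order on an object $X$ of a lextensive category is a subobject $R_X\subset X\times X$ such that $R_X\amalg\Delta_X\amalg R_X^{\mathrm{op}}\to X\times X$ is an isomorphism ($R_X^{\mathrm{op}}$ = image under the switch) and $R_{12}\cap R_{23}\subset R_{13}$ in $X^3$ ($R_{ij}$ the inverse image of $R_X$ under the projection to coordinates $i,j$). An ordered étale algebra is an ordered object of $\mathrm{Et}(\mathfrak{T})^{\mathrm{op}}$. The lexicographic sum of ordered objects $X,Y$ is $X\amalg Y$ with order $R_X\amalg(X\times Y)\amalg R_Y$ ($X$ placed before $Y$); for étale algebras this puts an order on the product algebra $A\oplus B$. The unit algebra $\mathbf{1}$ has a unique order (the empty relation, i.e. $R=0$). Tensor functors carry ordered étale algebras to ordered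 étale algebras. **Delannoy categories.** Let $\mathbb{G}=\mathrm{Aut}(\mathbf{R},<)$ be the group of order-preserving self-bijections of $\mathbf{R}$, topologized so that pointwise stabilizers of finite subsets form a neighborhood basis of $1$. $\mathbf{S}(\mathbb{G})$ is the category of $\mathbb{G}$-sets with open stabilizers and finitely many orbits. $\mathbf{R}^{(n)}\subset\mathbf{R}^n$ is the set of tuples $x_1<\dots<x_n$. A $k$-valued measure $\mu$ assigns $\mu(f)\in k$ to each map $f\colon Y\to X$ of transitive objects of $\mathbf{S}(\mathbb{G})$ such that: $\mu$ of an isomorphism is $1$; $\mu(gf)=\mu(g)\mu(f)$; for a map $X'\to X$ of transitive sets with $Y\times_XX'=\bigsqcup Y_i'$ the orbit decomposition, $\mu(f)=\sum_i\mu(Y_i'\to X')$. There are exactly four such measures $\mu_1,\dots,\mu_4$, determined by their values on $p_{1,1}\colon\mathbf{R}\to\mathrm{pt}$, $p_{2,1}\colon\mathbf{R}^{(2)}\to\mathbf{R},(x,y)\mapsto y$, and $p_{2,2}\colon\mathbf{R}^{(2)}\to\mathbf{R},(x,y)\mapsto x$: these triples of values are $(-1,-1,-1)$, $(0,-1,0)$, $(0,0,-1)$, $(1,0,0)$ for $\mu_1,\mu_2,\mu_3,\mu_4$. The category $\underline{\mathrm{Perm}}(\mathbb{G},\mu)$ has objects $\mathcal{C}(X)$, $X\in\mathbf{S}(\mathbb{G})$; morphisms $\mathcal{C}(X)\to\mathcal{C}(Y)$ are $\mathbb{G}$-invariant functions $Y\times X\to k$; the composite $BA$ of $A\colon\mathcal{C}(X)\to\mathcal{C}(Y)$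 and $B\colon\mathcal{C}(Y)\to\mathcal{C}(Z)$ takes on an orbit $W\subset Z\times X$ the value $\sum_TB(T)A(T)\mu(T\to W)$ over orbits $T\subset Z\times Y\times X$ mapping to $W$; $\oplus$ and $\otimes$ are given by $\amalg$ and $\times$ on objects and block matrices and Kronecker products on morphisms. For $f\colon Y\to X$, $f^*\colon\mathcal{C}(X)\to\mathcal{C}(Y)$ is the indicator function of the graph of $f$; $\mathcal{C}(X)$ is an étale algebra with unit $p^*$ ($p\colon X\to\mathrm{pt}$) and multiplication $\Delta^*$ ($\Delta$ the diagonal). $\mathfrak{C}_i$ is the Karoubi envelope of $\underline{\mathrm{Perm}}(\mathbb{G},\mu_i)$. The functor $X\mapsto\mathcal{C}(X)$, $\mathbf{S}(\mathbb{G})\to\mathrm{Et}(\mathfrak{C}_i)^{\mathrm{op}}$, preserves finite coproducts and finite limits, so $\mathcal{C}(\mathbf{R})$ is an ordered étale algebra with order given by $\mathcal{C}(\mathbf{R}^{(2)})$. *)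

(* Defs.v *)
From HB Require Import structures.
From mathcomp Require Import all_boot all_order all_algebra.
From mathcomp Require Import all_classical all_reals ring.

Set Implicit Arguments.
Unset Strict Implicit.
Unset Printing Implicit Defensive.

Import Order.TTheory GRing.Theory Num.Theory.

Local Open Scope classical_set_scope.
Local Open Scope ring_scope.

Declare Scope cat_scope.
Delimit Scope cat_scope with cat.
Local Open Scope cat_scope.

Reserved Notation "g \co f" (at level 40, left associativity).
Reserved Notation "X \ox Y" (at level 33, left associativity).
Reserved Notation "f \oxm g" (at level 33, left associativity).
Reserved Notation "X \op Y" (at level 38, left associativity).

Record linear_cat (k : fieldType) := LinearCat {
  ob :> Type;
  hom : ob -> ob -> lmodType k;
  idm : forall X, hom X X;
  comp : forall X Y Z, hom Y Z -> hom X Y -> hom X Z;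
  compA : forall X Y Z W (h : hom Z W) (g : hom Y Z) (f : hom X Y),
    comp h (comp g f) = comp (comp h g) f;
  comp1m : forall X Y (f : hom X Y), comp (idm Y) f = f;
  compm1 : forall X Y (f : hom X Y), comp f (idm X) = f;
  comp_linl : forall X Y Z (f : hom X Y),
    linear (fun g : hom Y Z => comp g f);
  comp_linr : forall X Y Z (g : hom Y Z),
    linear (fun f : hom X Y => comp g f)
}.
Arguments hom {k l}.
Arguments idm {k l}.
Arguments comp {k l X Y Z}.
Notation "g \co f" := (comp g f) : cat_scope.

Definition is_iso (k : fieldType) (C : linear_cat k) (X Y : C)
    (f : hom X Y) : Prop :=
  exists g : hom Y X, g \co f = idm X /\ f \co g = idm Y.

Record additive_cat (k : fieldType) := AdditiveCat {
  acat :> linear_cat k;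
  zob : acat;
  zobP : idm zob = 0;
  oplus : acat -> acat -> acat;
  inj1 : forall X Y, hom X (oplus X Y);
  inj2 : forall X Y, hom Y (oplus X Y);
  prj1 : forall X Y, hom (oplus X Y) X;
  prj2 : forall X Y, hom (oplus X Y) Y;
  prj1_inj1 : forall X Y, prj1 X Y \co inj1 X Y = idm X;
  prj2_inj2 : forall X Y, prj2 X Y \co inj2 X Y = idm Y;
  prj1_inj2 : forall X Y, prj1 X Y \co inj2 X Y = 0;
  prj2_inj1 : forall X Y, prj2 X Y \co inj1 X Y = 0;
  inj_prj : forall X Y, inj1 X Y \co prj1 X Y + inj2 X Y \co prj2 X Y
                        = idm (oplus X Y)
}.
Arguments zob {k}.
Arguments oplus {k a}.
Arguments inj1 {k a}.
Arguments inj2 {k a}.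
Arguments prj1 {k a}.
Arguments prj2 {k a}.
Notation "X \op Y" := (oplus X Y) : cat_scope.

Record tensor_cat (k : fieldType) := TensorCat {
  tcat :> additive_cat k;
  tunit : tcat;
  tens : tcat -> tcat -> tcat;
  tensm : forall X X' Y Y' : tcat,
    hom X X' -> hom Y Y' -> hom (tens X Y) (tens X' Y');
  tensm_linl : forall X X' Y Y' (g : hom Y Y'),
    linear (fun f : hom X X' => tensm f g);
  tensm_linr : forall X X' Y Y' (f : hom X X'),
    linear (fun g : hom Y Y' => tensm f g);
  tensm1 : forall X Y, tensm (idm X) (idm Y) = idm (tens X Y);
  tensm_comp : forall X X' X'' Y Y' Y''
    (f' : hom X' X'') (f : hom X X') (g' : hom Y' Y'') (g : hom Y Y'),
    tensm (f' \co f) (g' \co g) = tensm f' g' \co tensm f g;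
  ass : forall X Y Z, hom (tens (tens X Y) Z) (tens X (tens Y Z));
  assi : forall X Y Z, hom (tens X (tens Y Z)) (tens (tens X Y) Z);
  lun : forall X, hom (tens tunit X) X;
  luni : forall X, hom X (tens tunit X);
  run : forall X, hom (tens X tunit) X;
  runi : forall X, hom X (tens X tunit);
  sym : forall X Y, hom (tens X Y) (tens Y X);
  assK : forall X Y Z, assi X Y Z \co ass X Y Z = idm _;
  assiK : forall X Y Z, ass X Y Z \co assi X Y Z = idm _;
  lunK : forall X, luni X \co lun X = idm _;
  luniK : forall X, lun X \co luni X = idm _;
  runK : forall X, runi X \co run X = idm _;
  runiK : forall X, run X \co runi X = idm _;
  symK : forall X Y, sym Y X \co sym X Y = idm _;
  ass_nat : forall X X' Y Y' Z Z'
    (f : hom X X') (g : hom Y Y') (h : hom Z Z'),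
    ass X' Y' Z' \co tensm (tensm f g) h
    = tensm f (tensm g h) \co ass X Y Z;
  lun_nat : forall X X' (f : hom X X'),
    lun X' \co tensm (idm tunit) f = f \co lun X;
  run_nat : forall X X' (f : hom X X'),
    run X' \co tensm f (idm tunit) = f \co run X;
  sym_nat : forall X X' Y Y' (f : hom X X') (g : hom Y Y'),
    sym X' Y' \co tensm f g = tensm g f \co sym X Y;
  pentagon : forall X Y Z W,
    ass X Y (tens Z W) \co ass (tens X Y) Z W
    = tensm (idm X) (ass Y Z W) \co ass X (tens Y Z) W
      \co tensm (ass X Y Z) (idm W);
  triangle : forall X Y,
    tensm (idm X) (lun Y) \co ass X tunit Y = tensm (run X) (idm Y);
  hexagon : forall X Y Z,
    ass Y Z X \co sym X (tens Y Z) \co ass X Y Z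
    = tensm (idm Y) (sym X Z) \co ass Y X Z \co tensm (sym X Y) (idm Z)
}.
Arguments tunit {k t}.
Arguments tens {k t}.
Arguments tensm {k t X X' Y Y'}.
Arguments ass {k t}.
Arguments assi {k t}.
Arguments lun {k t}.
Arguments luni {k t}.
Arguments run {k t}.
Arguments runi {k t}.
Arguments sym {k t}.
Notation "X \ox Y" := (tens X Y) : cat_scope.
Notation "f \oxm g" := (tensm f g) : cat_scope.

(* Monoidal functors are strong: the comparison maps are isomorphisms. *)
Record tensor_functor (k : fieldType) (C D : tensor_cat k) := TensorFunctor {
  fob :> C -> D;
  fmor : forall X Y : C, hom X Y -> hom (fob X) (fob Y);
  fmor_lin : forall X Y, linear (@fmor X Y);
  fmor1 : forall X, fmor (idm X) = idm (fob X);
  fmor_comp : forall X Y Z (g : hom Y Z) (f : hom X Y),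
    fmor (g \co f) = fmor g \co fmor f;
  fun1 : hom (tunit : D) (fob tunit);
  fun1_iso : is_iso fun1;
  fun2 : forall X Y : C, hom (fob X \ox fob Y) (fob (X \ox Y));
  fun2_iso : forall X Y, is_iso (fun2 X Y);
  fun2_nat : forall X X' Y Y' (f : hom X X') (g : hom Y Y'),
    fun2 X' Y' \co (fmor f \oxm fmor g) = fmor (f \oxm g) \co fun2 X Y;
  fun2_ass : forall X Y Z,
    fmor (ass X Y Z) \co fun2 (X \ox Y) Z \co (fun2 X Y \oxm idm (fob Z))
    = fun2 X (Y \ox Z) \co (idm (fob X) \oxm fun2 Y Z)
      \co ass (fob X) (fob Y) (fob Z);
  fun2_lun : forall X,
    fmor (lun X) \co fun2 tunit X \co (fun1 \oxm idm (fob X)) = lun (fob X);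
  fun2_run : forall X,
    fmor (run X) \co fun2 X tunit \co (idm (fob X) \oxm fun1) = run (fob X);
  fun2_sym : forall X Y,
    fmor (sym X Y) \co fun2 X Y = fun2 Y X \co sym (fob X) (fob Y)
}.
Arguments fmor {k C D} t {X Y}.
Arguments fun1 {k C D}.
Arguments fun2 {k C D}.

Section Algebras.
Variables (k : fieldType) (C : tensor_cat k).

Record alg := Alg {
  alg_ob :> C;
  mul : hom (alg_ob \ox alg_ob) alg_ob;
  one : hom tunit alg_ob
}.
Arguments mul : clear implicits.
Arguments one : clear implicits.

Definition is_comm_algebra (A : alg) : Prop :=
  [/\ mul A \co (mul A \oxm idm A)
        = mul A \co (idm A \oxm mul A) \co ass A A A,
      mul A \co (one A \oxm idm A) = lun A,
      mul A \co (idm A \oxm one A) = run A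
    & mul A \co sym A A = mul A].

Definition is_alg_map (A B : alg) (f : hom A B) : Prop :=
  f \co mul A = mul B \co (f \oxm f) /\ f \co one A = one B.

Record dual (X : C) := Dual {
  dual_ob :> C;
  coev : hom tunit (X \ox dual_ob);
  ev : hom (dual_ob \ox X) tunit;
  dual_zigzag : run X \co (idm X \oxm ev) \co ass X dual_ob X
                \co (coev \oxm idm X) = lun X;
  dual_zagzig : lun dual_ob \co (ev \oxm idm dual_ob)
                \co assi dual_ob X dual_ob
                \co (idm dual_ob \oxm coev) = run dual_ob
}.
Arguments coev {X}.
Arguments ev {X}.

(* The adjoint X -> Y \ox Z^dual of a map X \ox Z -> Y. *)
Definition adjoint (X Y Z : C) (Zd : dual Z) (f : hom (X \ox Z) Y) :
    hom X (Y \ox Zd) :=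
  (f \oxm idm (dual_ob Zd)) \co assi X Z Zd \co (idm X \oxm coev Zd)
  \co runi X.

Definition trace_map (A : alg) (Ad : dual A) : hom A tunit :=
  ev Ad \co sym A Ad \co adjoint Ad (mul A).

Definition perfect_pairing (X : C) (Xd : dual X) (b : hom (X \ox X) tunit) :
    Prop :=
  is_iso (lun Xd \co adjoint Xd b).

Definition etale (A : alg) : Prop :=
  is_comm_algebra A /\
  exists Ad : dual A, perfect_pairing Ad (trace_map Ad \co mul A).

Definition sum_alg (A B : alg) : alg :=
  @Alg (A \op B)
    (inj1 A B \co mul A \co (prj1 A B \oxm prj1 A B)
     + inj2 A B \co mul B \co (prj2 A B \oxm prj2 A B))
    (inj1 A B \co one A + inj2 A B \co one B).

(* (a \ox b)(a' \ox b') = aa' \ox bb' *)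
Definition tens_alg (A B : alg) : alg :=
  @Alg (A \ox B)
    ((mul A \oxm mul B) \co assi A A (B \ox B)
     \co (idm A \oxm (ass A B B \co (sym B A \oxm idm B) \co assi B A B))
     \co ass A B (A \ox B))
    ((one A \oxm one B) \co runi tunit).

Definition unit_alg : alg := Alg (lun tunit) (idm tunit).

Definition zero_alg : alg := @Alg (zob C) 0 0.

(* An algebra A with a map A \ox A -> R. In the opposite of the category of
   étale algebras, binary products are tensor products, so this encodes a
   relation R -> X * X on the object X corresponding to A. *)
Record rel_alg := RelAlg {
  ra :> alg;
  rel_part : alg;
  rel_map : hom (ra \ox ra) rel_part
}.
Arguments rel_part : clear implicits.
Arguments rel_map : clear implicits.

(* For points x y : T -> X of X, given by algebra maps A -> E, the point
   (x, y) : T -> X * X lies on the relation. *)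
Definition related (X : rel_alg) (E : alg) (x y : hom X E) : Prop :=
  exists2 r : hom (rel_part X) E,
    is_alg_map r & r \co rel_map X = mul E \co (x \oxm y).

(* The fields say, in the opposite of the category of étale algebras, where
   coproducts are product algebras: the relation R is a subobject of X * X,
   the sum of R, the diagonal and R^op maps isomorphically to X * X, and
   R_12 /\ R_23 is contained in R_13 (this inclusion of subobjects of X^3 being
   tested on T-points of X^3, for all T). *)
Record ordered_etale (X : rel_alg) : Prop := OrderedEtale {
  oe_etale : etale X;
  oe_rel_etale : etale (rel_part X);
  oe_rel_map : is_alg_map (A := tens_alg X X) (rel_map X);
  oe_sub : forall (E : alg) (f g : hom (rel_part X) E), etale E ->
    is_alg_map f -> is_alg_map g ->
    f \co rel_map X = g \co rel_map X -> f = g;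
  oe_total :
    is_iso (inj1 (rel_part X \op X) (rel_part X)
              \co (inj1 (rel_part X) X \co rel_map X + inj2 (rel_part X) X \co mul X)
            + inj2 (rel_part X \op X) (rel_part X) \co (rel_map X \co sym X X));
  oe_trans : forall (E : alg) (x y z : hom X E), etale E ->
    is_alg_map x -> is_alg_map y -> is_alg_map z ->
    related x y -> related y z -> related x z
}.

Definition ordered_iso (X Y : rel_alg) : Prop :=
  [/\ ordered_etale X, ordered_etale Y &
    exists (f : hom X Y) (r : hom (rel_part X) (rel_part Y)),
      [/\ is_iso f, is_iso r, is_alg_map f, is_alg_map r
        & r \co rel_map X = rel_map Y \co (f \oxm f)]].

(* The order puts X before Y. *)
Definition lex_sum (X Y : rel_alg) : rel_alg :=
  @RelAlg (sum_alg X Y)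
    (sum_alg (sum_alg (rel_part X) (tens_alg X Y)) (rel_part Y))
    (inj1 (rel_part X \op X \ox Y) (rel_part Y)
       \co (inj1 (rel_part X) (X \ox Y)
              \co (rel_map X \co (prj1 X Y \oxm prj1 X Y))
            + inj2 (rel_part X) (X \ox Y) \co (prj1 X Y \oxm prj2 X Y))
     + inj2 (rel_part X \op X \ox Y) (rel_part Y)
       \co (rel_map Y \co (prj2 X Y \oxm prj2 X Y))).

Definition unit_ordered : rel_alg := @RelAlg unit_alg zero_alg 0.

End Algebras.
Arguments mul {k C}.
Arguments one {k C}.
Arguments unit_ordered {k C}.
Arguments rel_part {k C}.
Arguments rel_map {k C}.

Section Image.
Variables (k : fieldType) (C D : tensor_cat k) (F : tensor_functor C D).

Definition map_alg (A : alg C) : alg D :=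
  @Alg k D (F A) (fmor F (mul A) \co fun2 F A A) (fmor F (one A) \co fun1 F).

Definition map_ordered (X : rel_alg C) : rel_alg D :=
  @RelAlg k D (map_alg X) (map_alg (rel_part X))
    (fmor F (rel_map X) \co fun2 F X X).

End Image.

Section BilinearTheory.
Variables (k : fieldType) (C : linear_cat k).

Lemma compDl (X Y Z : C) (g g' : hom Y Z) (f : hom X Y) :
  (g + g') \co f = g \co f + g' \co f.
Proof. by have := comp_linl f 1 g g'; rewrite !scale1r. Qed.

Lemma compDr (X Y Z : C) (g : hom Y Z) (f f' : hom X Y) :
  g \co (f + f') = g \co f + g \co f'.
Proof. by have := comp_linr g 1 f f'; rewrite !scale1r. Qed.

Lemma comp0l (X Y Z : C) (f : hom X Y) : (0 : hom Y Z) \co f = 0.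
Proof. by apply: (addrI (0 \co f)); rewrite -compDl !addr0. Qed.

Lemma comp0r (X Y Z : C) (g : hom Y Z) : g \co (0 : hom X Y) = 0.
Proof. by apply: (addrI (g \co 0)); rewrite -compDr !addr0. Qed.

Lemma compZl (X Y Z : C) a (g : hom Y Z) (f : hom X Y) :
  (a *: g) \co f = a *: (g \co f).
Proof. by have := comp_linl f a g 0; rewrite comp0l !addr0. Qed.

Lemma compZr (X Y Z : C) a (g : hom Y Z) (f : hom X Y) :
  g \co (a *: f) = a *: (g \co f).
Proof. by have := comp_linr g a f 0; rewrite comp0r !addr0. Qed.

End BilinearTheory.

Section Karoubi.
Variables (k : fieldType) (C : tensor_cat k).

Record kar_ob := KarOb {
  kob : C;
  kid : hom kob kob;
  kid_idem : kid \co kid = kid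
}.

Record kar_hom (X Y : kar_ob) := KarHom {
  kmor : hom (kob X) (kob Y);
  kmorP : kid Y \co kmor \co kid X = kmor
}.

Lemma kar_hom_eq X Y (f g : kar_hom X Y) : kmor f = kmor g -> f = g.
Proof.
case: f g => f fP [g gP] /= fg; subst g.
by rewrite (Prop_irrelevance fP gP).
Qed.

Lemma kmor_idl X Y (f : kar_hom X Y) : kid Y \co kmor f = kmor f.
Proof. by rewrite -{1}(kmorP f) !compA kid_idem kmorP. Qed.

Lemma kmor_idr X Y (f : kar_hom X Y) : kmor f \co kid X = kmor f.
Proof. by rewrite -{1}(kmorP f) -!compA kid_idem !compA kmorP. Qed.

Section HomLmodule.
Variables X Y : kar_ob.

HB.instance Definition _ := gen_eqMixin (kar_hom X Y).
HB.instance Definition _ := gen_choiceMixin (kar_hom X Y).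

Let zeroP : kid Y \co 0 \co kid X = 0.
Proof. by rewrite comp0r comp0l. Qed.
Definition kar_zero : kar_hom X Y := KarHom zeroP.

Let scaleP a (f : kar_hom X Y) :
  kid Y \co (a *: kmor f) \co kid X = a *: kmor f.
Proof. by rewrite compZr compZl kmorP. Qed.
Definition kar_scale a f : kar_hom X Y := KarHom (scaleP a f).

Let addP (f g : kar_hom X Y) :
  kid Y \co (kmor f + kmor g) \co kid X = kmor f + kmor g.
Proof. by rewrite compDr compDl !kmorP. Qed.
Definition kar_add f g : kar_hom X Y := KarHom (addP f g).

Definition kar_opp f : kar_hom X Y := kar_scale (-1) f.

Let addA : associative kar_add.
Proof. by move=> f g h; apply: kar_hom_eq; rewrite /= addrA. Qed.
Let addC : commutative kar_add.
Proof. by move=> f g; apply: kar_hom_eq; rewrite /= addrC. Qed.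
Let add0 : left_id kar_zero kar_add.
Proof. by move=> f; apply: kar_hom_eq; rewrite /= add0r. Qed.
Let addN : left_inverse kar_zero kar_opp kar_add.
Proof. by move=> f; apply: kar_hom_eq; rewrite /= scaleN1r addNr. Qed.
HB.instance Definition _ :=
  GRing.isZmodule.Build (kar_hom X Y) addA addC add0 addN.

Let scaleA a b (f : kar_hom X Y) :
  kar_scale a (kar_scale b f) = kar_scale (a * b) f.
Proof. by apply: kar_hom_eq; rewrite /= scalerA. Qed.
Let scale1 : left_id 1 kar_scale.
Proof. by move=> f; apply: kar_hom_eq; rewrite /= scale1r. Qed.
Let scaleDr : right_distributive kar_scale +%R.
Proof. by move=> a f g; apply: kar_hom_eq; rewrite /= scalerDr. Qed.
Let scaleDl (f : kar_hom X Y) : {morph kar_scale^~ f : a b / a + b}.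
Proof. by move=> a b; apply: kar_hom_eq; rewrite /= scalerDl. Qed.
HB.instance Definition _ :=
  GRing.Zmodule_isLmodule.Build k (kar_hom X Y) scaleA scale1 scaleDr scaleDl.

End HomLmodule.

Lemma kar_idm_subproof X : kid X \co kid X \co kid X = kid X.
Proof. by rewrite !kid_idem. Qed.
Definition kar_idm X : kar_hom X X := KarHom (kar_idm_subproof X).

Lemma kar_comp_subproof X Y Z (g : kar_hom Y Z) (f : kar_hom X Y) :
  kid Z \co (kmor g \co kmor f) \co kid X = kmor g \co kmor f.
Proof. by rewrite compA kmor_idl -compA kmor_idr. Qed.
Definition kar_comp X Y Z (g : kar_hom Y Z) (f : kar_hom X Y) : kar_hom X Z :=
  KarHom (kar_comp_subproof g f).

Definition kar_linear_cat : linear_cat k.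
Proof.
refine (@LinearCat k kar_ob kar_hom kar_idm kar_comp _ _ _ _ _).
- by move=> *; apply: kar_hom_eq; rewrite /= compA.
- by move=> *; apply: kar_hom_eq; rewrite /= kmor_idl.
- by move=> *; apply: kar_hom_eq; rewrite /= kmor_idr.
- move=> X Y Z f a g g'; apply: kar_hom_eq.
  exact: (comp_linl (kmor f) a (kmor g) (kmor g')).
- move=> X Y Z g a f f'; apply: kar_hom_eq.
  exact: (comp_linr (kmor g) a (kmor f) (kmor f')).
Defined.

(* A map of C commuting with the idempotents, cut down to a map of direct
   summands. *)
Lemma kar_cut_subproof (X Y : kar_ob) (f : hom (kob X) (kob Y)) :
  f \co kid X = kid Y \co f -> kid Y \co (f \co kid X) \co kid X = f \co kid X.
Proof. by move=> fe; rewrite compA -fe -!compA !kid_idem. Qed.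
Definition kar_cut (X Y : kar_ob) (f : hom (kob X) (kob Y))
    (fe : f \co kid X = kid Y \co f) : kar_hom X Y :=
  KarHom (kar_cut_subproof fe).

Lemma kar_zob_subproof : idm (zob C) \co idm (zob C) = idm (zob C).
Proof. by rewrite comp1m. Qed.
Definition kar_zob : kar_ob := KarOb kar_zob_subproof.

Section Sums.
Variables X Y : kar_ob.
Let i1 := inj1 (kob X) (kob Y).
Let i2 := inj2 (kob X) (kob Y).
Let p1 := prj1 (kob X) (kob Y).
Let p2 := prj2 (kob X) (kob Y).

Definition kar_sum_id := i1 \co kid X \co p1 + i2 \co kid Y \co p2.

Lemma kar_p1e : p1 \co kar_sum_id = kid X \co p1.
Proof.
rewrite /kar_sum_id compDr !compA /p1 /i1 /i2 prj1_inj1 prj1_inj2 comp1m.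
by rewrite !comp0l addr0.
Qed.
Lemma kar_p2e : p2 \co kar_sum_id = kid Y \co p2.
Proof.
rewrite /kar_sum_id compDr !compA /p2 /i1 /i2 prj2_inj2 prj2_inj1 comp1m.
by rewrite !comp0l add0r.
Qed.
Lemma kar_i1e : i1 \co kid X = kar_sum_id \co i1.
Proof.
rewrite /kar_sum_id compDl -!compA /p1 /p2 /i1 prj1_inj1 prj2_inj1 compm1.
by rewrite !comp0r addr0.
Qed.
Lemma kar_i2e : i2 \co kid Y = kar_sum_id \co i2.
Proof.
rewrite /kar_sum_id compDl -!compA /p1 /p2 /i2 prj2_inj2 prj1_inj2 compm1.
by rewrite !comp0r add0r.
Qed.

Lemma kar_sum_subproof : kar_sum_id \co kar_sum_id = kar_sum_id.
Proof.
rewrite {1}/kar_sum_id compDl -!compA kar_p1e kar_p2e !compA.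
by rewrite -(compA i1) -(compA i2) !kid_idem.
Qed.
Definition kar_sum : kar_ob := KarOb kar_sum_subproof.

Definition kar_inj1 : kar_hom X kar_sum := @kar_cut X kar_sum i1 kar_i1e.
Definition kar_inj2 : kar_hom Y kar_sum := @kar_cut Y kar_sum i2 kar_i2e.
Definition kar_prj1 : kar_hom kar_sum X := @kar_cut kar_sum X p1 kar_p1e.
Definition kar_prj2 : kar_hom kar_sum Y := @kar_cut kar_sum Y p2 kar_p2e.
End Sums.

Definition kar_additive_cat : additive_cat k.
Proof.
refine (@AdditiveCat k kar_linear_cat kar_zob _ kar_sum kar_inj1 kar_inj2
  kar_prj1 kar_prj2 _ _ _ _ _).
- by apply: kar_hom_eq; rewrite /= zobP.
- move=> X Y; apply: kar_hom_eq; rewrite /= kar_p1e -!compA (compA (prj1 _ _)).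
  by rewrite prj1_inj1 comp1m kid_idem.
- move=> X Y; apply: kar_hom_eq; rewrite /= kar_p2e -!compA (compA (prj2 _ _)).
  by rewrite prj2_inj2 comp1m kid_idem.
- move=> X Y; apply: kar_hom_eq; rewrite /= kar_p1e -!compA (compA (prj1 _ _)).
  by rewrite prj1_inj2 comp0l comp0r.
- move=> X Y; apply: kar_hom_eq; rewrite /= kar_p2e -!compA (compA (prj2 _ _)).
  by rewrite prj2_inj1 comp0l comp0r.
- move=> X Y; apply: kar_hom_eq; rewrite /= kar_p1e kar_p2e.
  by rewrite -!compA (compA (kid X)) (compA (kid Y)) !kid_idem !compA.
Defined.

Lemma kar_unit_subproof :
  idm (tunit : C) \co idm (tunit : C) = idm (tunit : C).
Proof. by rewrite comp1m. Qed.
Definition kar_unit : kar_ob := KarOb kar_unit_subproof.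

Lemma kar_tens_subproof (X Y : kar_ob) :
  (kid X \oxm kid Y) \co (kid X \oxm kid Y) = kid X \oxm kid Y.
Proof. by rewrite -tensm_comp !kid_idem. Qed.
Definition kar_tens (X Y : kar_ob) : kar_ob := KarOb (kar_tens_subproof X Y).

Lemma kar_tensm_subproof X X' Y Y' (f : kar_hom X X') (g : kar_hom Y Y') :
  (kid X' \oxm kid Y') \co (kmor f \oxm kmor g) \co (kid X \oxm kid Y)
  = kmor f \oxm kmor g.
Proof. by rewrite -!tensm_comp !kmorP. Qed.
Definition kar_tensm X X' Y Y' (f : kar_hom X X') (g : kar_hom Y Y') :
  kar_hom (kar_tens X Y) (kar_tens X' Y') :=
  @KarHom (kar_tens X Y) (kar_tens X' Y') _ (kar_tensm_subproof f g).

Lemma assi_nat (X X' Y Y' Z Z' : C) (f : hom X X') (g : hom Y Y')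
    (h : hom Z Z') :
  assi X' Y' Z' \co (f \oxm (g \oxm h)) = ((f \oxm g) \oxm h) \co assi X Y Z.
Proof.
rewrite -[LHS]compm1 -(assiK X Y Z) !compA -(compA (assi _ _ _)) -ass_nat.
by rewrite !compA assK comp1m.
Qed.
Lemma luni_nat (X X' : C) (f : hom X X') :
  luni X' \co f = (idm tunit \oxm f) \co luni X.
Proof.
rewrite -[LHS]compm1 -(luniK X) !compA -(compA (luni _)) -lun_nat.
by rewrite !compA lunK comp1m.
Qed.
Lemma runi_nat (X X' : C) (f : hom X X') :
  runi X' \co f = (f \oxm idm tunit) \co runi X.
Proof.
rewrite -[LHS]compm1 -(runiK X) !compA -(compA (runi _)) -run_nat.
by rewrite !compA runK comp1m.
Qed.

Let kass X Y Z : kar_hom (kar_tens (kar_tens X Y) Z)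
    (kar_tens X (kar_tens Y Z)) :=
  @kar_cut (kar_tens (kar_tens X Y) Z) (kar_tens X (kar_tens Y Z))
    (ass _ _ _) (ass_nat _ _ _).
Let kassi X Y Z : kar_hom (kar_tens X (kar_tens Y Z))
    (kar_tens (kar_tens X Y) Z) :=
  @kar_cut (kar_tens X (kar_tens Y Z)) (kar_tens (kar_tens X Y) Z)
    (assi _ _ _) (assi_nat _ _ _).
Let klun X : kar_hom (kar_tens kar_unit X) X :=
  @kar_cut (kar_tens kar_unit X) X (lun _) (lun_nat _).
Let kluni X : kar_hom X (kar_tens kar_unit X) :=
  @kar_cut X (kar_tens kar_unit X) (luni _) (luni_nat _).
Let krun X : kar_hom (kar_tens X kar_unit) X :=
  @kar_cut (kar_tens X kar_unit) X (run _) (run_nat _).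
Let kruni X : kar_hom X (kar_tens X kar_unit) :=
  @kar_cut X (kar_tens X kar_unit) (runi _) (runi_nat _).
Let ksym X Y : kar_hom (kar_tens X Y) (kar_tens Y X) :=
  @kar_cut (kar_tens X Y) (kar_tens Y X) (sym _ _) (sym_nat _ _).

Lemma cut_comp (X Y Z : C) (g : hom Y Z) (f : hom X Y) (e : hom X X)
    (e' : hom Y Y) :
  e \co e = e -> f \co e = e' \co f ->
  (g \co e') \co (f \co e) = (g \co f) \co e.
Proof.
by move=> ee fe; rewrite -(compA g) (compA e') -fe -!compA ee.
Qed.

Definition karoubi : tensor_cat k.
Proof.
refine (@TensorCat k kar_additive_cat kar_unit kar_tens kar_tensm _ _ _ _
  kass kassi klun kluni krun kruni ksym _ _ _ _ _ _ _ _ _ _ _ _ _ _).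
- move=> X X' Y Y' g a f f'; apply: kar_hom_eq.
  exact: (tensm_linl (kmor g) a (kmor f) (kmor f')).
- move=> X X' Y Y' g a f f'; apply: kar_hom_eq.
  exact: (tensm_linr (kmor g) a (kmor f) (kmor f')).
- by move=> X Y; apply: kar_hom_eq.
- by move=> *; apply: kar_hom_eq; rewrite /= tensm_comp.
- move=> X Y Z; apply: kar_hom_eq.
  by rewrite [LHS]cut_comp ?assK ?comp1m ?kid_idem //; exact: ass_nat.
- move=> X Y Z; apply: kar_hom_eq.
  by rewrite [LHS]cut_comp ?assiK ?comp1m ?kid_idem //; exact: assi_nat.
- move=> X; apply: kar_hom_eq.
  by rewrite [LHS]cut_comp ?lunK ?comp1m ?kid_idem //; exact: lun_nat.
- move=> X; apply: kar_hom_eq.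
  by rewrite [LHS]cut_comp ?luniK ?comp1m ?kid_idem //; exact: luni_nat.
- move=> X; apply: kar_hom_eq.
  by rewrite [LHS]cut_comp ?runK ?comp1m ?kid_idem //; exact: run_nat.
- move=> X; apply: kar_hom_eq.
  by rewrite [LHS]cut_comp ?runiK ?comp1m ?kid_idem //; exact: runi_nat.
- move=> X Y; apply: kar_hom_eq.
  by rewrite [LHS]cut_comp ?symK ?comp1m ?kid_idem //; exact: sym_nat.
- move=> X X' Y Y' Z Z' f g h; apply: kar_hom_eq => /=.
  rewrite -compA -!tensm_comp !kmor_idl [RHS]compA -[in RHS]ass_nat.
  by rewrite -[RHS]compA -!tensm_comp !kmor_idr.
- move=> X X' f; apply: kar_hom_eq => /=.
  rewrite -compA -!tensm_comp comp1m kmor_idl lun_nat.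
  by rewrite [in RHS]lun_nat compA kmor_idr.
- move=> X X' f; apply: kar_hom_eq => /=.
  rewrite -compA -!tensm_comp comp1m kmor_idl run_nat.
  by rewrite [in RHS]run_nat compA kmor_idr.
- move=> X X' Y Y' f g; apply: kar_hom_eq => /=.
  rewrite -compA -!tensm_comp !kmor_idl sym_nat.
  by rewrite [in RHS]sym_nat compA -tensm_comp !kmor_idr.
- move=> X Y Z W; apply: kar_hom_eq => /=.
  have eq1 : kid X \oxm (ass (kob Y) (kob Z) (kob W)
                         \co (kid Y \oxm kid Z \oxm kid W))
    = (idm (kob X) \oxm ass _ _ _)
      \co (kid X \oxm (kid Y \oxm kid Z \oxm kid W)).
    by rewrite -tensm_comp comp1m.
  have eq2 : (ass (kob X) (kob Y) (kob Z) \co (kid X \oxm kid Y \oxm kid Z))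
             \oxm kid W
    = (ass _ _ _ \oxm idm (kob W))
      \co (kid X \oxm kid Y \oxm kid Z \oxm kid W).
    by rewrite -tensm_comp comp1m.
  have idem : (kid X \oxm kid Y \oxm kid Z \oxm kid W)
      \co (kid X \oxm kid Y \oxm kid Z \oxm kid W)
      = kid X \oxm kid Y \oxm kid Z \oxm kid W.
    by rewrite -!tensm_comp !kid_idem.
  rewrite eq1 eq2 (cut_comp _ idem (ass_nat _ _ _)) pentagon.
  rewrite (cut_comp _ _ (ass_nat _ _ _)); last first.
    by rewrite -!tensm_comp !kid_idem.
  rewrite (cut_comp _ idem) //.
  by rewrite -!tensm_comp ass_nat comp1m compm1.
- move=> X Y; apply: kar_hom_eq => /=.
  have -> : kid X \oxm (lun (kob Y) \co (idm tunit \oxm kid Y))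
    = (idm (kob X) \oxm lun _) \co (kid X \oxm (idm tunit \oxm kid Y)).
    by rewrite -tensm_comp comp1m.
  rewrite (cut_comp _ _ (ass_nat _ _ _)) ?triangle.
    by rewrite -!tensm_comp comp1m.
  by rewrite -!tensm_comp !kid_idem comp1m.
- move=> X Y Z; apply: kar_hom_eq => /=.
  have idem : (kid X \oxm kid Y \oxm kid Z) \co (kid X \oxm kid Y \oxm kid Z)
      = kid X \oxm kid Y \oxm kid Z.
    by rewrite -!tensm_comp !kid_idem.
  have -> : kid Y \oxm (sym (kob X) (kob Z) \co (kid X \oxm kid Z))
    = (idm (kob Y) \oxm sym _ _) \co (kid Y \oxm (kid X \oxm kid Z)).
    by rewrite -tensm_comp comp1m.
  have -> : (sym (kob X) (kob Y) \co (kid X \oxm kid Y)) \oxm kid Z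
    = (sym _ _ \oxm idm (kob Z)) \co (kid X \oxm kid Y \oxm kid Z).
    by rewrite -tensm_comp comp1m.
  rewrite -(compA _ _ (ass _ _ _ \co _)) (cut_comp _ idem (ass_nat _ _ _)).
  rewrite (cut_comp _ idem); last by rewrite -compA ass_nat compA sym_nat -compA.
  rewrite (cut_comp _ _ (ass_nat _ _ _)); last by rewrite -!tensm_comp !kid_idem.
  rewrite (cut_comp _ idem); last by rewrite -!tensm_comp sym_nat comp1m compm1.
  by rewrite -hexagon !compA.
Defined.

Lemma kar_emb_subproof (X : C) : idm X \co idm X = idm X.
Proof. by rewrite comp1m. Qed.
Definition kar_emb (X : C) : karoubi := KarOb (kar_emb_subproof X).

Lemma kar_embm_subproof (X Y : C) (f : hom X Y) :
  kid (kar_emb Y) \co f \co kid (kar_emb X) = f.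
Proof. by rewrite compm1 comp1m. Qed.
Definition kar_embm (X Y : C) (f : hom X Y) : hom (kar_emb X) (kar_emb Y) :=
  KarHom (kar_embm_subproof f).

Lemma kar_fun1_subproof : idm tunit \co idm tunit \co idm tunit
  = idm (tunit : C).
Proof. by rewrite !comp1m. Qed.
Lemma kar_fun2_subproof (X Y : C) :
  idm (X \ox Y) \co idm (X \ox Y) \co (idm X \oxm idm Y) = idm (X \ox Y).
Proof. by rewrite tensm1 !comp1m. Qed.
Lemma kar_fun2i_subproof (X Y : C) :
  (idm X \oxm idm Y) \co idm (X \ox Y) \co idm (X \ox Y) = idm (X \ox Y).
Proof. by rewrite tensm1 !comp1m. Qed.

Definition kar_functor : tensor_functor C karoubi.
Proof.
refine (@TensorFunctor k C karoubi kar_emb kar_embm _ _ _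
  (@KarHom kar_unit (kar_emb tunit) _ kar_fun1_subproof) _
  (fun X Y => @KarHom (kar_tens (kar_emb X) (kar_emb Y)) (kar_emb (X \ox Y)) _
                (kar_fun2_subproof X Y)) _ _ _ _ _ _).
- by move=> X Y a f g; apply: kar_hom_eq.
- by move=> X; apply: kar_hom_eq.
- by move=> X Y Z g f; apply: kar_hom_eq.
- exists (@KarHom (kar_emb tunit) kar_unit _ kar_fun1_subproof).
  by split; apply: kar_hom_eq; rewrite /= comp1m.
- move=> X Y; exists (@KarHom (kar_emb (X \ox Y))
    (kar_tens (kar_emb X) (kar_emb Y)) _ (kar_fun2i_subproof X Y)).
  by split; apply: kar_hom_eq; rewrite /= ?tensm1 comp1m.
- by move=> *; apply: kar_hom_eq; rewrite /= comp1m compm1.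
- by move=> *; apply: kar_hom_eq; rewrite /= !tensm1 !comp1m !compm1.
- by move=> *; apply: kar_hom_eq; rewrite /= !tensm1 !compm1.
- by move=> *; apply: kar_hom_eq; rewrite /= !tensm1 !compm1.
- by move=> *; apply: kar_hom_eq; rewrite /= !tensm1 comp1m !compm1.
Defined.

End Karoubi.

(* The group G = Aut(R, <) *)
Record oaut (R : realType) := OAut {
  oaut_fun :> R -> R;
  oaut_inv : R -> R;
  oaut_funK : cancel oaut_fun oaut_inv;
  oaut_invK : cancel oaut_inv oaut_fun;
  oaut_inc : {homo oaut_fun : x y / x < y}
}.

Section OautGroup.
Variable R : realType.
Implicit Types g h : oaut R.

Lemma oaut_eq g h : oaut_fun g =1 oaut_fun h -> g = h.
Proof.
case: g h => [g g' gK g'K gi] [h h' hK h'K hi] /= gh.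
have ? : g = h by apply/funext.
subst h; have ? : g' = h'.
  by apply/funext => x; apply: (can_inj gK); rewrite g'K h'K.
subst h'; by congr OAut; exact: Prop_irrelevance.
Qed.

HB.instance Definition _ := gen_eqMixin (oaut R).
HB.instance Definition _ := gen_choiceMixin (oaut R).

Lemma oaut_incE g : {mono g : x y / x < y}.
Proof. exact: leW_mono (le_mono (@oaut_inc R g)). Qed.

Definition oaut_id : oaut R :=
  @OAut R id id (fun=> erefl) (fun=> erefl) (fun _ _ => id).

Let inv_inc g : {homo oaut_inv g : x y / x < y}.
Proof. by move=> x y xy; rewrite -(oaut_incE g) !oaut_invK. Qed.
Definition oaut_inverse g : oaut R :=
  OAut (@oaut_invK _ g) (@oaut_funK _ g) (@inv_inc g).

Let comp_inc g h : {homo g \o h : x y / x < y}.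
Proof. by move=> x y xy; do 2!apply: oaut_inc. Qed.
Definition oaut_comp g h : oaut R :=
  OAut (can_comp (@oaut_funK _ g) (@oaut_funK _ h))
    (can_comp (@oaut_invK _ h) (@oaut_invK _ g)) (@comp_inc g h).

Let compA : associative oaut_comp.
Proof. by move=> *; apply: oaut_eq. Qed.
Let comp1 : left_id oaut_id oaut_comp.
Proof. by move=> *; apply: oaut_eq. Qed.
Let compr1 : right_id oaut_id oaut_comp.
Proof. by move=> *; apply: oaut_eq. Qed.
Let compV : left_inverse oaut_id oaut_inverse oaut_comp.
Proof. by move=> g; apply: oaut_eq => x /=; rewrite oaut_funK. Qed.
Let compVr : right_inverse oaut_id oaut_inverse oaut_comp.
Proof. by move=> g; apply: oaut_eq => x /=; rewrite oaut_invK. Qed.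
HB.instance Definition _ :=
  isGroup.Build (oaut R) compA comp1 compr1 compV compVr.

Definition pointwise_stab (A : seq R) : set (oaut R) :=
  [set g | {in A, forall a, g a = a}].

(* Openness, for a subgroup H, in the topology having the pointwise stabilizers
   of finite sets as a neighborhood basis of 1. *)
Definition open_subgroup (H : set (oaut R)) : Prop :=
  exists A : seq R, pointwise_stab A `<=` H.

Definition stretch (c u v x : R) : R :=
  if x <= c then x else c + (x - c) * ((v - c) / (u - c)).

Lemma stretchK c u v : c < u -> c < v -> cancel (stretch c u v) (stretch c v u).
Proof.
move=> cu cv x; rewrite /stretch; case: (leP x c) => [->//|cx].
have u0 : 0 < u - c by rewrite subr_gt0.
have v0 : 0 < v - c by rewrite subr_gt0.
have x0 : 0 < x - c by rewrite subr_gt0.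
rewrite ifF; last by apply/negbTE; rewrite -ltNge ltrDl !mulr_gt0 ?invr_gt0.
field; by rewrite !lt0r_neq0.
Qed.

Lemma stretch_inc c u v : c < u -> c < v ->
  {homo stretch c u v : x y / x < y}.
Proof.
move=> cu cv x y xy; rewrite /stretch.
have q0 : 0 < (v - c) / (u - c) by rewrite divr_gt0 // subr_gt0.
case: (leP x c) (leP y c) => xc [yc|yc] //.
- by rewrite (le_lt_trans xc) // ltrDl mulr_gt0 // subr_gt0.
- by have := lt_trans xc xy; rewrite ltNge yc.
- by rewrite ltrD2l ltr_pM2r // ltrD2r.
Qed.

Definition oaut_stretch c u v (cu : c < u) (cv : c < v) : oaut R :=
  OAut (stretchK cu cv) (stretchK cv cu) (stretch_inc cu cv).

Let shift_inc (t : R) : {homo +%R t : x y / x < y}.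
Proof. by move=> x y; rewrite ltrD2l. Qed.
Definition oaut_shift t : oaut R :=
  OAut (addKr t) (addNKr t) (@shift_inc t).

Lemma stretch_l c u v x : x <= c -> stretch c u v x = x.
Proof. by rewrite /stretch => ->. Qed.

Lemma stretch_r c u v : c < u -> stretch c u v u = v.
Proof.
move=> cu; rewrite /stretch leNgt cu /= mulrC divfK; last first.
  by rewrite subr_eq0 gt_eqF.
by rewrite addrC subrK.
Qed.

Lemma oautM g h x : (g * h)%g x = g (h x).
Proof. by []. Qed.

Lemma oaut_homogeneous (s : seq (R * R)) :
  {in s &, forall p q, (p.1 < q.1) = (p.2 < q.2)} ->
  exists g : oaut R, {in s, forall p, g p.1 = p.2}.
Proof.
pose le1 (p q : R * R) := q.1 <= p.1.
have tot : total le1 by move=> p q; exact: le_total.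
have trn : transitive le1 by move=> p q r /= qp rq; exact: le_trans rq qp.
move=> sP; suff [g gP] : exists g : oaut R, {in sort le1 s, forall p, g p.1 = p.2}.
  by exists g => p ps; apply: gP; rewrite mem_sort.
have : {in sort le1 s &, forall p q, (p.1 < q.1) = (p.2 < q.2)}.
  by move=> p q; rewrite !mem_sort; exact: sP.
have := sort_sorted tot s.
elim: (sort le1 s) => [|p [|q t] IH] /=; first by exists 1%g.
  by move=> _ _; exists (oaut_shift (p.2 - p.1)) => _ /[!inE]/eqP-> /=; rewrite subrK.
move=> /andP[qp srt] cons.
have [r r' rs r's|g gP] := IH srt.
  by apply: cons; rewrite inE ?rs ?r's orbT.
have [pq|pq] := eqVneq p.1 q.1.
  exists g => r; rewrite inE => /predU1P[->|/gP//].
  rewrite pq gP ?mem_head //; apply/eqP; rewrite eq_le !leNgt.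
  by rewrite -!cons ?inE ?eqxx ?orbT // pq ltxx.
have {}qp : q.1 < p.1 by rewrite lt_neqAle eq_sym pq.
have c1 : q.2 < g p.1.
  by rewrite -(gP q) ?mem_head //; exact: oaut_inc.
have c2 : q.2 < p.2 by rewrite -cons ?inE ?eqxx ?orbT.
exists (oaut_stretch c1 c2 * g)%g => r; rewrite inE => /predU1P[->|rt].
  by rewrite oautM; exact: stretch_r.
have rqt : r \in p :: q :: t by rewrite inE rt orbT.
have qqt : q \in p :: q :: t by rewrite !inE eqxx orbT.
rewrite oautM (gP _ rt); apply: stretch_l.
rewrite leNgt -cons // -leNgt; move: rt; rewrite inE => /predU1P[->//|rt].
by have /allP/(_ _ rt) := order_path_min trn srt.
Qed.

End OautGroup.

Section GSets.
Variable R : realType.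
Local Notation G := (oaut R).

Record gset := GSet {
  gcar :> Type;
  act : G -> gcar -> gcar;
  act1 : forall x, act 1%g x = x;
  actM : forall g h x, act (g * h)%g x = act g (act h x)
}.
Arguments act {_} _ _.

Record gmap (X Y : gset) := GMap {
  gfun :> X -> Y;
  gfunE : forall g x, gfun (act g x) = act g (gfun x)
}.

Lemma gmap_eq (X Y : gset) (f f' : gmap X Y) : gfun f =1 gfun f' -> f = f'.
Proof.
case: f f' => [f fE] [f' f'E] /= ff'.
have ? : f = f' by apply/funext.
by subst f'; congr GMap; exact: Prop_irrelevance.
Qed.

Definition gmap_id (X : gset) : gmap X X :=
  @GMap X X id (fun _ _ => erefl).

Let comp_gfunE (X Y Z : gset) (f : gmap Y Z) (h : gmap X Y) g x :
  f (h (act g x)) = act g (f (h x)).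
Proof. by rewrite !gfunE. Qed.
Definition gmap_comp (X Y Z : gset) (f : gmap Y Z) (h : gmap X Y) :
  gmap X Z := GMap (comp_gfunE f h).

Definition orbit (X : gset) (x : X) : set X :=
  [set y | exists g, y = act g x].

Definition stabilizer (X : gset) (x : X) : set G := [set g | act g x = x].

Lemma actK (X : gset) g (x : X) : act g^-1%g (act g x) = x.
Proof. by rewrite -actM mulVg act1. Qed.

Lemma actKV (X : gset) g (x : X) : act g (act g^-1%g x) = x.
Proof. by rewrite -actM mulgV act1. Qed.

Lemma orbit_refl (X : gset) (x : X) : orbit x x.
Proof. by exists 1%g; rewrite act1. Qed.

Lemma orbit_act (X : gset) g (x : X) : orbit (act g x) = orbit x.
Proof.
apply/seteqP; split => y /= [h ->]; first by exists (h * g)%g; rewrite actM.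
by exists (h * g^-1)%g; rewrite actM actK.
Qed.

Lemma orbit_eq (X : gset) (x y : X) : orbit x y -> orbit y = orbit x.
Proof. by move=> [g ->]; rewrite orbit_act. Qed.

(* The objects of S(G) *)
Record sset := SSet {
  sset_gset :> gset;
  sset_open : forall x : sset_gset, open_subgroup (stabilizer x);
  sset_fin : finite_set (range (@orbit sset_gset))
}.

Record tset := TSet {
  tset_sset :> sset;
  tset_trans : exists x : tset_sset, orbit x = setT
}.

Lemma fin_orbits_rep (X : gset) : finite_set (range (@orbit X)) ->
  exists (n : nat) (r : 'I_n -> X), forall x, exists i, orbit (r i) x.
Proof.
move=> /finite_seqP[s sE].
have sP (i : 'I_(size s)) : exists x, tnth (in_tuple s) i = orbit x.
  have : [set` s] (tnth (in_tuple s) i) by rewrite /= mem_tnth.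
  by rewrite -sE => -[x _ <-]; exists x.
exists (size s), (fun i => sval (cid (sP i))) => x.
have : [set` s] (orbit x) by rewrite -sE; exists x.
move=> /= xs; have /tnthP[i xi] : orbit x \in in_tuple s by [].
exists i; case: (cid (sP i)) => y /= yi.
by rewrite -yi -xi; exact: orbit_refl.
Qed.

Lemma open_subgroup_fin (n : nat) (H : 'I_n -> set G) :
  (forall i, open_subgroup (H i)) ->
  exists A, forall i, pointwise_stab A `<=` H i.
Proof.
move=> HP; pose A i := sval (cid (HP i)).
exists (flatten [seq A i | i : 'I_n]) => i g gA.
apply: (svalP (cid (HP i))) => a ai; apply: gA.
by apply/flattenP; exists (A i) => //; apply: map_f; rewrite mem_enum.
Qed.

Let prod_act (X Y : gset) (g : G) (p : X * Y) := (act g p.1, act g p.2).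
Let prod_act1 (X Y : gset) (p : X * Y) : prod_act 1%g p = p.
Proof. by case: p => x y; rewrite /prod_act /= !act1. Qed.
Let prod_actM (X Y : gset) g h (p : X * Y) :
  prod_act (g * h)%g p = prod_act g (prod_act h p).
Proof. by rewrite /prod_act /= !actM. Qed.
Definition prod_gset (X Y : gset) : gset :=
  GSet (@prod_act1 X Y) (@prod_actM X Y).

Lemma prod_fin (X Y : sset) : finite_set (range (@orbit (prod_gset X Y))).
Proof.
have [n [r rP]] := fin_orbits_rep (sset_fin X).
have [m [s sP]] := fin_orbits_rep (sset_fin Y).
have [A AP] := open_subgroup_fin (fun i => sset_open (r i)).
have [B BP] := open_subgroup_fin (fun j => sset_open (s j)).
pose pts (g h : G) := map g A ++ map h B.
pose N := (size A + size B)%N.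
have size_pts g h : size (pts g h) = N by rewrite size_cat !size_map.
pose pattern g h : {ffun 'I_N * 'I_N -> bool} :=
  [ffun uv : 'I_N * 'I_N => nth 0 (pts g h) uv.1 < nth 0 (pts g h) uv.2].
pose Z := prod_gset X Y.
pose c (t : 'I_n * 'I_m * {ffun 'I_N * 'I_N -> bool}) : set Z :=
  xget set0 [set O | exists g h, pattern g h = t.2 /\
                 O = @orbit Z (act g (r t.1.1), act h (s t.1.2))].
apply: (@sub_finite_set _ _ (range c)); last first.
  exact/finite_image/finite_finset.
move=> _ [[x y] _ <-].
have [i [g ->]] := rP x; have [j [h ->]] := sP y.
exists (i, j, pattern g h) => //; rewrite /c.
case: xgetP => [O _ [g' [h' [pat ->]]]|/(_ (@orbit Z (act g (r i), act h (s j))))]; last first.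
  by case; exists g, h.
have [|u uP] := @oaut_homogeneous R (zip (pts g h) (pts g' h')).
  move=> p q /(nthP (0, 0))[a + <-] /(nthP (0, 0))[b + <-].
  rewrite !size_zip !size_pts minnn => aN bN.
  rewrite !nth_zip ?size_pts //=.
  by have /ffunP/(_ (Ordinal aN, Ordinal bN)) := pat; rewrite !ffunE.
rewrite /= -(@orbit_act Z u (act g (r i), act h (s j))) /= /prod_act /= -!actM.
have mem a b : (a, b) \in zip (pts g h) (pts g' h') -> u a = b by move/uP.
have zipcat : zip (pts g h) (pts g' h')
    = zip (map g A) (map g' A) ++ zip (map h B) (map h' B).
  by rewrite /pts zip_cat // !size_map.
have zipm (D : seq R) (f f' : G) d : d \in D -> (f d, f' d) \in zip (map f D) (map f' D).
  elim: D => //= e D IH; rewrite !inE => /predU1P[->|/IH->]; first by rewrite eqxx.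
  by rewrite orbT.
have -> : act (u * g)%g (r i) = act g' (r i).
  rewrite -[LHS](actKV g'); congr act; rewrite -actM; apply: AP => a aA /=.
  rewrite (mem _ (g' a)) ?oaut_funK //.
  by rewrite zipcat mem_cat zipm.
have -> // : act (u * h)%g (s j) = act h' (s j).
rewrite -[LHS](actKV h'); congr act; rewrite -actM; apply: BP => a aA /=.
rewrite (mem _ (h' a)) ?oaut_funK //.
by rewrite zipcat mem_cat zipm ?orbT.
Qed.

Let prod_open (X Y : sset) (p : prod_gset X Y) : open_subgroup (stabilizer p).
Proof.
case: p => x y; have [A AP] := sset_open x; have [B BP] := sset_open y.
exists (A ++ B) => g gAB; rewrite /stabilizer /= /prod_act /=.
rewrite AP ?BP // => a aA; apply: gAB; by rewrite mem_cat aA ?orbT.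
Qed.
Definition prod_sset (X Y : sset) : sset := SSet (@prod_open X Y) (prod_fin X Y).
Canonical prod_sset.

Let sum_act (X Y : gset) (g : G) (p : X + Y) : X + Y :=
  match p with inl x => inl (act g x) | inr y => inr (act g y) end.
Let sum_act1 (X Y : gset) (p : X + Y) : sum_act 1%g p = p.
Proof. by case: p => x /=; rewrite act1. Qed.
Let sum_actM (X Y : gset) g h (p : X + Y) :
  sum_act (g * h)%g p = sum_act g (sum_act h p).
Proof. by case: p => x /=; rewrite actM. Qed.
Definition sum_gset (X Y : gset) : gset :=
  GSet (@sum_act1 X Y) (@sum_actM X Y).

Let sum_open (X Y : sset) (p : sum_gset X Y) : open_subgroup (stabilizer p).
Proof.
case: p => x; have [A AP] := sset_open x; exists A => g gA;
  by rewrite /stabilizer /= AP.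
Qed.
Let sum_fin (X Y : sset) : finite_set (range (@orbit (sum_gset X Y))).
Proof.
apply: (@sub_finite_set _ _ ((fun T => inl @` T) @` range (@orbit X)
    `|` (fun T => inr @` T) @` range (@orbit Y))); last first.
  by rewrite finite_setU; split; apply: finite_image; exact: sset_fin.
move=> _ [[x|y] _ <-]; [left|right].
  exists (orbit x); first by exists x.
  apply/seteqP; split => [_ [_ [g ->] <-]|_ [g ->]]; first by exists g.
  by exists (act g x) => //; exists g.
exists (orbit y); first by exists y.
apply/seteqP; split => [_ [_ [g ->] <-]|_ [g ->]]; first by exists g.
by exists (act g y) => //; exists g.
Qed.
Definition sum_sset (X Y : sset) : sset := SSet (@sum_open X Y) (@sum_fin X Y).
Canonical sum_sset.

Lemma sval_eq (T : Type) (P : T -> Prop) (p q : {x | P x}) :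
  sval p = sval q -> p = q.
Proof. by case: p q => [x xP] [y yP] /= xy; exact: eq_exist. Qed.

Definition ginv (X : gset) (P : set X) := forall g x, P x -> P (act g x).

Section Sub.
Variables (X : gset) (P : set X) (Pinv : ginv P).
Let sub_act (g : G) (p : {x | P x}) : {x | P x} :=
  exist _ (act g (sval p)) (Pinv g (svalP p)).
Let sub_act1 p : sub_act 1%g p = p.
Proof. by apply: sval_eq; exact: act1. Qed.
Let sub_actM g h p : sub_act (g * h)%g p = sub_act g (sub_act h p).
Proof. by apply: sval_eq; exact: actM. Qed.
Definition sub_gset : gset := GSet sub_act1 sub_actM.
Definition sub_incl : gmap sub_gset X := @GMap sub_gset X sval (fun _ _ => erefl).

Lemma sub_orbit (p : sub_gset) : orbit p = [set q | orbit (sval p) (sval q)].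
Proof.
apply/seteqP; split => q /= [g qE]; exists g; first by rewrite qE.
exact: sval_eq.
Qed.
End Sub.

Let sub_open (X : sset) (P : set X) (Pinv : ginv P) (p : sub_gset Pinv) :
  open_subgroup (stabilizer p).
Proof.
have [A AP] := sset_open (sval p); exists A => g gA.
by apply: sval_eq; exact: AP.
Qed.
Let sub_fin (X : sset) (P : set X) (Pinv : ginv P) :
  finite_set (range (@orbit (sub_gset Pinv))).
Proof.
apply: (@sub_finite_set _ _
  ((fun T => [set q : sub_gset Pinv | T (sval q)]) @` range (@orbit X))).
  by move=> _ [p _ <-]; exists (orbit (sval p)); rewrite ?sub_orbit //; exists (sval p).
exact/finite_image/sset_fin.
Qed.
Definition sub_sset (X : sset) (P : set X) (Pinv : ginv P) : sset :=
  SSet (sub_open (Pinv := Pinv)) (sub_fin Pinv).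

Let fib_inv (X Y Z : gset) (f : gmap X Z) (h : gmap Y Z) :
  @ginv (prod_gset X Y) [set p | f p.1 = h p.2].
Proof. by move=> g [x y] /= fh; rewrite !gfunE fh. Qed.
Definition fib_sset (X Y Z : sset) (f : gmap X Z) (h : gmap Y Z) : sset :=
  @sub_sset (prod_sset X Y) _ (@fib_inv X Y Z f h).

Definition fib_fst (X Y Z : sset) (f : gmap X Z) (h : gmap Y Z) :
    gmap (fib_sset f h) X :=
  @GMap (fib_sset f h) X (fun p => (sval p).1) (fun _ _ => erefl).
Definition fib_snd (X Y Z : sset) (f : gmap X Z) (h : gmap Y Z) :
    gmap (fib_sset f h) Y :=
  @GMap (fib_sset f h) Y (fun p => (sval p).2) (fun _ _ => erefl).

Record orb (X : sset) := Orb {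
  orb_set :> set X;
  orbP : exists x, orb_set = orbit x
}.

Lemma orb_eq (X : sset) (S T : orb X) : orb_set S = orb_set T -> S = T.
Proof.
case: S T => [S SP] [T TP] /= ST; subst T.
by congr Orb; exact: Prop_irrelevance.
Qed.

Definition orb_of (X : sset) (x : X) : orb X := Orb (ex_intro _ x erefl).

Lemma orb_rep (X : sset) (T : orb X) : exists x, T = orb_of x.
Proof. by case: T => T [x TE]; exists x; exact: orb_eq. Qed.

Lemma orb_ofP (X : sset) (x y : X) : orb_of x = orb_of y <-> orbit y x.
Proof.
split=> [[xy]|xy]; first by rewrite -xy; exact: orbit_refl.
by apply: orb_eq => /=; exact: orbit_eq.
Qed.

Lemma orb_of_act (X : sset) g (x : X) : orb_of (act g x) = orb_of x.
Proof. by apply: orb_eq; exact: orbit_act. Qed.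

Lemma orb_mem (X : sset) (T : orb X) x : orb_set T x -> T = orb_of x.
Proof. by have [y ->] := orb_rep T => xy; apply/esym/orb_ofP. Qed.

Section OrbFinite.
Variable X : sset.
Let orb_enum : exists n : nat, exists r : 'I_n -> X, forall x, exists i, orbit (r i) x.
Proof. exact: fin_orbits_rep (sset_fin X). Qed.
Let n := projT1 (cid orb_enum).
Let rE := cid (projT2 (cid orb_enum)).
Let e (i : 'I_n) : orb X := orb_of (projT1 rE i).
Let eP T : exists i, e i = T.
Proof.
have [x ->] := orb_rep T; have [i ix] := projT2 rE x.
by exists i; apply/esym/orb_ofP.
Qed.
Let e' T : 'I_n := sval (cid (eP T)).
Let e'K : cancel e' e.
Proof. by move=> T; exact: svalP (cid (eP T)). Qed.
HB.instance Definition _ := Finite.copy (orb X) (can_type e'K).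
End OrbFinite.

Lemma orb_inv (X : sset) (T : orb X) : ginv T.
Proof.
have [x ->] := orb_rep T; move=> g y [h ->].
by exists (g * h)%g; rewrite actM.
Qed.

Lemma orb_tset_subproof (X : sset) (T : orb X) :
  exists x : sub_sset (@orb_inv X T), orbit x = setT.
Proof.
have [x TE] := orb_rep T; have Tx : orb_set T x by rewrite TE; exact: orbit_refl.
exists (exist _ x Tx); rewrite sub_orbit; apply/seteqP; split=> // -[y] /= + _.
by rewrite TE.
Qed.
Definition orb_tset (X : sset) (T : orb X) : tset :=
  TSet (@orb_tset_subproof X T).

Definition orb_incl (X : sset) (T : orb X) : gmap (orb_tset T) X :=
  sub_incl (@orb_inv X T).

Lemma orb_im_subproof (X Y : sset) (f : gmap X Y) (T : orb X) :
  exists y, f @` T = orbit y.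
Proof.
have [x ->] := orb_rep T; exists (f x); apply/seteqP; split=> [_ [_ [g ->] <-]|].
  by exists g; rewrite gfunE.
by move=> _ [g ->]; exists (act g x); [exists g|rewrite gfunE].
Qed.
Definition orb_im (X Y : sset) (f : gmap X Y) (T : orb X) : orb Y :=
  Orb (orb_im_subproof f T).

Let orb_res_fun (X Y : sset) (f : gmap X Y) (T : orb X)
    (p : orb_tset T) : orb_tset (orb_im f T) :=
  exist _ (f (sval p)) (ex_intro2 _ _ (sval p) (svalP p) erefl).
Let orb_res_funE (X Y : sset) (f : gmap X Y) (T : orb X) g p :
  @orb_res_fun X Y f T (act g p) = act g (orb_res_fun f p).
Proof. by apply: sval_eq; rewrite /= gfunE. Qed.
Definition orb_res (X Y : sset) (f : gmap X Y) (T : orb X) :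
  gmap (orb_tset T) (orb_tset (orb_im f T)) := GMap (@orb_res_funE X Y f T).

Lemma orb_im_of (X Y : sset) (f : gmap X Y) x :
  orb_im f (orb_of x) = orb_of (f x).
Proof. by apply: orb_mem; exists x => //; exact: orbit_refl. Qed.

Definition pt_gset : gset :=
  @GSet unit (fun _ x => x) (fun=> erefl) (fun _ _ _ => erefl).
Let pt_open (x : pt_gset) : open_subgroup (stabilizer x).
Proof. by exists [::]. Qed.
Let pt_trans : exists x : pt_gset, orbit x = setT.
Proof.
by exists tt; apply/seteqP; split=> // -[] _; exact: orbit_refl.
Qed.

Lemma trans_fin (X : gset) : (exists x : X, orbit x = setT) ->
  finite_set (range (@orbit X)).
Proof.
move=> [x xT]; apply: (@sub_finite_set _ _ [set setT]); last exact: finite_set1.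
move=> _ [y _ <-] /=; rewrite -xT; apply: orbit_eq; by rewrite xT.
Qed.

Definition pt_sset : sset := SSet pt_open (trans_fin pt_trans).
Canonical pt_sset.
Definition pt_tset : tset := @TSet pt_sset pt_trans.

Definition empty_gset : gset :=
  @GSet False (fun _ x => x) (fun=> erefl) (fun _ _ _ => erefl).
Let empty_open (x : empty_gset) : open_subgroup (stabilizer x).
Proof. by case: x. Qed.
Let empty_fin : finite_set (range (@orbit empty_gset)).
Proof.
by apply: (@sub_finite_set _ _ set0); [move=> _ [[]]|exact: finite_set0].
Qed.
Definition empty_sset : sset := SSet empty_open empty_fin.

Definition line_gset : gset :=
  @GSet R (fun g x => g x) (fun=> erefl) (fun _ _ _ => erefl).
Let line_open (x : line_gset) : open_subgroup (stabilizer x).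
Proof. by exists [:: x] => g /(_ x); rewrite inE; exact. Qed.
Let line_trans : exists x : line_gset, orbit x = setT.
Proof.
exists (0 : R); apply/seteqP; split=> // y _.
by exists (oaut_shift y) => /=; rewrite addr0.
Qed.
Definition line_sset : sset := SSet line_open (trans_fin line_trans).
Canonical line_sset.
Definition line_tset : tset := @TSet line_sset line_trans.

Let line2_inv : @ginv (prod_gset line_gset line_gset) [set p | p.1 < p.2].
Proof. by move=> g [x y] /=; exact: oaut_inc. Qed.
Definition line2_sset : sset := @sub_sset (prod_sset line_sset line_sset) _ line2_inv.
Let line2_trans : exists x : line2_sset, orbit x = setT.
Proof.
exists (exist (fun p : R * R => p.1 < p.2) (0, 1) ltr01).
apply/seteqP; split=> // -[[x y] /= xy] _.
have [|g gP] := @oaut_homogeneous R [:: (0, x); (1, y)].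
  by move=> p q; rewrite !inE => /orP[]/eqP-> /orP[]/eqP-> /=;
    rewrite ?ltxx ?ltr01 ?xy // ltr10 ltNge ltW.
exists g; apply: eq_exist => /=.
by rewrite /prod_act /= (gP (0, x)) ?(gP (1, y)) // !inE eqxx ?orbT.
Qed.
Definition line2_tset : tset := @TSet line2_sset line2_trans.

Definition to_pt (X : gset) : gmap X pt_gset :=
  @GMap X pt_gset (fun=> tt) (fun _ _ => erefl).

Section Maps.
Variables X Y : gset.
Definition gfst : gmap (prod_gset X Y) X :=
  @GMap (prod_gset X Y) X fst (fun _ _ => erefl).
Definition gsnd : gmap (prod_gset X Y) Y :=
  @GMap (prod_gset X Y) Y snd (fun _ _ => erefl).
Definition ginl : gmap X (sum_gset X Y) :=
  @GMap X (sum_gset X Y) inl (fun _ _ => erefl).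
Definition ginr : gmap Y (sum_gset X Y) :=
  @GMap Y (sum_gset X Y) inr (fun _ _ => erefl).
Definition gdiag : gmap X (prod_gset X X) :=
  @GMap X (prod_gset X X) (fun x => (x, x)) (fun _ _ => erefl).
Variables (Z : gset) (f : gmap Z X) (h : gmap Z Y).
Let pair_gfunE g z : (f (act g z), h (act g z)) = act g ((f z, h z) : prod_gset X Y).
Proof. by rewrite !gfunE. Qed.
Definition gpair : gmap Z (prod_gset X Y) := @GMap Z (prod_gset X Y) _ pair_gfunE.
End Maps.

Definition line2_incl : gmap line2_sset (prod_gset line_gset line_gset) :=
  sub_incl line2_inv.

End GSets.

Record gmeasure (R : realType) (k : fieldType) := GMeasure {
  gval : forall Y X : tset R, gmap Y X -> k;
  mu_iso : forall (Y X : tset R) (f : gmap Y X),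
    bijective f -> gval f = 1;
  mu_comp : forall (Z Y X : tset R) (f : gmap Y X) (h : gmap Z Y),
    gval (gmap_comp f h) = gval f * gval h;
  mu_base : forall (Y X X' : tset R) (f : gmap Y X) (h : gmap X' X),
    gval f = \sum_(T : orb (fib_sset f h))
               gval (gmap_comp (fib_snd f h) (orb_incl T))
}.

Arguments gval {R k} g {Y X}.

Section InvariantFunctions.
Variables (R : realType) (k : fieldType).

Record inv_fun (X : gset R) := InvFun {
  ifun :> X -> k;
  ifunE : forall g x, ifun (act g x) = ifun x
}.

Lemma ifun_eq (X : gset R) (f f' : inv_fun X) : ifun f =1 ifun f' -> f = f'.
Proof.
case: f f' => [f fE] [f' f'E] /= ff'.
have ? : f = f' by apply/funext.
by subst f'; congr InvFun; exact: Prop_irrelevance.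
Qed.

Section Lmodule.
Variable X : gset R.

HB.instance Definition _ := gen_eqMixin (inv_fun X).
HB.instance Definition _ := gen_choiceMixin (inv_fun X).

Definition ifun_cst (c : k) : inv_fun X := @InvFun X (fun=> c) (fun _ _ => erefl).

Let addE (f f' : inv_fun X) g x :
  f (act g x) + f' (act g x) = f x + f' x.
Proof. by rewrite !ifunE. Qed.
Definition ifun_add (f f' : inv_fun X) : inv_fun X :=
  InvFun (addE f f').

Let mulE (f f' : inv_fun X) g x :
  f (act g x) * f' (act g x) = f x * f' x.
Proof. by rewrite !ifunE. Qed.
Definition ifun_mul (f f' : inv_fun X) : inv_fun X :=
  InvFun (mulE f f').

Definition ifun_scale c f := ifun_mul (ifun_cst c) f.
Definition ifun_opp f := ifun_scale (-1) f.

Let addA : associative ifun_add.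
Proof. by move=> *; apply: ifun_eq => x /=; rewrite addrA. Qed.
Let addC : commutative ifun_add.
Proof. by move=> *; apply: ifun_eq => x /=; rewrite addrC. Qed.
Let add0 : left_id (ifun_cst 0) ifun_add.
Proof. by move=> *; apply: ifun_eq => x /=; rewrite add0r. Qed.
Let addN : left_inverse (ifun_cst 0) ifun_opp ifun_add.
Proof. by move=> *; apply: ifun_eq => x /=; rewrite mulN1r addNr. Qed.
HB.instance Definition _ :=
  GRing.isZmodule.Build (inv_fun X) addA addC add0 addN.

Let scaleA a b (f : inv_fun X) :
  ifun_scale a (ifun_scale b f) = ifun_scale (a * b) f.
Proof. by apply: ifun_eq => x /=; rewrite mulrA. Qed.
Let scale1 : left_id 1 ifun_scale.
Proof. by move=> f; apply: ifun_eq => x /=; rewrite mul1r. Qed.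
Let scaleDr : right_distributive ifun_scale +%R.
Proof. by move=> a f g; apply: ifun_eq => x /=; rewrite mulrDr. Qed.
Let scaleDl (f : inv_fun X) : {morph ifun_scale^~ f : a b / a + b}.
Proof. by move=> a b; apply: ifun_eq => x /=; rewrite mulrDl. Qed.
HB.instance Definition _ :=
  GRing.Zmodule_isLmodule.Build k (inv_fun X) scaleA scale1 scaleDr scaleDl.

Lemma ifunD (f f' : inv_fun X) x : (f + f') x = f x + f' x.
Proof. by []. Qed.
Lemma ifunZ c (f : inv_fun X) x : (c *: f) x = c * f x.
Proof. by []. Qed.
Lemma ifun0 x : (0 : inv_fun X) x = 0.
Proof. by []. Qed.
End Lmodule.

Lemma ifun_mulC (X : gset R) (f f' : inv_fun X) :
  ifun_mul f f' = ifun_mul f' f.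
Proof. by apply: ifun_eq => x; rewrite /= mulrC. Qed.

Let pull_ifunE (X Y : gset R) (f : gmap Y X) (phi : inv_fun X) g y :
  phi (f (act g y)) = phi (f y).
Proof. by rewrite gfunE ifunE. Qed.
Definition ifun_pull (X Y : gset R) (f : gmap Y X) (phi : inv_fun X) :
  inv_fun Y := InvFun (pull_ifunE f phi).

Definition ifun_orb (X : sset R) (phi : inv_fun X) (T : orb X) : k :=
  phi (sval (cid (orbP T))).

Arguments ifun_orb : simpl never.

Lemma ifun_orb_of (X : sset R) (phi : inv_fun X) x :
  ifun_orb phi (orb_of x) = phi x.
Proof.
rewrite /ifun_orb; case: cid => y /= xy.
have [g ->] : orbit y x by rewrite -xy; exact: orbit_refl.
by rewrite ifunE.
Qed.

Lemma ifun_orbE (X : sset R) (phi : inv_fun X) (T : orb X) x :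
  T = orb_of x -> ifun_orb phi T = phi x.
Proof. by move=> ->; exact: ifun_orb_of. Qed.

Variable mu : gmeasure R k.

(* mu (T -> f(T)) *)
Definition mu_orb (X Y : sset R) (f : gmap X Y) (T : orb X) : k :=
  gval mu (orb_res f T).

Lemma mu_orbE (X Y : sset R) (f : gmap X Y) (T : orb X) (W : orb Y)
    (r : gmap (orb_tset T) (orb_tset W)) :
  (forall p, sval (r p) = f (sval p)) -> gval mu r = mu_orb f T.
Proof.
move=> rE; have WE : W = orb_im f T.
  have [x TE] := orb_rep T.
  have Tx : orb_set T x by rewrite TE; exact: orbit_refl.
  rewrite TE orb_im_of; apply: orb_mem.
  by rewrite -(rE (exist _ x Tx)); exact: svalP.
subst W; congr (gval mu _); apply: gmap_eq => p; apply: sval_eq; exact: rE.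
Qed.

Lemma mu_orb_comp (X Y Z : sset R) (h : gmap Y Z) (f : gmap X Y) (T : orb X) :
  mu_orb (gmap_comp h f) T = mu_orb h (orb_im f T) * mu_orb f T.
Proof. by rewrite /mu_orb -mu_comp; apply/esym; exact: mu_orbE. Qed.

Lemma inj_surj_bij (A B : Type) (f : A -> B) :
  injective f -> (forall b, exists a, f a = b) -> bijective f.
Proof.
move=> fI fS; exists (fun b => sval (cid (fS b))) => [a|b].
  by apply: fI; exact: svalP (cid (fS (f a))).
exact: svalP (cid (fS b)).
Qed.

Lemma mu_orb_inj (X Y : sset R) (f : gmap X Y) (T : orb X) :
  injective f -> mu_orb f T = 1.
Proof.
move=> fI; apply: mu_iso; apply: inj_surj_bij.
  by move=> p q /(congr1 sval) /= /fI; exact: sval_eq.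
by move=> [y yT]; case: (yT) => x Tx xy; exists (exist _ x Tx); exact: sval_eq.
Qed.

Lemma orb_im_inj (X Y : sset R) (f : gmap X Y) :
  injective f -> injective (orb_im f).
Proof.
move=> fI S T; have [x ->] := orb_rep S; have [y ->] := orb_rep T.
rewrite !orb_im_of => /orb_ofP[g]; rewrite -gfunE => /fI ->.
by rewrite orb_of_act.
Qed.

Section MuBase.
Variables (X Y Z : sset R) (f : gmap X Z) (h : gmap Y Z).
Variables (T : orb X) (S : orb Y).
Hypothesis TS : orb_im f T = orb_im h S.

Let r_mem (p : orb_tset S) : orb_set (orb_im f T) (h (sval p)).
Proof. by rewrite TS; exists (sval p) => //; exact: svalP. Qed.
Let r_fun (p : orb_tset S) : orb_tset (orb_im f T) := exist _ _ (r_mem p).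
Let r_funE g p : r_fun (act g p) = act g (r_fun p).
Proof. by apply: sval_eq; rewrite /= gfunE. Qed.
Let r : gmap (orb_tset S) (orb_tset (orb_im f T)) := GMap r_funE.

Let e_mem (p : fib_sset (orb_res f T) r) :
  f (sval (sval p).1) = h (sval (sval p).2).
Proof. by have /(congr1 sval) := svalP p. Qed.
Let e_fun (p : fib_sset (orb_res f T) r) : fib_sset f h :=
  exist _ (sval (sval p).1, sval (sval p).2) (e_mem p).
Let e_funE g p : e_fun (act g p) = act g (e_fun p).
Proof. exact: sval_eq. Qed.
Let e : gmap (fib_sset (orb_res f T) r) (fib_sset f h) := GMap e_funE.

Let e_inj : injective e.
Proof.
move=> [[p q] pq] [[p' q'] pq'] /(congr1 sval) /= [pp' qq'].
by apply: sval_eq; congr pair; exact: sval_eq.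
Qed.

Lemma mu_orb_base : mu_orb f T =
  \sum_(U : orb (fib_sset f h)
        | (orb_im (fib_fst f h) U == T) && (orb_im (fib_snd f h) U == S))
     mu_orb (fib_snd f h) U.
Proof.
rewrite /mu_orb (mu_base _ _ r) (partition_big (orb_im e)
  (fun U => (orb_im (fib_fst f h) U == T) && (orb_im (fib_snd f h) U == S))).
  apply: eq_bigr => U /andP[/eqP U1 /eqP U2].
  have [u UE] := orb_rep U.
  have u1 : orb_set T (sval u).1.
    by rewrite -U1 UE orb_im_of; exact: orbit_refl.
  have u2 : orb_set S (sval u).2.
    by rewrite -U2 UE orb_im_of; exact: orbit_refl.
  have uP : orb_res f T (exist _ _ u1) = r (exist _ _ u2).
    by apply: sval_eq; exact: svalP u.
  pose v : fib_sset (orb_res f T) r :=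
    exist _ (exist _ _ u1, exist _ _ u2) uP.
  have vU : orb_im e (orb_of v) = U.
    rewrite orb_im_of UE; congr orb_of; apply: sval_eq => /=.
    by case: (sval u).
  rewrite (big_pred1 (orb_of v)).
    rewrite (@mu_orbE _ _ (gmap_comp (fib_snd f h) e)) //.
    by rewrite mu_orb_comp (mu_orb_inj _ e_inj) mulr1 vU.
  by move=> V /=; rewrite -vU (inj_eq (orb_im_inj e_inj)).
move=> V _; have [v ->] := orb_rep V; rewrite !orb_im_of.
by apply/andP; split; apply/eqP/esym/orb_mem; exact: svalP.
Qed.
End MuBase.

Let push_ifunE (X Y : sset R) (f : gmap X Y) (phi : inv_fun X) g y :
  \sum_(T : orb X | orb_im f T == orb_of (act g y)) ifun_orb phi T * mu_orb f T
  = \sum_(T : orb X | orb_im f T == orb_of y) ifun_orb phi T * mu_orb f T.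
Proof. by rewrite orb_of_act. Qed.
(* On an orbit W of Y, the push-forward of phi is the sum, over the orbits T of
   X mapping to W, of phi(T) mu(T -> W). *)
Definition ifun_push (X Y : sset R) (f : gmap X Y) (phi : inv_fun X) :
  inv_fun Y := InvFun (push_ifunE f phi).

Lemma push_comp (X Y Z : sset R) (h : gmap Y Z) (f : gmap X Y) phi :
  ifun_push h (ifun_push f phi) = ifun_push (gmap_comp h f) phi.
Proof.
apply: ifun_eq => z /=.
rewrite [RHS](partition_big (orb_im f) (fun S => orb_im h S == orb_of z)).
  apply: eq_bigr => S /eqP Sz; have [y SE] := orb_rep S.
  rewrite (ifun_orbE _ SE) /= mulr_suml -SE.
  have im T : orb_im (gmap_comp h f) T = orb_im h (orb_im f T).
    by have [x ->] := orb_rep T; rewrite !orb_im_of.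
  apply: eq_big => [T|T /eqP TS].
    by rewrite im; case: eqP => [->|]; rewrite ?Sz ?eqxx ?andbF.
  by rewrite mu_orb_comp TS -mulrA [X in _ * X]mulrC.
move=> T; have [x ->] := orb_rep T; by rewrite !orb_im_of.
Qed.

Lemma push_proj (X Y : sset R) (f : gmap X Y) phi (psi : inv_fun Y) :
  ifun_mul (ifun_push f phi) psi
  = ifun_push f (ifun_mul phi (ifun_pull f psi)).
Proof.
apply: ifun_eq => y /=; rewrite mulr_suml; apply: eq_bigr => T.
have [x ->] := orb_rep T; rewrite orb_im_of => /eqP/orb_ofP[g fx].
by rewrite !ifun_orb_of /= fx ifunE mulrAC.
Qed.

Lemma push_lin (X Y : sset R) (f : gmap X Y) : linear (ifun_push f).
Proof.
move=> a phi psi; apply: ifun_eq => y.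
rewrite ifunD ifunZ /= mulr_sumr -big_split /=; apply: eq_bigr => T _.
have [x ->] := orb_rep T; rewrite !ifun_orb_of ifunD ifunZ.
by rewrite mulrDl mulrA.
Qed.

Lemma push_inj (X Y : sset R) (f : gmap X Y) phi x :
  injective f -> ifun_push f phi (f x) = phi x.
Proof.
move=> fI /=; rewrite (big_pred1 (orb_of x)).
  by rewrite ifun_orb_of mu_orb_inj // mulr1.
by move=> T /=; rewrite -orb_im_of (inj_eq (orb_im_inj fI)).
Qed.

Lemma push_notin (X Y : sset R) (f : gmap X Y) phi y :
  ~ range f y -> ifun_push f phi y = 0.
Proof.
move=> fy /=; rewrite big_pred0 // => T; apply/eqP => Ty; apply: fy.
have : orb_set (orb_im f T) y by rewrite Ty; exact: orbit_refl.
by move=> [x _ <-]; exists x.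
Qed.

Lemma push_fib (X Y Z : sset R) (f : gmap X Z) (h : gmap Y Z) phi :
  ifun_pull h (ifun_push f phi)
  = ifun_push (fib_snd f h) (ifun_pull (fib_fst f h) phi).
Proof.
apply: ifun_eq => y /=.
rewrite [RHS](partition_big (orb_im (fib_fst f h))
  (fun T => orb_im f T == orb_of (h y))).
  apply: eq_bigr => T /eqP Ty.
  rewrite (@mu_orb_base _ _ _ _ h T (orb_of y)) ?orb_im_of // mulr_sumr.
  apply: eq_big => [U|U /andP[/eqP UT _]]; first by rewrite andbC.
  congr (_ * _); have [u UE] := orb_rep U.
  by rewrite (ifun_orbE _ UE); apply: ifun_orbE; rewrite -UT UE orb_im_of.
move=> U; have [u ->] := orb_rep U; rewrite !orb_im_of => /eqP/orb_ofP uy.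
apply/eqP/orb_ofP; rewrite [fib_fst f h u]/= (svalP u).
by case: uy => g /= ->; exists g; rewrite gfunE.
Qed.

Lemma push_cart (P X Y Z : sset R) (f : gmap X Z) (h : gmap Y Z)
    (a : gmap P X) (b : gmap P Y) phi :
  (forall p, f (a p) = h (b p)) ->
  (forall p q, a p = a q -> b p = b q -> p = q) ->
  (forall x y, f x = h y -> exists2 p, a p = x & b p = y) ->
  ifun_pull h (ifun_push f phi) = ifun_push b (ifun_pull a phi).
Proof.
move=> fa inj surj.
pose c_fun p : fib_sset f h := exist _ (a p, b p) (fa p).
have c_funE g p : c_fun (act g p) = act g (c_fun p).
  by apply: sval_eq; rewrite /= !gfunE.
pose c : gmap P (fib_sset f h) := GMap c_funE.
have cI : injective c by move=> p q /(congr1 sval) /= [] /inj; exact.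
rewrite push_fib.
have -> : ifun_push b (ifun_pull a phi)
  = ifun_push (gmap_comp (fib_snd f h) c) (ifun_pull a phi).
  by congr ifun_push; apply: gmap_eq.
rewrite -push_comp; congr ifun_push; apply: ifun_eq => -[[x y] xy].
have [p px py] := surj _ _ xy.
have -> : exist _ (x, y) xy = c p by apply: sval_eq; rewrite /= px py.
by rewrite push_inj.
Qed.

Lemma push_id (X : sset R) (f : gmap X X) phi :
  (forall x, f x = x) -> ifun_push f phi = phi.
Proof.
move=> fE; apply: ifun_eq => x; rewrite -[in LHS](fE x) push_inj //.
by move=> y z; rewrite !fE.
Qed.

End InvariantFunctions.

Section Perm.
Variables (R : realType) (k : fieldType) (mu : gmeasure R k).
Implicit Types X Y Z W : sset R.

(* A map C(X) -> C(Y) is an invariant function on Y * X. *)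
Definition perm_hom X Y := inv_fun k (prod_sset Y X).

Section Triple.
Variables Z Y X : sset R.
Definition triple : sset R := prod_sset (prod_sset Z Y) X.
Definition t12 : gmap triple (prod_sset Z Y) := gfst _ _.
Definition t13 : gmap triple (prod_sset Z X) :=
  gpair (gmap_comp (gfst Z Y) (gfst (prod_sset Z Y) X)) (gsnd _ _).
Definition t23 : gmap triple (prod_sset Y X) :=
  gpair (gmap_comp (gsnd Z Y) (gfst (prod_sset Z Y) X)) (gsnd _ _).
End Triple.

Definition perm_comp X Y Z (B : perm_hom Y Z) (A : perm_hom X Y) :
    perm_hom X Z :=
  ifun_push mu (t13 Z Y X)
    (ifun_mul (ifun_pull (t12 Z Y X) B) (ifun_pull (t23 Z Y X) A)).

Let graph_inv (X Y : gset R) (f : gmap Y X) g (p : prod_gset Y X) :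
  (`[< (act g p).2 = f (act g p).1 >])%:R = (`[< p.2 = f p.1 >])%:R :> k.
Proof.
congr (nat_of_bool _)%:R; apply: asbool_equiv_eq; case: p => y x /=.
by rewrite gfunE; split=> [/(congr1 (act g^-1%g))|->//]; rewrite !actK.
Qed.
(* f^* : C(X) -> C(Y), for f : Y -> X *)
Definition perm_pull X Y (f : gmap Y X) : perm_hom X Y :=
  InvFun (@graph_inv X Y f).
(* its transpose f_* : C(Y) -> C(X) *)
Definition perm_push X Y (f : gmap Y X) : perm_hom Y X :=
  ifun_pull (gpair (gsnd X Y) (gfst X Y)) (perm_pull f).

Definition perm_id X : perm_hom X X := perm_pull (gmap_id X).

Lemma perm_pullE X Y (f : gmap Y X) y x :
  perm_pull f (y, x) = (`[< x = f y >])%:R.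
Proof. by []. Qed.
Lemma perm_pushE X Y (f : gmap Y X) y x :
  perm_push f (x, y) = (`[< x = f y >])%:R.
Proof. by []. Qed.

Lemma perm_ext X Y (A B : perm_hom X Y) :
  (forall y x, A (y, x) = B (y, x)) -> A = B.
Proof. by move=> AB; apply: ifun_eq => -[y x]. Qed.

Lemma perm_compA X Y Z W (C : perm_hom Z W) (B : perm_hom Y Z)
    (A : perm_hom X Y) :
  perm_comp C (perm_comp B A) = perm_comp (perm_comp C B) A.
Proof.
pose Q := prod_sset (triple W Z Y) X.
pose wzy : gmap Q (triple W Z Y) := gfst _ _.
pose x4 : gmap Q X := gsnd _ _.
pose w : gmap Q W := gmap_comp (gfst W Z) (gmap_comp (t12 W Z Y) wzy).
pose z : gmap Q Z := gmap_comp (gsnd W Z) (gmap_comp (t12 W Z Y) wzy).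
pose y : gmap Q Y := gmap_comp (gsnd _ _) wzy.
pose wyx : gmap Q (triple W Y X) := gpair (gpair w y) x4.
pose wzx : gmap Q (triple W Z X) := gpair (gpair w z) x4.
pose zyx : gmap Q (triple Z Y X) := gpair (gpair z y) x4.
rewrite -[LHS]/(ifun_push mu (t13 W Z X) (ifun_mul (ifun_pull (t12 W Z X) C)
    (ifun_pull (t23 W Z X) (perm_comp B A)))).
rewrite -[RHS]/(ifun_push mu (t13 W Y X) (ifun_mul
    (ifun_pull (t12 W Y X) (perm_comp C B)) (ifun_pull (t23 W Y X) A))).
have -> : ifun_pull (t12 W Y X) (perm_comp C B)
  = ifun_push mu wyx (ifun_pull wzy
      (ifun_mul (ifun_pull (t12 W Z Y) C) (ifun_pull (t23 W Z Y) B))).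
  apply: push_cart => [[[[? ?] ?] ?]//| |].
    by move=> [[[? ?] ?] ?] [[[? ?] ?] ?] /= [-> -> ->] [->].
  move=> [[w0 z0] y0] [[w1 y1] x1] /= [<- <-].
  by exists (w0, z0, y0, x1).
have -> : ifun_pull (t23 W Z X) (perm_comp B A)
  = ifun_push mu wzx (ifun_pull zyx
      (ifun_mul (ifun_pull (t12 Z Y X) B) (ifun_pull (t23 Z Y X) A))).
  apply: push_cart => [[[[? ?] ?] ?]//| |].
    by move=> [[[? ?] ?] ?] [[[? ?] ?] ?] /= [-> -> ->] [->].
  move=> [[z0 y0] x0] [[w1 z1] x1] /= [-> ->].
  by exists (w1, z1, y0, x1).
rewrite ifun_mulC !push_proj !push_comp.
have -> : gmap_comp (t13 W Z X) wzx = gmap_comp (t13 W Y X) wyx by exact: gmap_eq.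
congr ifun_push; apply: ifun_eq => -[[[? ?] ?] ?] /=.
by rewrite [LHS]mulrC mulrA.
Qed.

Lemma perm_comp_pull X Y W (f : gmap Y X) (A : perm_hom W X) y w :
  perm_comp (perm_pull f) A (y, w) = A (f y, w).
Proof.
pose s : gmap (prod_sset Y W) (triple Y X W) :=
  gpair (gpair (gfst _ _) (gmap_comp f (gfst _ _))) (gsnd _ _).
have sI : injective s by move=> [? ?] [? ?] /= [-> _ ->].
rewrite /perm_comp.
have -> : ifun_pull (t12 Y X W) (perm_pull f) = ifun_push mu s (ifun_cst _ 1).
  apply: ifun_eq => -[[y' x'] w'].
  rewrite [LHS]/=; case: (asboolP (x' = f y')) => [->|ne].
    by rewrite -[RHS]/(ifun_push mu s _ (s (y', w'))) push_inj.
  by rewrite push_notin // => -[[a b] _ /= [ay ax _]]; apply: ne; rewrite -ax ay.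
rewrite push_proj push_comp push_id; last by case.
by rewrite /= mul1r.
Qed.

Lemma perm_comp_pullr X Y Z (f : gmap Y X) (A : perm_hom Y Z) :
  perm_comp A (perm_pull f)
  = ifun_push mu (gpair (gfst Z Y) (gmap_comp f (gsnd Z Y))) A.
Proof.
pose s : gmap (prod_sset Z Y) (triple Z Y X) :=
  gpair (gmap_id _) (gmap_comp f (gsnd _ _)).
have sI : injective s by move=> [? ?] [? ?] /= [-> ->].
rewrite /perm_comp.
have -> : ifun_pull (t23 Z Y X) (perm_pull f) = ifun_push mu s (ifun_cst _ 1).
  apply: ifun_eq => -[[z' y'] x'].
  rewrite [LHS]/=; case: (asboolP (x' = f y')) => [->|ne].
    by rewrite -[RHS]/(ifun_push mu s _ (s (z', y'))) push_inj.
  by rewrite push_notin // => -[[a b] _ /= [_ by' bx]]; apply: ne; rewrite -bx by'.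
rewrite ifun_mulC push_proj push_comp.
have -> : gmap_comp (t13 Z Y X) s = gpair (gfst Z Y) (gmap_comp f (gsnd Z Y)).
  exact: gmap_eq.
congr ifun_push; apply: ifun_eq => -[z y] /=; exact: mul1r.
Qed.

Lemma perm_comp_pullr_inj X Y Z (f : gmap Y X) (A : perm_hom Y Z) z y :
  injective f -> perm_comp A (perm_pull f) (z, f y) = A (z, y).
Proof.
move=> fI; rewrite perm_comp_pullr.
set h := gpair _ _; have hI : injective h.
  by move=> [? ?] [? ?] /= [-> /fI->].
by rewrite -[LHS]/(ifun_push mu h A (h (z, y))) push_inj.
Qed.

Lemma perm_comp_pullr_notin X Y Z (f : gmap Y X) (A : perm_hom Y Z) z x :
  ~ range f x -> perm_comp A (perm_pull f) (z, x) = 0.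
Proof.
move=> fx; rewrite perm_comp_pullr push_notin //.
by move=> [[? y] _ /= [_ yx]]; apply: fx; exists y.
Qed.

Lemma perm_comp1m X Y (A : perm_hom X Y) : perm_comp (perm_id Y) A = A.
Proof. by apply: perm_ext => y x; rewrite perm_comp_pull. Qed.

Lemma perm_compm1 X Y (A : perm_hom X Y) : perm_comp A (perm_id X) = A.
Proof.
apply: perm_ext => y x.
by have := @perm_comp_pullr_inj X X Y (gmap_id X) A y x (fun _ _ => id); exact.
Qed.

Lemma perm_pull_comp X Y Z (f : gmap Y X) (h : gmap Z Y) :
  perm_comp (perm_pull h) (perm_pull f) = perm_pull (gmap_comp f h).
Proof. by apply: perm_ext => z x; rewrite perm_comp_pull. Qed.

Definition perm_linear_cat : linear_cat k.
Proof.
refine (@LinearCat k (sset R) perm_hom perm_id perm_comp perm_compA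
  perm_comp1m perm_compm1 _ _).
- move=> X Y Z f a g g'; rewrite /perm_comp -push_lin; congr ifun_push.
  by apply: ifun_eq => t; rewrite !(ifunD, ifunZ) /= mulrDl mulrA.
- move=> X Y Z g a f f'; rewrite /perm_comp -push_lin; congr ifun_push.
  by apply: ifun_eq => t; rewrite !(ifunD, ifunZ) /= mulrDr mulrCA.
Defined.

Definition perm_additive_cat : additive_cat k.
Proof.
refine (@AdditiveCat k perm_linear_cat (empty_sset R) _ (@sum_sset R)
  (fun X Y => perm_push (ginl X Y)) (fun X Y => perm_push (ginr X Y))
  (fun X Y => perm_pull (ginl X Y)) (fun X Y => perm_pull (ginr X Y))
  _ _ _ _ _).
- by apply: perm_ext => -[].
- move=> X Y; apply: perm_ext => x' x.
  rewrite [LHS]perm_comp_pull perm_pushE; congr (nat_of_bool _)%:R.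
  by apply: asbool_equiv_eq; split=> [[->]|/= ->].
- move=> X Y; apply: perm_ext => x' x.
  rewrite [LHS]perm_comp_pull perm_pushE; congr (nat_of_bool _)%:R.
  by apply: asbool_equiv_eq; split=> [[->]|/= ->].
- move=> X Y; apply: perm_ext => x' x.
  by rewrite [LHS]perm_comp_pull perm_pushE asboolF.
- move=> X Y; apply: perm_ext => x' x.
  by rewrite [LHS]perm_comp_pull perm_pushE asboolF.
- move=> X Y; apply: perm_ext => s t.
  have lI : injective (ginl X Y) by move=> ? ? [].
  have rI : injective (ginr X Y) by move=> ? ? [].
  rewrite [LHS]ifunD.
  case: t => t.
    rewrite -[inl t]/(ginl X Y t) (perm_comp_pullr_inj _ _ _ lI).
    rewrite perm_comp_pullr_notin; last by move=> [].
    rewrite addr0 perm_pushE perm_pullE; congr (nat_of_bool _)%:R.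
    by apply: asbool_equiv_eq; split=> ->.
  rewrite -[inr t]/(ginr X Y t) (perm_comp_pullr_inj _ _ _ rI).
  rewrite perm_comp_pullr_notin; last by move=> [].
  rewrite add0r perm_pushE perm_pullE; congr (nat_of_bool _)%:R.
  by apply: asbool_equiv_eq; split=> ->.
Defined.

Section Tensor.
Variables X X' Y Y' : sset R.
Let p1 : gmap (prod_sset (prod_sset X' Y') (prod_sset X Y))
    (prod_sset X' X) :=
  gpair (gmap_comp (gfst _ _) (gfst _ _)) (gmap_comp (gfst _ _) (gsnd _ _)).
Let p2 : gmap (prod_sset (prod_sset X' Y') (prod_sset X Y))
    (prod_sset Y' Y) :=
  gpair (gmap_comp (gsnd _ _) (gfst _ _)) (gmap_comp (gsnd _ _) (gsnd _ _)).
Definition perm_tensm (A : perm_hom X X') (B : perm_hom Y Y') :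
    perm_hom (prod_sset X Y) (prod_sset X' Y') :=
  ifun_mul (ifun_pull p1 A) (ifun_pull p2 B).

Lemma perm_tensmE A B x y x' y' :
  perm_tensm A B ((x', y'), (x, y)) = A (x', x) * B (y', y).
Proof. by []. Qed.
End Tensor.

Lemma push_ext X X' Y Y' (f : gmap X X') (h : gmap Y Y')
    (phi : inv_fun k X) (psi : inv_fun k Y) x' y' :
  ifun_push mu (gpair (gmap_comp f (gfst X Y)) (gmap_comp h (gsnd X Y)) :
                 gmap (prod_sset X Y) (prod_sset X' Y'))
    (ifun_mul (ifun_pull (gfst X Y) phi) (ifun_pull (gsnd X Y) psi)) (x', y')
  = ifun_push mu f phi x' * ifun_push mu h psi y'.
Proof.
pose a : gmap (prod_sset X Y) (prod_sset X Y') :=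
  gpair (gfst _ _) (gmap_comp h (gsnd _ _)).
pose b : gmap (prod_sset X Y') (prod_sset X' Y') :=
  gpair (gmap_comp f (gfst _ _)) (gsnd _ _).
have -> : (gpair (gmap_comp f (gfst X Y)) (gmap_comp h (gsnd X Y)) :
            gmap (prod_sset X Y) (prod_sset X' Y')) = gmap_comp b a.
  exact: gmap_eq.
rewrite -push_comp.
have -> : ifun_push mu a
    (ifun_mul (ifun_pull (gfst X Y) phi) (ifun_pull (gsnd X Y) psi))
  = ifun_mul (ifun_pull (gfst X Y') phi)
      (ifun_pull (gsnd X Y') (ifun_push mu h psi)).
  rewrite (push_cart (P := prod_sset X Y) mu (a := gsnd X Y) (b := a)).
  - by rewrite ifun_mulC [RHS]ifun_mulC push_proj; congr ifun_push; exact: ifun_eq.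
  - by [].
  - by move=> [? ?] [? ?] /= -> [->].
  - by move=> y [x y1] /= yy1; exists (x, y); rewrite /= ?yy1.
have -> : ifun_pull (gsnd X Y') (ifun_push mu h psi)
  = ifun_pull b (ifun_pull (gsnd X' Y') (ifun_push mu h psi)).
  by apply: ifun_eq.
rewrite -push_proj.
rewrite -(push_cart (Z := X') mu (f := f) (h := gfst X' Y')) //.
- by move=> [? ?] [? ?] /= -> [->].
- by move=> x [x1 y1] /= <-; exists (x, y1).
Qed.

Lemma perm_tensm_comp X X' X'' Y Y' Y''
    (f' : perm_hom X' X'') (f : perm_hom X X')
    (g' : perm_hom Y' Y'') (g : perm_hom Y Y') :
  perm_tensm (perm_comp f' f) (perm_comp g' g)
  = perm_comp (perm_tensm f' g') (perm_tensm f g).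
Proof.
apply: ifun_eq => -[[x'' y''] [x y]].
rewrite perm_tensmE /perm_comp -push_ext.
set D := triple (prod_sset X'' Y'') (prod_sset X' Y') (prod_sset X Y).
set E := prod_sset (triple X'' X' X) (triple Y'' Y' Y).
pose d1 : gmap D (prod_sset X'' Y'') := gmap_comp (gfst _ _) (gfst _ _).
pose d2 : gmap D (prod_sset X' Y') := gmap_comp (gsnd _ _) (gfst _ _).
pose d3 : gmap D (prod_sset X Y) := gsnd _ _.
pose c : gmap D E := gpair
  (gpair (gpair (gmap_comp (gfst _ _) d1) (gmap_comp (gfst _ _) d2))
     (gmap_comp (gfst _ _) d3))
  (gpair (gpair (gmap_comp (gsnd _ _) d1) (gmap_comp (gsnd _ _) d2))
     (gmap_comp (gsnd _ _) d3)).
have cI : injective c.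
  by move=> [[[? ?] [? ?]] [? ?]] [[[? ?] [? ?]] [? ?]] /= [-> -> -> -> -> ->].
pose m : gmap (prod_sset (prod_sset X'' X) (prod_sset Y'' Y))
    (prod_sset (prod_sset X'' Y'') (prod_sset X Y)) :=
  gpair (gpair (gmap_comp (gfst _ _) (gfst _ _)) (gmap_comp (gfst _ _) (gsnd _ _)))
    (gpair (gmap_comp (gsnd _ _) (gfst _ _)) (gmap_comp (gsnd _ _) (gsnd _ _))).
have mI : injective m.
  by move=> [[? ?] [? ?]] [[? ?] [? ?]] /= [-> -> -> ->].
rewrite -[in LHS](push_inj mu _ _ mI) push_comp.
rewrite -[(m _)]/((x'', y''), (x, y)).
set phi := (X in ifun_push _ _ X _ = _).
have -> : phi = ifun_push mu c (ifun_pull c phi).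
  apply: ifun_eq => -[[[a1 a2] a3] [[b1 b2] b3]].
  by rewrite -[((a1, a2, a3), (b1, b2, b3))]/(c ((a1, b1), (a2, b2), (a3, b3))) push_inj.
rewrite push_comp.
have -> : ifun_pull c phi = ifun_mul
    (ifun_pull (t12 (prod_sset X'' Y'') (prod_sset X' Y') (prod_sset X Y)) (perm_tensm f' g'))
    (ifun_pull (t23 (prod_sset X'' Y'') (prod_sset X' Y') (prod_sset X Y)) (perm_tensm f g)).
  by apply: ifun_eq => -[[[a1 b1] [a2 b2]] [a3 b3]] /=; rewrite mulrACA.
congr (ifun (ifun_push _ _ _) _); apply: gmap_eq.
by move=> [[[a1 b1] [a2 b2]] [a3 b3]].
Qed.

Lemma perm_tensm_pull X X' Y Y' (f : gmap X' X) (h : gmap Y' Y) :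
  perm_tensm (perm_pull f) (perm_pull h)
  = perm_pull (gpair (gmap_comp f (gfst X' Y')) (gmap_comp h (gsnd X' Y')) :
                gmap (prod_sset X' Y') (prod_sset X Y)).
Proof.
apply: ifun_eq => -[[x' y'] [x y]]; rewrite perm_tensmE !perm_pullE /=.
rewrite -natrM mulnb; congr (nat_of_bool _)%:R; rewrite -asbool_and.
by apply: asbool_equiv_eq; split=> [[-> ->]|[]].
Qed.

Section StructureMaps.
Variables X Y Z : sset R.
Definition gass : gmap (prod_sset (prod_sset X Y) Z) (prod_sset X (prod_sset Y Z)) :=
  gpair (gmap_comp (gfst _ _) (gfst _ _))
    (gpair (gmap_comp (gsnd _ _) (gfst _ _)) (gsnd _ _)).
Definition gassi : gmap (prod_sset X (prod_sset Y Z)) (prod_sset (prod_sset X Y) Z) :=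
  gpair (gpair (gfst _ _) (gmap_comp (gfst _ _) (gsnd _ _)))
    (gmap_comp (gsnd _ _) (gsnd _ _)).
Definition glun : gmap X (prod_sset (pt_sset R) X) := gpair (to_pt X) (gmap_id X).
Definition grun : gmap X (prod_sset X (pt_sset R)) := gpair (gmap_id X) (to_pt X).
Definition gswap : gmap (prod_sset X Y) (prod_sset Y X) := gpair (gsnd X Y) (gfst X Y).
End StructureMaps.

Lemma perm_pull_eq X Y (f h : gmap Y X) : gfun f =1 gfun h ->
  perm_pull f = perm_pull h.
Proof. by move=> fh; congr perm_pull; exact: gmap_eq. Qed.

Definition perm : tensor_cat k.
Proof.
refine (@TensorCat k perm_additive_cat (pt_sset R) (@prod_sset R) perm_tensm
  _ _ _ perm_tensm_comp
  (fun X Y Z => perm_pull (gassi X Y Z)) (fun X Y Z => perm_pull (gass X Y Z))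
  (fun X => perm_pull (glun X)) (fun X => perm_pull (gsnd _ X))
  (fun X => perm_pull (grun X)) (fun X => perm_pull (gfst X _))
  (fun X Y => perm_pull (gswap Y X)) _ _ _ _ _ _ _ _ _ _ _ _ _ _).
- move=> X X' Y Y' g a f f'; apply: ifun_eq => -[[x' y'] [x y]].
  by rewrite ifunD ifunZ !perm_tensmE ifunD ifunZ mulrDl mulrA.
- move=> X X' Y Y' f a g g'; apply: ifun_eq => -[[x' y'] [x y]].
  by rewrite ifunD ifunZ !perm_tensmE ifunD ifunZ mulrDr mulrCA.
- by move=> X Y; rewrite [LHS]perm_tensm_pull; apply: perm_pull_eq => -[].
- by move=> X Y Z; rewrite [LHS]perm_pull_comp; apply: perm_pull_eq => -[[]].
- by move=> X Y Z; rewrite [LHS]perm_pull_comp; apply: perm_pull_eq => -[? []].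
- by move=> X; rewrite [LHS]perm_pull_comp; apply: perm_pull_eq => -[[]].
- by move=> X; rewrite [LHS]perm_pull_comp; apply: perm_pull_eq.
- by move=> X; rewrite [LHS]perm_pull_comp; apply: perm_pull_eq => -[? []].
- by move=> X; rewrite [LHS]perm_pull_comp; apply: perm_pull_eq.
- by move=> X Y; rewrite [LHS]perm_pull_comp; apply: perm_pull_eq => -[].
- move=> X X' Y Y' Z Z' f g h; apply: ifun_eq => -[[x' [y' z']] [[x y] z]].
  rewrite [LHS]perm_comp_pull.
  rewrite -[((x, y), z)]/(gassi X Y Z (x, (y, z))).
  rewrite [RHS]perm_comp_pullr_inj.
    by rewrite [LHS]/= [RHS]/= mulrA.
  by move=> [? [? ?]] [? [? ?]] /= [-> -> ->].
- move=> X X' f; apply: ifun_eq => -[x' [[] x]].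
  rewrite [LHS]perm_comp_pull -[(tt, x)]/(glun X x).
  rewrite [RHS]perm_comp_pullr_inj; last by move=> ? ? /= [].
  by rewrite perm_tensmE perm_pullE asboolT ?mul1r.
- move=> X X' f; apply: ifun_eq => -[x' [x []]].
  rewrite [LHS]perm_comp_pull -[(x, tt)]/(grun X x).
  rewrite [RHS]perm_comp_pullr_inj; last by move=> ? ? /= [].
  by rewrite perm_tensmE perm_pullE asboolT ?mulr1.
- move=> X X' Y Y' f g; apply: ifun_eq => -[[y' x'] [x y]].
  rewrite [LHS]perm_comp_pull -[(x, y)]/(gswap Y X (y, x)).
  rewrite [RHS]perm_comp_pullr_inj; last by move=> [? ?] [? ?] /= [-> ->].
  by rewrite [LHS]perm_tensmE [RHS]perm_tensmE mulrC.
- move=> X Y Z W; rewrite /= !perm_tensm_pull !perm_pull_comp.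
  by apply: perm_pull_eq.
- move=> X Y; rewrite /= !perm_tensm_pull !perm_pull_comp.
  by apply: perm_pull_eq => -[].
- move=> X Y Z; rewrite /= !perm_tensm_pull !perm_pull_comp.
  by apply: perm_pull_eq.
Defined.

(* The algebra C(X), and for a relation Y -> X * X the map C(X * X) -> C(Y) *)
Definition perm_alg X : alg perm :=
  @Alg k perm X (perm_pull (gdiag X)) (perm_pull (to_pt X)).

Definition perm_rel_alg X Y (r : gmap Y (prod_sset X X)) : rel_alg perm :=
  @RelAlg k perm (perm_alg X) (perm_alg Y) (perm_pull r).

End Perm.

(* The measure takes the values a, b, c on R -> pt, (x, y) |-> y and
   (x, y) |-> x, the last two being maps from pairs x < y to R. *)
Definition measure_values (R : realType) (k : fieldType) (mu : gmeasure R k)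
    (a b c : k) : Prop :=
  [/\ gval mu (to_pt (line_tset R) : gmap (line_tset R) (pt_tset R)) = a,
      gval mu (gmap_comp (gsnd _ _) (@line2_incl R)
                : gmap (line2_tset R) (line_tset R)) = b
    & gval mu (gmap_comp (gfst _ _) (@line2_incl R)
                : gmap (line2_tset R) (line_tset R)) = c].

Definition delannoy (R : realType) (k : fieldType) (mu : gmeasure R k) :
  tensor_cat k := karoubi (perm mu).

Definition delannoy_line (R : realType) (k : fieldType) (mu : gmeasure R k) :
    rel_alg (delannoy mu) :=
  map_ordered (kar_functor (perm mu)) (perm_rel_alg mu (@line2_incl R)).

(* Main.v *)
(* Let L be the line with a least and/or a greatest point added, embedded in the
   line as (-1, 1) together with the corresponding endpoints. Transporting G to
   automorphisms of the line supported in (-1, 1), the points of a G-set X that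
   are fixed by the stabilizer of a finite subset of L form a G-set hat X, and
   hat preserves products and takes the line to L. Restriction of invariant
   functions to hat then defines a tensor functor from Perm(G, mu) to Perm(G, mu')
   as soon as it commutes with push-forwards. Every transitive G-set embeds in a
   power of the line, so it is enough to treat the projections T * line -> T with T
   transitive, and there, by base change, the maps line -> pt and
   (x, y) |-> y on pairs x < y. The condition is thus that the volume of L and
   the volumes of its initial segments for mu' are the values of mu on these two
   maps. *)
From mathcomp Require Import all_boot all_order all_algebra.
From mathcomp Require Import all_classical all_reals ring lra.
Require Import Defs.

Set Implicit Arguments.
Unset Strict Implicit.
Unset Printing Implicit Defensive.

Import Order.TTheory GRing.Theory Num.Theory.

Local Open Scope classical_set_scope.
Local Open Scope ring_scope.
Local Open Scope cat_scope.

Arguments act {R _} _ _.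
Arguments gval {R k} g {Y X}.


(** * Supports *)

(** Letting G act on X through the transported automorphisms is not enough: every point outside (-1,
    1) is then fixed, and the line alone has infinitely many orbits. This is why hat X keeps only
    the points with finite support in L. That hat X has finitely many orbits rests on a rigidity of
    G: an increasing map that permutes a finite set fixes it pointwise, so the stabilizer of a point
    in a G-set with open stabilizers is exactly the pointwise stabilizer of some finite set.
    Equivariant coordinates thus separate the points of an orbit, which embeds it in a power of the
    line and its hat in a power of L.

    On the algebra side, étaleness and the order axioms are proved once, for C(X) with an explicit
    strict total order on a G-set X. The image of C(line), the unit and the lexicographic sums are
    each recognized as such an algebra, so the required isomorphism reduces to an order-preserving
    equivariant bijection between L and the hat of the line. *)

(** Serves to move [b] slightly to the left without crossing the finite set [s]. The point [b] may
    itself belong to [s], and then counts as lying above [d]. *)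
Lemma gapl (R : realType) (b : R) (s : seq R) :
  exists2 d, d < b & {in s, forall a, (a < d) = (a < b) /\ (d < a) = (b <= a)}.
Proof.
elim: s => [|a s [d db dP]]; first by exists (b - 1); rewrite ?ltrBlDr ?ltrDl.
have [ba|ab] := leP b a.
  exists d => // c; rewrite inE => /predU1P[->|/dP//].
  by rewrite (lt_le_trans db ba) ltNge (ltW (lt_le_trans db ba)) ltNge !ba.
pose m := Num.max a d; have mb : m < b by rewrite gt_max ab db.
have [me eb] := midf_lt mb; exists ((m + b) / 2) => // c.
have [am dm] : a <= m /\ d <= m by rewrite !le_max !lexx orbT.
rewrite inE => /predU1P[->|/dP[cd dc]].
  rewrite (le_lt_trans am me) ab ltNge (ltW (le_lt_trans am me)).
  by rewrite leNgt ab.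
have [cb|bc] := ltP c b.
  have cm : c <= m by rewrite (le_trans _ dm) // leNgt dc leNgt cb.
  by rewrite (le_lt_trans cm me) ltNge (ltW (le_lt_trans cm me)).
by rewrite (lt_le_trans eb bc) ltNge (ltW (lt_le_trans eb bc)).
Qed.

Lemma gapr (R : realType) (b : R) (s : seq R) :
  exists2 d, b < d & {in s, forall a, (d < a) = (b < a) /\ (a < d) = (a <= b)}.
Proof.
have [d db dP] := gapl (- b) (map -%R s).
exists (- d); first by rewrite ltrNr.
by move=> a /(map_f -%R)/dP[]; rewrite ltrN2 lerN2 ltrNl ltrNr.
Qed.

Section Support.
Variable R : realType.
Local Notation G := (oaut R).

Lemma act_inj (X : gset R) (g : G) : injective (act g : X -> X).
Proof. exact: can_inj (@actK R X g). Qed.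

Definition supports (X : gset R) (A : seq R) (x : X) : Prop :=
  pointwise_stab A `<=` stabilizer x.

Lemma supports_act (X : gset R) (A : seq R) (x : X) (g : G) :
  supports A x -> supports (map g A) (act g x).
Proof.
move=> Ax h hA; apply: (@act_inj X g^-1%g); rewrite actK -!actM.
apply: Ax => a aA; apply: (can_inj (@oaut_funK _ g)).
by rewrite -[LHS]oautM mulgA mulVKg oautM hA // map_f.
Qed.

(** Homogeneity applied to (b, c) and the pairs (a, a): the pointwise stabilizer of [A] is
    transitive on each cell of the line cut at [A]. *)
Lemma oaut_stab_move (A : seq R) (b c : R) :
  {in A, forall a, (a < b) = (a < c) /\ (b < a) = (c < a)} ->
  exists2 g : G, pointwise_stab A g & g b = c.
Proof.
move=> bc; have [|g gP] := @oaut_homogeneous R ((b, c) :: [seq (a, a) | a <- A]).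
  move=> p q; rewrite !inE => /predU1P[->|/mapP[a aA ->]] /predU1P[->|/mapP[a' a'A ->]] //=.
  - by rewrite !ltxx.
  - by have [] := bc _ a'A.
  - by have [] := bc _ aA.
exists g => [a aA|]; last by have := gP (b, c); rewrite mem_head; apply.
by have := gP (a, a); apply; rewrite inE map_f ?orbT.
Qed.

(* An element of the pointwise stabilizer of A \ {b} that moves b is, up to the
   stabilizer of A, a short move of b that fixes B followed by a move in the
   stabilizer of A. *)
Lemma supports_rem (X : gset R) (A B : seq R) (x : X) b :
  supports A x -> supports B x -> b \notin B ->
  supports [seq a <- A | a != b] x.
Proof.
move=> Ax Bx bB; set A' := seq.filter _ A.
have A'b a : a \in A' -> a != b by rewrite mem_filter => /andP[].
have AA' a : a \in A -> a = b \/ a \in A'.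
  by rewrite mem_filter; case: eqVneq => [|_ ->]; [left|right].
suff key : forall g : G, pointwise_stab A' g -> exists2 h : G, act h x = x &
    pointwise_stab A' h /\ h b = g b.
  move=> g gA'; have [h hx [hA' hb]] := key g gA'.
  rewrite /stabilizer /= -[g](mulVKg h) actM (_ : act _ x = x) //.
  apply: Ax => a /AA'[->|aA'].
    by rewrite oautM -hb; exact: oaut_funK.
  by rewrite oautM gA' // -[in LHS](hA' _ aA'); exact: oaut_funK.
(* [h1] slides [b] to [d] while fixing [A'] and [B], so it fixes [x]. [h2] continues to g b while
   fixing [A], which may contain [b]; this is possible since [d] and g b lie on the same side of
   [b]. *)
have slide : forall (g : G) d, pointwise_stab A' g -> (g b < b <-> d < b) -> d != b -> g b != b ->
    {in A' ++ B, forall a, (a < d) = (a < b) /\ (d < a) = (b < a)} ->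
    exists2 h : G, act h x = x & pointwise_stab A' h /\ h b = g b.
  move=> g d gA' gd nd ng dP.
  have [a|h1 h1P h1b] := @oaut_stab_move (A' ++ B) b d.
    by move=> /dP[-> ->].
  have [a|h2 h2P h2d] := @oaut_stab_move A d (g b).
    move=> /AA'[->|aA'].
      case: (ltgtP d b) gd nd => // _; case: (ltgtP (g b) b) ng => //.
      + by move=> _ _ [_ /(_ isT)].
      + by move=> _ _ [/(_ isT)].
    have [|-> ->] := dP a; first by rewrite mem_cat aA'.
    by rewrite -{2 4}(gA' a aA') !oaut_incE.
  exists (h2 * h1)%g.
    rewrite actM (_ : act h1 x = x) ?(Ax h2) // (Bx h1) // => a aB.
    by apply: h1P; rewrite mem_cat aB orbT.
  split; last by rewrite oautM h1b.
  move=> a aA'; rewrite oautM h1P ?mem_cat ?aA' // h2P //.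
  by move: aA'; rewrite mem_filter => /andP[].
have bAB a : a \in A' ++ B -> a != b.
  by rewrite mem_cat => /orP[/A'b//|]; apply: contraTneq => ->.
move=> g gA'; case: (ltgtP (g b) b) => gb.
- have [d db dP] := gapl b (A' ++ B); apply: (slide g d) => //.
  + by rewrite lt_eqF.
  + by rewrite lt_eqF.
  + move=> a aAB; have [-> ->] := dP a aAB.
    by rewrite (lt_neqAle b) eq_sym (bAB _ aAB).
- have [d db dP] := gapr b (A' ++ B); apply: (slide g d) => //.
  + by rewrite !ltNge (ltW gb) (ltW db); split.
  + by rewrite gt_eqF.
  + by rewrite gt_eqF.
  + move=> a aAB; have [-> ->] := dP a aAB.
    by rewrite (lt_neqAle a) (bAB _ aAB).
- by exists 1%g; rewrite ?act1.
Qed.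

(** The increasing enumeration of a finite set is unique, and [g] carries that of [A] to that of gA,
    which is the same set. *)
Lemma oaut_stable_fix (A : seq R) (g : G) :
  {subset A <= map g A} -> pointwise_stab A g.
Proof.
move=> AgA; pose s := sort <=%R (undup A).
have sA a : (a \in s) = (a \in A) by rewrite mem_sort mem_undup.
have ss : sorted <%R s by rewrite sort_lt_sorted undup_uniq.
have gss : sorted <%R (map g s).
  by rewrite sorted_map; apply: sub_sorted ss => a b /= ab; exact: oaut_inc.
have sgs : {subset s <= map g s}.
  by move=> a; rewrite sA => /AgA/mapP[b bA ->]; rewrite map_f // sA.
have E : s = map g s.
  have [|_ E] := uniq_min_size (lt_sorted_uniq ss) sgs; first by rewrite size_map.
  exact: lt_sorted_eq E.
move=> a; rewrite -sA => /(nthP 0)[i i_s <-].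
by rewrite {2}E (nth_map 0).
Qed.

(** If some [g] fixing [x] moves a point of [A], then [A] is not contained in gA. Since gA also
    supports [x], a point of [A] outside gA can be removed from [A]; the size decreases. *)
Lemma exact_support (X : gset R) (A : seq R) (x : X) : supports A x ->
  exists2 B, supports B x & stabilizer x `<=` pointwise_stab B.
Proof.
move: {2}(size A).+1 (ltnSn (size A)) => n; elim: n A => // n IH A An Ax.
have [?|] := pselect (stabilizer x `<=` pointwise_stab A); first by exists A.
move=> /existsNP[g /not_implyP[gx gA]].
have /existsNP[b /not_implyP[bA bgA]] : ~ {subset A <= map g A}.
  by move=> /oaut_stable_fix.
have gAx : supports (map g A) x by rewrite -gx; exact: supports_act.
have {}bgA : b \notin map g A by apply/negP.
apply: IH (supports_rem Ax gAx bgA).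
rewrite ltnS in An; apply: leq_trans An; rewrite size_filter.
by rewrite ltn_neqAle count_size andbT -all_count; apply/allPn; exists b; rewrite ?negbK.
Qed.

Lemma gmap_extend (X Z : gset R) (x : X) (z : Z) :
  orbit x = setT -> stabilizer x `<=` stabilizer z ->
  exists f : gmap X Z, f x = z.
Proof.
move=> xT xz; have xP y : exists g, y = act g x by rewrite -[exists _, _]/(orbit x y) xT.
pose c y := sval (cid (xP y)); have cP y : y = act (c y) x := svalP (cid (xP y)).
have key : forall g h : G, act g x = act h x -> act g z = act h z.
  move=> g h gh; apply: (@act_inj Z h^-1%g); rewrite actK -actM.
  by apply: xz; rewrite /stabilizer /= actM gh actK.
have fE g y : act (c (act g y)) z = act g (act (c y) z).
  by rewrite -actM; apply: key; rewrite -cP actM -cP.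
exists (GMap fE) => /=; rewrite -[RHS]act1; apply: key.
by rewrite -cP act1.
Qed.

(** Equality in the power of [Z] indexed by [us], kept as a list of conditions so that coordinates
    can be handled one at a time. *)
Fixpoint agree (X Z : gset R) (us : seq (gmap X Z)) (p q : X) : Prop :=
  if us is u :: us' then u p = u q /\ agree us' p q else True.

(** For each b in the exact support [B] of [x], the assignment of b to [x] extends to an equivariant
    map from the orbit to the line. The values of these maps at g x are the points g b, and they
    determine g x because [B] supports [x]. *)
Lemma separating_maps (X : gset R) (x : X) :
  orbit x = setT -> open_subgroup (stabilizer x) ->
  exists us : seq (gmap X (line_sset R)), forall p q, agree us p q -> p = q.
Proof.
move=> xT [A /exact_support[B Bx xB]].
suff [us usP] : exists us : seq (gmap X (line_sset R)),
    forall g h : G, agree us (act g x) (act h x) -> {in B, forall b, g b = h b}.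
  exists us => p q; have [g ->] : orbit x p by rewrite xT.
  have [h ->] : orbit x q by rewrite xT.
  move=> /usP gh; apply: (@act_inj X h^-1%g); rewrite actK -actM.
  by apply: Bx => b bB; rewrite oautM gh //; exact: oaut_funK.
elim: B xB {Bx} => [|b B IH] xB; first by exists [::].
have [|us usP] := IH; first by move=> g /xB gB a aB; rewrite gB // inE aB orbT.
have [|f fx] := @gmap_extend X (line_sset R) x b xT.
  by move=> g /xB gB; rewrite /stabilizer /= gB ?mem_head.
exists (f :: us) => g h /= [fgh /usP ghB] a; rewrite inE => /predU1P[->|/ghB//].
by move: fgh; rewrite !gfunE fx.
Qed.

End Support.

(** * Supported points *)

(* An equivariant embedding of a G-set [le_src] in the line, for an action of G
   on the line through an endomorphism of G. *)
Record line_embedding (R : realType) := LineEmbedding {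
  le_src :> sset R;
  le_fun : le_src -> R;
  le_hom : oaut R -> oaut R;
  le_hom1 : le_hom 1%g = 1%g;
  le_homM : forall g h, le_hom (g * h)%g = (le_hom g * le_hom h)%g;
  le_inj : injective le_fun;
  le_funE : forall g l, le_hom g (le_fun l) = le_fun (act g l)
}.

Section Hat.
Variables (R : realType) (j : line_embedding R).
Local Notation G := (oaut R).
Local Notation iota := (@le_fun R j).
Local Notation e := (@le_hom R j).

Definition supported (X : gset R) (x : X) : Prop :=
  exists2 s : seq R, {in s, forall a, range iota a} & supports s x.

Lemma supported_gmap (X Y : gset R) (f : gmap X Y) x :
  supported x -> supported (f x).
Proof.
by move=> [s sj sx]; exists s => // g /sx gx; rewrite /stabilizer /= -gfunE gx.
Qed.

Lemma supported_inj (X Y : gset R) (f : gmap X Y) x :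
  injective f -> supported (f x) -> supported x.
Proof.
move=> fI [s sj sx]; exists s => // g /sx gx; apply: fI.
by rewrite gfunE gx.
Qed.

Lemma supported_pair (X Y : gset R) (x : X) (y : Y) :
  supported x -> supported y -> supported ((x, y) : prod_gset X Y).
Proof.
move=> [s sj sx] [t tj ty]; exists (s ++ t) => [a|g gst].
  by rewrite mem_cat => /orP[/sj|/tj].
rewrite /stabilizer /=; congr pair; [apply: sx|apply: ty] => a ast;
  by apply: gst; rewrite mem_cat ast ?orbT.
Qed.

Lemma supported_act (X : gset R) g (x : X) : supported x -> supported (act (e g) x).
Proof.
move=> [s sj /(supports_act (g := e g)) sx]; exists (map (e g) s) => //.
move=> _ /mapP[a /sj[l _ <-] ->]; exists (act g l) => //.
by rewrite le_funE.
Qed.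

(** A point of the line belongs to each of its finite supports: otherwise an automorphism fixing the
    support would move it to a nearby point. *)
Lemma supported_line (t : line_sset R) : supported t <-> range iota t.
Proof.
split=> [[s sj st]|tj]; last first.
  exists [:: t : R] => [a|g]; first by rewrite inE => /eqP->.
  by apply; rewrite mem_head.
apply: sj; apply: contraPT (st) => ts.
have [d db dP] := gapl (t : R) s.
have [a aS|g gs gt] := @oaut_stab_move R s t d.
  have [-> ->] := dP a aS; rewrite (lt_neqAle t) eq_sym; split=> //.
  by rewrite (memPn ts).
by move=> /(_ g gs) E; move: db; rewrite -gt [g t]E ltxx.
Qed.

Definition hat_act (X : gset R) (g : G) (p : {x : X | supported x}) :
  {x : X | supported x} := exist _ (act (e g) (sval p)) (supported_act g (svalP p)).
Lemma hat_act1 (X : gset R) (p : {x : X | supported x}) : hat_act 1%g p = p.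
Proof. by apply: sval_eq; rewrite /= le_hom1 act1. Qed.
Lemma hat_actM (X : gset R) g h (p : {x : X | supported x}) :
  hat_act (g * h)%g p = hat_act g (hat_act h p).
Proof. by apply: sval_eq; rewrite /= le_homM actM. Qed.
Definition hat_gset (X : gset R) : gset R :=
  GSet (@hat_act1 X) (@hat_actM X).

Lemma hat_gmap_subproof (X Y : gset R) (f : gmap X Y) g (p : hat_gset X) :
  exist (@supported Y) (f (sval (act g p))) (supported_gmap f (svalP (act g p)))
  = act g (exist (@supported Y) (f (sval p)) (supported_gmap f (svalP p)) : hat_gset Y).
Proof. by apply: sval_eq; rewrite /= gfunE. Qed.
Definition hat_gmap (X Y : gset R) (f : gmap X Y) : gmap (hat_gset X) (hat_gset Y) :=
  @GMap R (hat_gset X) (hat_gset Y) _ (hat_gmap_subproof f).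

(** If a point of the support is the image of [l], then [e g] fixes it as soon as [g] fixes [l], and
    the stabilizer of [l] is open. *)
Lemma hat_open (X : gset R) (x : hat_gset X) : open_subgroup (stabilizer x).
Proof.
case: x => x [s sj sx].
have [A AP] : exists A, forall g, pointwise_stab A g -> {in s, forall a, e g a = a}.
  elim: s sj {sx} => [|a s IH] sj; first by exists [::].
  have [b bs|A AP] := IH; first by apply: sj; rewrite inE bs orbT.
  have [l _ la] := sj a (mem_head _ _).
  have [B BP] := sset_open l; exists (A ++ B) => g gAB b; rewrite inE => /predU1P[->|].
    by rewrite -la le_funE BP // => c cB; apply: gAB; rewrite mem_cat cB orbT.
  by apply: AP => c cA; apply: gAB; rewrite mem_cat cA.
by exists A => g /AP gs; apply: sval_eq; apply: sx.
Qed.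

Lemma unhat_subproof (t : hat_gset (line_sset R)) : exists l, iota l = sval t.
Proof. by have /supported_line[l _ E] := svalP t; exists l. Qed.
Definition unhat_fun (t : hat_gset (line_sset R)) : j := sval (cid (unhat_subproof t)).
Lemma unhat_funK t : iota (unhat_fun t) = sval t.
Proof. exact: svalP (cid (unhat_subproof t)). Qed.
Lemma unhat_funE g t : unhat_fun (act g t) = act g (unhat_fun t).
Proof. by apply: le_inj; rewrite unhat_funK -le_funE unhat_funK. Qed.
Definition unhat : gmap (hat_gset (line_sset R)) j := GMap unhat_funE.
Lemma unhatK t : iota (unhat t) = sval t.
Proof. exact: unhat_funK. Qed.

Lemma fin_orbits_inj (X : gset R) (Y : sset R) (f : gmap X Y) :
  injective f -> finite_set (range (@orbit R X)).
Proof.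
move=> fI; apply: (@sub_finite_set _ _
  ((fun T => [set x | T (f x)]) @` range (@orbit R Y))); last first.
  exact/finite_image/sset_fin.
move=> _ [x _ <-]; exists (orbit (f x)); first by exists (f x).
apply/seteqP; split=> y [g]; last by move=> ->; exists g; rewrite gfunE.
by rewrite -gfunE => /fI ->; exists g.
Qed.

Lemma agree_product (X : gset R) (Z : sset R) (us : seq (gmap X Z)) :
  exists (Y : sset R) (f : gmap X Y), forall p q, f p = f q -> agree us p q.
Proof.
elim: us => [|u us [Y [f fP]]]; first by exists (pt_sset R), (to_pt X).
by exists (prod_sset Z Y), (gpair u f) => p q [up /fP fp].
Qed.

(** Each of the finitely many orbits of [X] has separating maps to the line; on supported points
    they take values in the image of [j], so they embed the hat of the orbit in a power of [j],
    which has finitely many orbits. *)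
Lemma hat_fin (X : sset R) : finite_set (range (@orbit R (hat_gset X))).
Proof.
pose piece (T : orb X) := [set p : hat_gset X | orb_set T (sval p)].
have pieceE (T : orb X) : finite_set (@orbit R (hat_gset X) @` piece T).
  have [x xT] := tset_trans (orb_tset T).
  have [us usP] := separating_maps xT (sset_open x).
  have [Y [f fP]] := agree_product [seq gmap_comp unhat (hat_gmap u) | u <- us].
  have fI : injective f.
    move=> p q /fP pq; apply: sval_eq; apply: usP.
    elim: us pq {fP} => //= u us IH [upq /IH]; split => //.
    have := congr1 iota upq; rewrite /= !unhatK; exact.
  have := fin_orbits_inj fI.
  pose i := hat_gmap (orb_incl T).
  move=> /(finite_image (fun O => i @` O)); apply: sub_finite_set.
  move=> _ [p Tp <-].
  have p'P : supported (exist _ (sval p) Tp : orb_tset T).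
    by apply: (@supported_inj _ _ (orb_incl T)); [exact: sval_eq|exact: svalP p].
  pose p' : hat_gset (orb_tset T) := exist _ _ p'P.
  have ip : i p' = p by exact: sval_eq.
  exists (orbit p'); first by exists p'.
  apply/seteqP; split=> [_ [_ [g ->] <-]|_ [g ->]].
    by exists g; rewrite -[LHS]/(i _) gfunE ip.
  by exists (act g p'); [exists g|rewrite -[LHS]/(i _) gfunE ip].
apply: (@sub_finite_set _ _ (\bigcup_(T in setT) (@orbit R (hat_gset X) @` piece T))).
  move=> _ [p _ <-]; exists (orb_of (sval p)) => //.
  by exists p => //; exact: orbit_refl.
by apply: bigcup_finite => //; exact: finite_finset.
Qed.

Definition hat (X : sset R) : sset R := SSet (@hat_open X) (@hat_fin X).
Canonical hat.

Definition hatm (X Y : sset R) (f : gmap X Y) : gmap (hat X) (hat Y) := hat_gmap f.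

Lemma hatm_comp (X Y Z : sset R) (f : gmap Y Z) (h : gmap X Y) :
  hatm (gmap_comp f h) = gmap_comp (hatm f) (hatm h).
Proof. by apply: gmap_eq => x; exact: sval_eq. Qed.

(** Injectivity reflects supports. Surjectivity alone need not pass to hats: if L has a least point,
    no supported pair x < y lies over it under the map to y. *)
Lemma hat_lift (X Y : sset R) (f : gmap X Y) x (y : hat Y) :
  injective f -> f x = sval y -> exists2 p : hat X, sval p = x & hatm f p = y.
Proof.
move=> fI fx; have xP : supported x.
  by apply: (supported_inj fI); rewrite fx; exact: svalP.
by exists (exist _ x xP) => //; apply: sval_eq.
Qed.

End Hat.

(** * Comparison of push-forwards *)

Section Push.
Variables (R : realType) (k : fieldType) (mu : gmeasure R k).

Lemma ifun_sum (X : gset R) (I : finType) (F : I -> inv_fun k X) x :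
  (\sum_i F i) x = \sum_i F i x.
Proof. exact: (big_morph (fun f : inv_fun k X => f x) (fun f f' => ifunD f f' x) (ifun0 k x)). Qed.

Lemma ifun_orb_decomp (X : sset R) (phi : inv_fun k X) :
  phi = \sum_(T : orb X) ifun_push mu (orb_incl T) (ifun_pull (orb_incl T) phi).
Proof.
have iI (T : orb X) : injective (orb_incl T) by move=> p q; exact: sval_eq.
apply: ifun_eq => x; rewrite ifun_sum (bigD1 (orb_of x)) // big1 ?Monoid.mulm1.
  pose p : orb_tset (orb_of x) := exist _ x (orbit_refl x).
  by have := push_inj mu (ifun_pull (orb_incl (orb_of x)) phi) p (iI _) => ->.
move=> T /andP[_ /eqP Tx]; rewrite push_notin // => -[p _ px].
case: Tx; apply: orb_mem; rewrite -px; exact: svalP.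
Qed.

Lemma push0 (X Y : sset R) (f : gmap X Y) : ifun_push mu f 0 = 0.
Proof. by have := push_lin mu f (-1) 0 0; rewrite !scaleN1r oppr0 addr0 addNr. Qed.

(** A transitive set is its only orbit, and the inclusion of that orbit is an isomorphism of measure
    1. This ties push-forwards, defined orbit by orbit, to the values of the measure. *)
Lemma push_tset (Y X : tset R) (f : gmap Y X) phi y x :
  ifun_push mu f phi x = phi y * gval mu f.
Proof.
have yT (T : orb Y) : T = orb_of y.
  have [y0 y0T] := tset_trans Y; have [z ->] := orb_rep T.
  have [g ->] : orbit y0 z by rewrite y0T.
  have [h ->] : orbit y0 y by rewrite y0T.
  by rewrite !orb_of_act.
rewrite /= (big_pred1 (orb_of y)) => [|T].
  rewrite ifun_orb_of /mu_orb; congr (_ * _).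
  have iY : bijective (orb_incl (orb_of y)).
    apply: inj_surj_bij; first by move=> p q; exact: sval_eq.
    move=> z; have zy : orb_set (orb_of y) z by rewrite -(yT (orb_of z)); exact: orbit_refl.
    by exists (exist _ z zy).
  have iX : bijective (orb_incl (orb_im f (orb_of y))).
    apply: inj_surj_bij; first by move=> p q; exact: sval_eq.
    have [x0 x0T] := tset_trans X.
    move=> z; have zf : orb_set (orb_im f (orb_of y)) z.
      rewrite orb_im_of /=; have -> : orbit (f y) = orbit x0.
        by apply: orbit_eq; rewrite x0T.
      by rewrite x0T.
    by exists (exist _ z zf).
  have := mu_comp mu (orb_incl (orb_im f (orb_of y))) (orb_res f (orb_of y)).
  rewrite (mu_iso mu iX) mul1r => <-.
  rewrite -[RHS]mulr1 -(mu_iso mu iY) -mu_comp.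
  by congr gval; exact: gmap_eq.
rewrite (yT T) /= eqxx; apply/eqP; rewrite orb_im_of; apply/orb_ofP.
have [x0 x0T] := tset_trans X.
suff -> : orbit x = setT by [].
by rewrite -x0T; apply: orbit_eq; rewrite x0T.
Qed.

Lemma push_sum (X Y Z : sset R) (f : gmap (sum_sset X Y) Z) phi :
  ifun_push mu f phi
  = ifun_push mu (gmap_comp f (ginl X Y)) (ifun_pull (ginl X Y) phi)
    + ifun_push mu (gmap_comp f (ginr X Y)) (ifun_pull (ginr X Y) phi).
Proof.
have lI : injective (ginl X Y) by move=> ? ? [].
have rI : injective (ginr X Y) by move=> ? ? [].
rewrite -!push_comp.
have E : phi = ifun_push mu (ginl X Y) (ifun_pull (ginl X Y) phi)
             + ifun_push mu (ginr X Y) (ifun_pull (ginr X Y) phi).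
  apply: ifun_eq => -[x|y]; rewrite ifunD.
    rewrite [X in _ = _ + X]push_notin; last by move=> [? _].
    by rewrite addr0 -[inl x]/(ginl X Y x) push_inj.
  rewrite [X in _ = X + _]push_notin; last by move=> [? _].
  by rewrite add0r -[inr y]/(ginr X Y y) push_inj.
have := push_lin mu f 1 (ifun_push mu (ginl X Y) (ifun_pull (ginl X Y) phi))
  (ifun_push mu (ginr X Y) (ifun_pull (ginr X Y) phi)).
by rewrite !scale1r -E.
Qed.

Lemma push_bij (X Y Z : sset R) (f : gmap Y Z) (c : gmap X Y) phi :
  injective c -> (forall y, exists x, c x = y) ->
  ifun_push mu (gmap_comp f c) (ifun_pull c phi) = ifun_push mu f phi.
Proof.
move=> cI cS; rewrite -push_comp; congr ifun_push; apply: ifun_eq => y.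
by have [x <-] := cS y; rewrite push_inj.
Qed.

End Push.

Section Comparison.
Variables (R : realType) (k : fieldType) (mu mu' : gmeasure R k).
Variable j : line_embedding R.
Local Notation line := (line_sset R).
Local Notation G := (oaut R).

Definition res (X : gset R) (phi : inv_fun k X) : inv_fun k (hat_gset j X) :=
  @InvFun R k (hat_gset j X) (fun p => phi (sval p))
    (fun g p => ifunE phi (le_hom j g) (sval p)).

(** Localized at one point because base change along [h] gives information only at points in the
    image of [hatm j h]. *)
Definition compatible_at (X Y : sset R) (f : gmap X Y) (phi : inv_fun k X)
    (y : hat j Y) : Prop :=
  ifun_push mu f phi (sval y) = ifun_push mu' (hatm j f) (res phi) y.

Definition compatible (X Y : sset R) (f : gmap X Y) (phi : inv_fun k X) : Prop :=
  forall y, compatible_at f phi y.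

Lemma compatible_res (X Y : sset R) (f : gmap X Y) phi :
  compatible f phi -> res (ifun_push mu f phi) = ifun_push mu' (hatm j f) (res phi).
Proof. by move=> c; apply: ifun_eq => y; exact: c. Qed.

(** For any measure, push-forward along an injection is extension by zero, and by [hat_lift] a
    supported point of the image comes from a supported point. *)
Lemma compatible_inj (X Y : sset R) (f : gmap X Y) phi :
  injective f -> compatible f phi.
Proof.
move=> fI y; rewrite /compatible_at.
have hfI : injective (hatm j f).
  by move=> p q /(congr1 sval) /fI; exact: sval_eq.
have [[x _ xy]|nr] := pselect (range f (sval y)).
  have [p px <-] := hat_lift fI xy.
  by rewrite [RHS]push_inj // [LHS]push_inj.
rewrite [LHS]push_notin // [RHS]push_notin // => -[p _ py].
by apply: nr; exists (sval p) => //; rewrite -py.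
Qed.

Lemma compatible_lin (X Y : sset R) (f : gmap X Y) a phi psi :
  compatible f phi -> compatible f psi -> compatible f (a *: phi + psi).
Proof.
move=> cphi cpsi y; rewrite /compatible_at.
have -> : res (a *: phi + psi) = a *: res phi + res psi by exact: ifun_eq.
by rewrite !push_lin !ifunD !ifunZ cphi cpsi.
Qed.

Lemma compatible_sum (X Y : sset R) (f : gmap X Y) (I : finType)
    (F : I -> inv_fun k X) :
  (forall i, compatible f (F i)) -> compatible f (\sum_i F i).
Proof.
move=> cF; apply: (big_ind (compatible f)) => [y|phi psi ? ?|i _ //].
  by rewrite /compatible_at push0 (_ : res 0 = 0) ?push0 //; exact: ifun_eq.
by rewrite -[phi]scale1r; exact: compatible_lin.
Qed.

Lemma compatible_comp (X Y Z : sset R) (f : gmap X Y) (h : gmap Y Z) phi :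
  compatible f phi -> compatible h (ifun_push mu f phi) ->
  compatible (gmap_comp h f) phi.
Proof.
move=> cf ch y; by rewrite /compatible_at -push_comp ch (compatible_res cf) push_comp hatm_comp.
Qed.

(** Reduces a function extended by zero from an invariant subset to a function on that subset. *)
Lemma compatible_push (X Y Z : sset R) (f : gmap X Y) (h : gmap Y Z) phi :
  compatible f phi -> compatible (gmap_comp h f) phi ->
  compatible h (ifun_push mu f phi).
Proof.
move=> cf ch y; by rewrite /compatible_at push_comp ch (compatible_res cf) push_comp hatm_comp.
Qed.

(** Both measures satisfy base change, and hats preserve cartesian squares: the point of [P] over a
    supported pair is supported because (a, b) is injective. *)
Lemma compatible_cart (P X Y Z : sset R) (f : gmap X Z) (h : gmap Y Z)
    (a : gmap P X) (b : gmap P Y) phi (y : hat j Y) :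
  (forall p, f (a p) = h (b p)) ->
  (forall p q, a p = a q -> b p = b q -> p = q) ->
  (forall x y, f x = h y -> exists2 p, a p = x & b p = y) ->
  compatible_at f phi (hatm j h y) <-> compatible_at b (ifun_pull a phi) y.
Proof.
move=> sq inj surj; rewrite /compatible_at.
have -> : ifun_push mu f phi (sval (hatm j h y)) = ifun_push mu b (ifun_pull a phi) (sval y).
  by rewrite -(push_cart mu phi sq inj surj).
have -> : res (ifun_pull a phi) = ifun_pull (hatm j a) (res phi) by exact: ifun_eq.
rewrite -(@push_cart _ _ mu' _ _ _ _ (hatm j f) (hatm j h) (hatm j a) (hatm j b)) //.
- by move=> p; apply: sval_eq; exact: sq.
- by move=> p q /(congr1 sval) ap /(congr1 sval) bp; apply: sval_eq; exact: inj.
move=> u v /(congr1 sval) uv; have [p pa pb] := surj _ _ uv.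
have abI : injective (gpair a b) by move=> p1 p2 [] /inj; exact.
have [] := @hat_lift _ j _ (prod_sset X Y) (gpair a b) p
  (exist _ (sval u, sval v) (supported_pair (svalP u) (svalP v))) abI.
  by rewrite /= pa pb.
move=> q qp /(congr1 sval) [qa qb]; exists q; exact: sval_eq.
Qed.

End Comparison.

(** * Step functions on the line *)

Definition same_cut (R : realType) (A : seq R) (z z' : R) : Prop :=
  {in A, forall a, (a < z) = (a < z') /\ (z < a) = (z' < a)}.

Lemma same_cut_between (R : realType) (A : seq R) (z a z' : R) :
  z <= a -> a <= z' -> same_cut A z z' -> same_cut A z a /\ same_cut A z' a.
Proof.
move=> za az' zz'.
have key b : b \in A -> (b < z) = (b < a) /\ (z < b) = (a < b).
  move=> /zz'[b1 b2]; split; apply/idP/idP => h.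
  - exact: lt_le_trans h za.
  - by rewrite b1; exact: lt_le_trans h az'.
  - by apply: le_lt_trans az' _; rewrite -b2.
  - exact: le_lt_trans za h.
split=> b bA; have [k1 k2] := key b bA; first by [].
by have [<- <-] := zz' b bA.
Qed.

Lemma step_function_ind (R : realType) (k : fieldType) (A : seq R)
    (P : (R -> k) -> Prop) :
  (forall c v w, P v -> P w -> P (fun z => c * v z + w z)) ->
  P (fun=> 1) ->
  {in A, forall a, P (fun z => (z < a)%R%:R)} ->
  {in A, forall a, P (fun z => (z == a)%:R)} ->
  forall u, (forall z z', same_cut A z z' -> u z = u z') -> P u.
Proof.
move=> Plin P1; elim: A => [|a A IH] Plt Peq u uA.
  have -> : u = fun z => (u 0 - 1) * 1 + 1.
    by apply/funext => z; rewrite mulr1 subrK; exact: uA.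
  exact: Plin.
have {}IH v : (forall z z', same_cut A z z' -> v z = v z') -> P v.
  by apply: IH => b bA; [apply: Plt|apply: Peq]; rewrite inE bA orbT.
have [aA|aA] := boolP (a \in A).
  apply: IH => z z' zz'; apply: uA => b; rewrite inE => /predU1P[->|]; exact: zz'.
have nA b : b \in A -> (b == a) = false by move=> bA; apply: contraNF aA => /eqP<-.
have [d da dP] := gapl a A; have [f fa fP] := gapr a A.
(* [d] and [f] sample the cells just left and right of [a]. The coefficients give [u'] the value u f
   at [a] and on both adjacent cells. *)
pose u' z := u z - (u a - u f) * (z == a)%:R - (u d - u f) * (z < a)%R%:R.
have -> : u = fun z => (u a - u f) * (z == a)%:R + ((u d - u f) * (z < a)%R%:R + u' z).
  by apply/funext => z; rewrite /u'; ring.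
apply: (Plin); first by apply: Peq; exact: mem_head.
apply: (Plin); first by apply: Plt; exact: mem_head.
apply: IH => z z' zz'.
have u'a y : same_cut A y a -> u' y = u f.
  move=> ya; rewrite /u'; case: (ltgtP y a) => [lt|gt|->] /=.
  - have -> : u y = u d.
      apply: uA => b; rewrite inE => /predU1P[->|bA].
        by rewrite lt da !ltNge (ltW lt) (ltW da).
      have [-> ->] := ya b bA; have [-> ->] := dP b bA.
      by rewrite le_eqVlt eq_sym nA.
    by rewrite mulr0 mulr1; ring.
  - have -> : u y = u f.
      apply: uA => b; rewrite inE => /predU1P[->|bA].
        by rewrite gt fa !ltNge (ltW gt) (ltW fa).
      have [-> ->] := ya b bA; have [-> ->] := fP b bA.
      by rewrite le_eqVlt nA.
    by rewrite !mulr0; ring.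
  - by rewrite mulr0 mulr1; ring.
have uzz' : (a < z) = (a < z') -> (z < a) = (z' < a) -> u' z = u' z'.
  move=> h1 h2; have h3 : (z == a) = (z' == a) by rewrite !eq_le !leNgt h1 h2.
  rewrite /u' h2 h3; congr (_ - _ - _).
  by apply: uA => b; rewrite inE => /predU1P[->//|]; exact: zz'.
have sw x y : same_cut A x y -> same_cut A y x.
  by move=> xy b bA; have [-> ->] := xy b bA.
(* If [a] lies between z and z', both are in the cell of [A] containing [a], where [u'] is
   constant. *)
have btw : z <= a <= z' \/ z' <= a <= z -> u' z = u' z'.
  move=> [/andP[h1 h2]|/andP[h1 h2]].
    by have [/u'a-> /u'a->] := same_cut_between h1 h2 zz'.
  by have [/u'a-> /u'a->] := same_cut_between h1 h2 (sw _ _ zz').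
have [h|h] := ltP z a; have [h'|h'] := ltP z' a.
- by apply: uzz'; rewrite ?h ?h' // !ltNge (ltW h) (ltW h').
- by apply: btw; left; rewrite h' ltW.
- by apply: btw; right; rewrite h ltW.
have [za|az] := leP z a; first by apply: btw; left; rewrite za.
have [z'a|az'] := leP z' a; first by apply: btw; right; rewrite z'a.
by apply: uzz'; rewrite ?az ?az' // !ltNge h h'.
Qed.

Section Determination.
Variables (R : realType) (k : fieldType) (mu mu' : gmeasure R k).
Variable j : line_embedding R.
Local Notation line := (line_sset R).
Local Notation compatible := (compatible mu mu' j).
Local Notation line2_snd := (gmap_comp (gsnd line line) (line2_incl R)).

Hypothesis line_compatible : compatible (to_pt line) (ifun_cst _ 1).
Hypothesis line2_compatible : compatible line2_snd (ifun_cst _ 1).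

Lemma lt_fun_subproof g (p : prod_sset line line) :
  ((act g p).1 < (act g p).2)%R%:R = (p.1 < p.2)%R%:R :> k.
Proof. by rewrite /= oaut_incE. Qed.
Definition lt_fun : inv_fun k (prod_sset line line) := InvFun lt_fun_subproof.

(** The indicator of x < y is the push-forward of 1 from the set of pairs x < y, where the
    hypothesis on [line2_snd] applies. *)
Lemma lt_fun_compatible : compatible (gsnd line line) lt_fun.
Proof.
have iI : injective (line2_incl R) by move=> p q; exact: sval_eq.
have -> : lt_fun = ifun_push mu (line2_incl R) (ifun_cst _ 1).
  apply: ifun_eq => -[x y]; rewrite [LHS]/=; case: ltP => xy.
    pose p : line2_sset R := exist _ (x, y) xy.
    by have := push_inj mu (ifun_cst _ 1) p iI => /= ->.
  rewrite push_notin // => -[[[x' y'] x'y'] _ /= [xE yE]].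
  by move: x'y'; rewrite /= xE yE ltNge xy.
exact: compatible_push (compatible_inj mu mu' _ iI) line2_compatible.
Qed.

(* On the product of an orbit T with the line, the invariant functions are spanned
   by 1 and the indicators of z < u(t) and z = u(t), for the maps u from T to the
   line. *)
Lemma proj_compatible_trans (T : sset R) (t : T) phi :
  orbit t = setT -> compatible (gfst T line) phi.
Proof.
move=> tT; have [us usP] := separating_maps tT (sset_open t).
pose A : seq R := map (fun u : gmap T line => u t) us.
have AP a : a \in A -> exists u : gmap T line, a = u t.
  rewrite /A; elim: us {usP A} => //= u us IH.
  by rewrite inE => /predU1P[->|//]; exists u.
pose P (v : R -> k) := exists2 psi, compatible (gfst T line) psi &
  forall z, psi (t, z) = v z.
have [] : P (fun z => phi (t, z)).
  apply: (@step_function_ind _ _ A).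
  - move=> c v w [psi1 c1 E1] [psi2 c2 E2]; exists (c *: psi1 + psi2).
      exact: compatible_lin.
    by move=> z; rewrite ifunD ifunZ E1 E2.
  - exists (ifun_cst _ 1) => // y; pose p := @to_pt R T.
    apply/(@compatible_cart _ _ _ _ _ (prod_sset T line) line T (pt_sset R)
      (to_pt line) p (gsnd T line) (gfst T line) (ifun_cst _ 1)).
    + by [].
    + by move=> [? ?] [? ?] /= -> ->.
    + by move=> x s _; exists (s, x).
    + exact: line_compatible.
  - move=> a /AP[u ->].
    exists (ifun_pull (gpair (gsnd T line) (gmap_comp u (gfst T line))) lt_fun) => //.
    move=> y; apply/(@compatible_cart _ _ _ _ _ (prod_sset T line)
      (prod_sset line line) T line (gsnd line line) u _ (gfst T line) lt_fun).
    + by [].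
    + by move=> [? ?] [? ?] /= [-> _] ->.
    + by move=> [x x'] s /= ->; exists (s, x).
    + exact: lt_fun_compatible.
  - move=> a /AP[u ->]; pose s := gpair (gmap_id T) u.
    have sI : injective s by move=> ? ? [].
    exists (ifun_push mu s (ifun_cst _ 1)).
      apply: compatible_push (compatible_inj mu mu' _ sI) _; exact: compatible_inj.
    move=> z; case: eqVneq => [->|zu].
      by have := push_inj mu (ifun_cst _ 1) t sI => /= ->.
    by rewrite push_notin // => -[t' _ [tt' zE]]; rewrite -zE tt' eqxx in zu.
  (* An element of the stabilizer of [A] carries z to z'. It fixes the coordinates of [t], hence
     [t], so invariance of [phi] gives equal values. *)
  - move=> z z' /oaut_stab_move[g gA <-].
    rewrite -(ifunE phi g); congr (ifun phi _); congr pair.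
    apply: usP; rewrite /A in gA; elim: us {A AP} gA => //= u us IH gA; split.
      by rewrite gfunE; apply: gA; exact: mem_head.
    by apply: IH => b bA; apply: gA; rewrite inE bA orbT.
move=> psi cpsi E; suff -> : phi = psi by [].
apply: ifun_eq => -[s z]; have [g ->] : orbit t s by rewrite tT.
have -> : (act g t, z) = act g ((t, act g^-1%g z) : prod_sset T line).
  by rewrite -[RHS]/(act g t, act g (act g^-1%g z)) actKV.
by rewrite !ifunE E.
Qed.

(** Base change along the inclusion of the orbit of the given point reduces to a transitive base. *)
Lemma proj_compatible (X : sset R) phi : compatible (gfst X line) phi.
Proof.
move=> x; pose T := orb_of (sval x); pose i := orb_incl T.
have iI : injective i by move=> p q; exact: sval_eq.
have [p _ <-] := hat_lift (f := i) (x := exist _ _ (orbit_refl (sval x))) iI (erefl (sval x)).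
apply/(@compatible_cart _ _ _ _ _ (prod_sset (orb_tset T) line) _ _ _ _ i
  (gpair (gmap_comp i (gfst _ _)) (gsnd _ _)) (gfst _ _)).
- by [].
- by move=> [? ?] [? ?] /= [_ ->] ->.
- by move=> [? z] y /= ->; exists (y, z).
- have [t tT] := tset_trans (orb_tset T).
  exact: (proj_compatible_trans _ tT).
Qed.

(** Factoring [f] as (f, u) followed by a projection along the line absorbs one separating map into
    the target; when none is left, the map is injective. *)
Lemma separated_compatible (Y X : sset R) (f : gmap Y X)
    (us : seq (gmap Y line)) phi :
  (forall p q, f p = f q -> agree us p q -> p = q) -> compatible f phi.
Proof.
elim: us X f phi => [|u us IH] X f phi sep.
  by apply: compatible_inj => p q /sep; exact.
have -> : f = gmap_comp (gfst X line) (gpair f u) by exact: gmap_eq.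
apply: compatible_comp; last exact: proj_compatible.
by apply: IH => p q [fpq upq] pq; exact: sep.
Qed.

Lemma all_compatible (Y X : sset R) (f : gmap Y X) phi : compatible f phi.
Proof.
rewrite (ifun_orb_decomp mu phi); apply: compatible_sum => T.
have iI : injective (orb_incl T) by move=> p q; exact: sval_eq.
apply: compatible_push (compatible_inj mu mu' _ iI) _.
have [t tT] := tset_trans (orb_tset T).
have [us usP] := separating_maps tT (sset_open t).
by apply: (separated_compatible (us := us)) => p q _; exact: usP.
Qed.

End Determination.

(** * The induced tensor functor *)

Lemma perm_pull_iso (R : realType) (k : fieldType) (mu : gmeasure R k)
    (X Y : sset R) (f : gmap Y X) :
  injective f -> (forall x, exists y, f y = x) ->
  exists2 h : gmap X Y, cancel h f &
    @is_iso k (perm mu) _ _ (perm_pull k f) /\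
    [/\ perm_comp mu (perm_pull k h) (perm_pull k f) = perm_id k X &
        perm_comp mu (perm_pull k f) (perm_pull k h) = perm_id k Y].
Proof.
move=> fI fS; pose h x := sval (cid (fS x)).
have hK x : f (h x) = x := svalP (cid (fS x)).
have hE g x : h (act g x) = act g (h x) by apply: fI; rewrite gfunE !hK.
exists (GMap hE) => //.
have e1 : perm_comp mu (perm_pull k (GMap hE)) (perm_pull k f) = perm_id k X.
  by rewrite perm_pull_comp; apply: perm_pull_eq => x /=; rewrite hK.
have e2 : perm_comp mu (perm_pull k f) (perm_pull k (GMap hE)) = perm_id k Y.
  by rewrite perm_pull_comp; apply: perm_pull_eq => y /=; apply: fI; rewrite hK.
by split=> //; exists (perm_pull k (GMap hE)); split.
Qed.

Section HatFunctor.
Variables (R : realType) (k : fieldType) (mu mu' : gmeasure R k).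
Variable j : line_embedding R.
Implicit Types X Y Z : sset R.
Hypothesis compat : forall X Y (f : gmap X Y) phi, compatible mu mu' j f phi.

Definition hat_pair X Y : gmap (hat j (prod_sset X Y)) (prod_sset (hat j X) (hat j Y)) :=
  gpair (hatm j (gfst X Y)) (hatm j (gsnd X Y)).

Lemma hat_pair_inj X Y : injective (@hat_pair X Y).
Proof.
move=> p q /= [e1 e2]; apply: sval_eq.
by move: e1 e2; case: (sval p) (sval q) => [? ?] [? ?] /= -> ->.
Qed.

Lemma hat_pair_surj X Y p : exists q, @hat_pair X Y q = p.
Proof.
case: p => x y; exists (exist _ (sval x, sval y) (supported_pair (svalP x) (svalP y))).
by congr pair; exact: sval_eq.
Qed.

Definition hat_hom X Y (A : perm_hom k X Y) : perm_hom k (hat j X) (hat j Y) :=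
  @InvFun R k (prod_sset (hat j Y) (hat j X)) (fun p => A (sval p.1, sval p.2))
    (fun g p => ifunE A (le_hom j g) (sval p.1, sval p.2)).

Lemma hat_hom_pull X Y (f : gmap Y X) :
  hat_hom (perm_pull k f) = perm_pull k (hatm j f).
Proof.
apply: perm_ext => y x; rewrite [LHS]perm_pullE perm_pullE.
congr (nat_of_bool _)%:R; apply: asbool_equiv_eq.
by split=> [E|->//]; exact: sval_eq.
Qed.

(** Composition is a push-forward along [t13]. Compatibility, which enters the functor only here,
    moves the restriction inside, and the hat of a triple product is the triple product of the
    hats. *)
Lemma hat_hom_comp X Y Z (B : perm_hom k Y Z) (A : perm_hom k X Y) :
  hat_hom (perm_comp mu B A) = perm_comp mu' (hat_hom B) (hat_hom A).
Proof.
apply: perm_ext => z x.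
pose q : hat j (prod_sset Z X) :=
  exist _ (sval z, sval x) (supported_pair (svalP z) (svalP x)).
pose T := triple (hat j Z) (hat j Y) (hat j X).
pose c : gmap (hat j (triple Z Y X)) T :=
  gpair (gmap_comp (@hat_pair Z Y) (hatm j (gfst _ _))) (hatm j (gsnd _ _)).
have cI : injective c.
  move=> p p' /= [e1 e2 e3].
  by apply: sval_eq; move: e1 e2 e3;
    case: (sval p) (sval p') => [[? ?] ?] [[? ?] ?] /= -> -> ->.
have cS t : exists p, c p = t.
  case: t => [[z1 y1] x1].
  exists (exist _ ((sval z1, sval y1), sval x1)
    (supported_pair (supported_pair (svalP z1) (svalP y1)) (svalP x1))).
  by congr (_, _, _); exact: sval_eq.
rewrite -[LHS]/(ifun_push mu _ _ (sval q)) (compat _ _ q).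
pose phi := ifun_mul (ifun_pull (t12 _ _ _) (hat_hom B)) (ifun_pull (t23 _ _ _) (hat_hom A)).
rewrite -[RHS]/(ifun_push mu' (t13 (hat j Z) (hat j Y) (hat j X)) phi (z, x)).
rewrite -(push_bij mu' (t13 (hat j Z) (hat j Y) (hat j X)) phi cI cS).
have -> : gmap_comp (t13 (hat j Z) (hat j Y) (hat j X)) c
  = gmap_comp (@hat_pair Z X) (hatm j (t13 Z Y X)).
  by apply: gmap_eq => p; congr pair; exact: sval_eq.
rewrite -push_comp.
have -> : (z, x) = hat_pair Z X q by congr pair; exact: sval_eq.
rewrite (push_inj _ _ _ (@hat_pair_inj Z X)).
by congr (ifun _ _); congr ifun_push; apply: ifun_eq => -[[[? ?] ?] ?].
Qed.

Lemma hat_hom_tens X X' Y Y' (A : perm_hom k X X') (B : perm_hom k Y Y') :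
  perm_comp mu' (perm_pull k (@hat_pair X' Y')) (perm_tensm (hat_hom A) (hat_hom B))
  = perm_comp mu' (hat_hom (perm_tensm A B)) (perm_pull k (@hat_pair X Y)).
Proof.
apply: perm_ext => p q; rewrite perm_comp_pull.
have [q' <-] := hat_pair_surj q.
by rewrite (perm_comp_pullr_inj _ _ _ _ (@hat_pair_inj X Y)).
Qed.

Definition hat_functor : tensor_functor (perm mu) (perm mu').
Proof.
refine (@TensorFunctor k (perm mu) (perm mu') (hat j) hat_hom _ _ hat_hom_comp
  (perm_pull k (to_pt (hat j (pt_sset R)))) _
  (fun X Y => perm_pull k (@hat_pair X Y)) _ hat_hom_tens _ _ _ _).
- by move=> X Y a f g; apply: ifun_eq.
- move=> X; rewrite [LHS]hat_hom_pull; apply: perm_pull_eq => x; exact: sval_eq.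
- have [||h _ []//] := @perm_pull_iso R k mu' _ _ (to_pt (hat j (pt_sset R))).
    by move=> p q _; apply: sval_eq; case: (sval p) (sval q) => [] [].
  move=> []; have tP : supported j (tt : pt_sset R) by exists [::].
  by exists (exist _ tt tP).
- move=> X Y; have [||h _ []//] := @perm_pull_iso R k mu' _ _ (@hat_pair X Y).
    exact: hat_pair_inj.
  exact: hat_pair_surj.
- move=> X Y Z; rewrite /= !hat_hom_pull !perm_tensm_pull !perm_pull_comp.
  by apply: perm_pull_eq => x /=; congr (_, _, _); exact: sval_eq.
- move=> X; rewrite /= !hat_hom_pull !perm_tensm_pull !perm_pull_comp.
  by apply: perm_pull_eq => x /=; congr (_, _); exact: sval_eq.
- move=> X; rewrite /= !hat_hom_pull !perm_tensm_pull !perm_pull_comp.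
  by apply: perm_pull_eq => x /=; congr (_, _); exact: sval_eq.
- move=> X Y; rewrite /= !hat_hom_pull !perm_pull_comp.
  by apply: perm_pull_eq => x /=; congr (_, _); exact: sval_eq.
Defined.

End HatFunctor.

(** * Extension of tensor functors to Karoubi envelopes *)

Section KaroubiFunctor.
Variables (k : fieldType) (C D : tensor_cat k) (F : tensor_functor C D).

Lemma kar_map_ob_subproof (X : kar_ob C) :
  fmor F (kid X) \co fmor F (kid X) = fmor F (kid X).
Proof. by rewrite -fmor_comp kid_idem. Qed.
Definition kar_map_ob (X : karoubi C) : karoubi D := KarOb (kar_map_ob_subproof X).

Lemma kar_map_hom_subproof (X Y : kar_ob C) (f : kar_hom X Y) :
  kid (kar_map_ob Y) \co fmor F (kmor f) \co kid (kar_map_ob X) = fmor F (kmor f).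
Proof. by rewrite -!fmor_comp kmorP. Qed.
Definition kar_map_hom (X Y : karoubi C) (f : hom X Y) :
  hom (kar_map_ob X) (kar_map_ob Y) :=
  @KarHom k D (kar_map_ob X) (kar_map_ob Y) _ (kar_map_hom_subproof f).

Lemma kar_map_fun1_subproof :
  fun1 F \co kid (kar_unit D) = kid (kar_map_ob (kar_unit C)) \co fun1 F.
Proof. by rewrite /= fmor1 comp1m compm1. Qed.
Definition kar_map_fun1 : hom (tunit : karoubi D) (kar_map_ob tunit) :=
  @kar_cut k D (kar_unit D) (kar_map_ob (kar_unit C)) _ kar_map_fun1_subproof.

Definition kar_map_fun2 (X Y : karoubi C) :
    hom (kar_map_ob X \ox kar_map_ob Y) (kar_map_ob (X \ox Y)) :=
  @kar_cut k D (kar_tens (kar_map_ob X) (kar_map_ob Y))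
    (kar_map_ob (kar_tens X Y)) _ (fun2_nat F (kid X) (kid Y)).

Let F1 X : fmor F (idm X) = idm (F X). Proof. exact: fmor1. Qed.

(** In the coherence axioms, [cut_comp] gathers the idempotents on the right of each composite,
    after which the axiom for [F] applies. *)
Definition kar_map : tensor_functor (karoubi C) (karoubi D).
Proof.
refine (@TensorFunctor k (karoubi C) (karoubi D) kar_map_ob kar_map_hom _ _ _
  kar_map_fun1 _ kar_map_fun2 _ _ _ _ _ _).
- move=> X Y a f g; apply: kar_hom_eq.
  exact: (fmor_lin F a (kmor f) (kmor g)).
- by move=> X; apply: kar_hom_eq.
- by move=> X Y Z g f; apply: kar_hom_eq; rewrite /= fmor_comp.
- have [g [gf fg]] := fun1_iso F.
  have gE : g \co kid (kar_map_ob (kar_unit C)) = kid (kar_unit D) \co g.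
    by rewrite /= F1 comp1m compm1.
  exists (@kar_cut k D (kar_map_ob (kar_unit C)) (kar_unit D) g gE).
  by split; apply: kar_hom_eq; rewrite /= F1 !compm1.
- move=> X Y; have [g [gf fg]] := fun2_iso F (kob X) (kob Y).
  have gE : g \co fmor F (kid X \oxm kid Y) = (fmor F (kid X) \oxm fmor F (kid Y)) \co g.
    rewrite -[RHS]comp1m -gf -[RHS]compA (compA (fun2 _ _ _)) fun2_nat.
    by rewrite -(compA _ _ g) fg compm1.
  exists (@kar_cut k D (kar_map_ob (kar_tens X Y))
    (kar_tens (kar_map_ob X) (kar_map_ob Y)) g gE).
  split; apply: kar_hom_eq; rewrite /= cut_comp ?gf ?fg ?comp1m //.
  + by rewrite -tensm_comp -!fmor_comp !kid_idem.
  + exact: fun2_nat.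
  + by rewrite -fmor_comp -tensm_comp !kid_idem.
- move=> X X' Y Y' f g; apply: kar_hom_eq => /=.
  rewrite -compA -tensm_comp -!fmor_comp !kmor_idl compA -fun2_nat -compA.
  by rewrite -tensm_comp -!fmor_comp !kmor_idr.
- move=> X Y Z; apply: kar_hom_eq => /=.
  have idem : (fmor F (kid X) \oxm fmor F (kid Y) \oxm fmor F (kid Z))
      \co (fmor F (kid X) \oxm fmor F (kid Y) \oxm fmor F (kid Z))
      = fmor F (kid X) \oxm fmor F (kid Y) \oxm fmor F (kid Z).
    by rewrite -!tensm_comp -!fmor_comp !kid_idem.
  have eq1 : (fun2 F (kob X) (kob Y) \co (fmor F (kid X) \oxm fmor F (kid Y)))
      \oxm fmor F (kid Z)
    = (fun2 F (kob X) (kob Y) \oxm idm _)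
      \co (fmor F (kid X) \oxm fmor F (kid Y) \oxm fmor F (kid Z)).
    by rewrite -tensm_comp comp1m.
  have eq2 : fmor F (kid X)
      \oxm (fun2 F (kob Y) (kob Z) \co (fmor F (kid Y) \oxm fmor F (kid Z)))
    = (idm _ \oxm fun2 F (kob Y) (kob Z))
      \co (fmor F (kid X) \oxm (fmor F (kid Y) \oxm fmor F (kid Z))).
    by rewrite -tensm_comp comp1m.
  rewrite eq1 eq2 fmor_comp.
  have idem1 : (fmor F (kid X \oxm kid Y) \oxm fmor F (kid Z))
      \co (fmor F (kid X \oxm kid Y) \oxm fmor F (kid Z))
      = fmor F (kid X \oxm kid Y) \oxm fmor F (kid Z).
    by rewrite -!tensm_comp -!fmor_comp -!tensm_comp !kid_idem.
  have idem2 : (fmor F (kid X) \oxm fmor F (kid Y \oxm kid Z))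
      \co (fmor F (kid X) \oxm fmor F (kid Y \oxm kid Z))
      = fmor F (kid X) \oxm fmor F (kid Y \oxm kid Z).
    by rewrite -!tensm_comp -!fmor_comp -!tensm_comp !kid_idem.
  rewrite (cut_comp _ idem1 (fun2_nat _ _ _)).
  rewrite (cut_comp _ idem); last by rewrite -!tensm_comp fun2_nat comp1m compm1.
  rewrite fun2_ass.
  rewrite (cut_comp _ _ (_ : _ = (fmor F (kid X) \oxm fmor F (kid Y \oxm kid Z)) \co _)).
  + by rewrite (cut_comp _ idem) // ass_nat.
  + by rewrite -!tensm_comp -!fmor_comp !kid_idem.
  + by rewrite -!tensm_comp fun2_nat comp1m compm1.
- move=> X; apply: kar_hom_eq => /=; rewrite compm1 fmor_comp.
  have idem1 : (fmor F (idm tunit) \oxm fmor F (kid X))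
      \co (fmor F (idm tunit) \oxm fmor F (kid X))
      = fmor F (idm tunit) \oxm fmor F (kid X).
    by rewrite -!tensm_comp -!fmor_comp kid_idem comp1m.
  have eq1 : fun1 F \oxm fmor F (kid X)
      = (fun1 F \oxm idm _) \co (idm tunit \oxm fmor F (kid X)).
    by rewrite -tensm_comp compm1 comp1m.
  rewrite eq1 (cut_comp _ idem1 (fun2_nat _ _ _)) (cut_comp _ _ _) ?fun2_lun //.
  + by rewrite -!tensm_comp -!fmor_comp kid_idem comp1m.
  + by rewrite -!tensm_comp F1 !comp1m !compm1.
- move=> X; apply: kar_hom_eq => /=; rewrite compm1 fmor_comp.
  have idem1 : (fmor F (kid X) \oxm fmor F (idm tunit))
      \co (fmor F (kid X) \oxm fmor F (idm tunit))
      = fmor F (kid X) \oxm fmor F (idm tunit).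
    by rewrite -!tensm_comp -!fmor_comp kid_idem comp1m.
  have eq1 : fmor F (kid X) \oxm fun1 F
      = (idm _ \oxm fun1 F) \co (fmor F (kid X) \oxm idm tunit).
    by rewrite -tensm_comp compm1 comp1m.
  rewrite eq1 (cut_comp _ idem1 (fun2_nat _ _ _)) (cut_comp _ _ _) ?fun2_run //.
  + by rewrite -!tensm_comp -!fmor_comp kid_idem comp1m.
  + by rewrite -!tensm_comp F1 !comp1m !compm1.
- move=> X Y; apply: kar_hom_eq => /=; rewrite fmor_comp.
  have idem : (fmor F (kid X) \oxm fmor F (kid Y)) \co (fmor F (kid X) \oxm fmor F (kid Y))
      = fmor F (kid X) \oxm fmor F (kid Y).
    by rewrite -!tensm_comp -!fmor_comp !kid_idem.
  rewrite (cut_comp _ idem (fun2_nat _ _ _)) fun2_sym.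
  by rewrite (cut_comp _ idem (sym_nat _ _)).
Defined.

End KaroubiFunctor.

(** * Commutative algebras in a tensor category *)

Section TensorAlgebra.
Variables (k : fieldType) (C : tensor_cat k).

(* The interchange (A * B) * (A' * B') -> (A * A') * (B * B') used in [tens_alg]. *)
Definition mid (A B A' B' : C) :
    hom ((A \ox B) \ox (A' \ox B')) ((A \ox A') \ox (B \ox B')) :=
  assi A A' (B \ox B')
    \co (idm A \oxm (ass A' B B' \co (sym B A' \oxm idm B') \co assi B A' B'))
    \co ass A B (A' \ox B').

Lemma mid_nat (A B A' B' A1 B1 A1' B1' : C) (f : hom A A1) (g : hom B B1)
    (f' : hom A' A1') (g' : hom B' B1') :
  mid A1 B1 A1' B1' \co ((f \oxm g) \oxm (f' \oxm g'))
  = ((f \oxm f') \oxm (g \oxm g')) \co mid A B A' B'.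
Proof.
rewrite /mid -!compA ass_nat (compA _ (f \oxm _)) -tensm_comp comp1m.
have -> : (ass A1' B1 B1' \co ((sym B1 A1' \oxm idm B1') \co assi B1 A1' B1'))
    \co (g \oxm (f' \oxm g'))
  = (f' \oxm (g \oxm g')) \co (ass A' B B' \co ((sym B A' \oxm idm B') \co assi B A' B')).
  rewrite -!compA assi_nat (compA _ ((g \oxm f') \oxm _)) -tensm_comp sym_nat comp1m.
  rewrite [RHS]compA -ass_nat -!compA; congr (_ \co _).
  by rewrite [RHS]compA -tensm_comp compm1.
rewrite [in RHS]compA -assi_nat -!compA; congr (_ \co _).
by rewrite [RHS]compA -tensm_comp compm1.
Qed.

Lemma tens_alg_mulE (A B : alg C) :
  mul (tens_alg A B) = (mul A \oxm mul B) \co mid A B A B.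
Proof. by rewrite /mid /= !compA. Qed.

Section CommAlgebra.
Variables (E : alg C).
Hypothesis Ecomm : is_comm_algebra E.
Let m := mul E.
Let mA : m \co (m \oxm idm _) = m \co (idm _ \oxm m) \co ass _ _ _.
Proof. by case: Ecomm. Qed.
Let mC : m \co sym _ _ = m. Proof. by case: Ecomm. Qed.

(** The interchange swaps the middle factors of a fourfold product, which does not affect a
    commutative associative multiplication. *)
Lemma mul_mid : m \co (m \oxm m) \co mid E E E E = m \co (m \oxm m).
Proof.
have mm : m \co (m \oxm m) = m \co (idm _ \oxm (m \co (idm _ \oxm m))) \co ass _ _ _.
  have -> : m \oxm m = (m \oxm idm _) \co (idm _ \oxm m).
    by rewrite -tensm_comp compm1 comp1m.
  rewrite compA mA -tensm1 -compA ass_nat !compA -(compA m) -tensm_comp comp1m.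
  by [].
rewrite {1}mm /mid !compA -(compA _ (ass _ _ _)) assiK compm1.
rewrite -(compA m) -tensm_comp comp1m.
have -> : m \co (idm E \oxm m)
    \co (ass E E E \co (sym E E \oxm idm E) \co assi E E E) = m \co (idm E \oxm m).
  rewrite !compA -mA -(compA m) -tensm_comp mC comp1m mA -!compA assiK compm1.
  by [].
by rewrite mm.
Qed.

(** This is the copairing of x and y out of the coproduct of commutative algebras, dually the point
    (x, y). Its multiplicativity comes from [mul_mid]. *)
Lemma alg_map_mul (A B : alg C) (x : hom A E) (y : hom B E) :
  is_alg_map x -> is_alg_map y -> is_alg_map (A := tens_alg A B) (m \co (x \oxm y)).
Proof.
move=> [xm x1] [ym y1]; split.
  rewrite tens_alg_mulE -!compA (compA (x \oxm y)) -tensm_comp xm ym tensm_comp.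
  rewrite -(compA (mul E \oxm mul E)) -mid_nat.
  rewrite (compA (m \oxm m)) (compA m _ ((x \oxm y) \oxm _)) (compA m (m \oxm m)) mul_mid -!compA -!tensm_comp.
  by [].
rewrite /= !compA -(compA m) -tensm_comp x1 y1.
have -> : one E \oxm one E = (idm _ \oxm one E) \co (one E \oxm idm tunit).
  by rewrite -tensm_comp compm1 comp1m.
by case: Ecomm => _ _ e1 _; rewrite compA e1 run_nat -compA runiK compm1.
Qed.

End CommAlgebra.

(* The algebra map X * X -> X^3 dual to the projection on the first and third
   coordinates *)
Definition outer13 (X : alg C) : hom (X \ox X) ((X \ox X) \ox X) :=
  ((idm X \oxm one X) \oxm idm X) \co (runi X \oxm idm X).

(* The product t : X^3 -> E of x, y and z absorbs the indicators M12 and M23 of the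
   relations between x, y and y, z; hence it absorbs M13. *)
Lemma related_trans (X : rel_alg C) (s : hom (rel_part X) (X \ox X))
    (M13 : hom ((X \ox X) \ox X) ((X \ox X) \ox X)) (E : alg C) (x y z : hom X E) :
  let M := s \co rel_map X in
  let M12 := M \oxm idm X in
  let M23 := assi X X X \co (idm X \oxm M) \co ass X X X in
  is_alg_map (A := tens_alg X X) (rel_map X) ->
  rel_map X \co s = idm _ ->
  M13 \co outer13 X = outer13 X \co M ->
  M12 \co M23 \co M13 = M12 \co M23 ->
  is_comm_algebra E -> is_alg_map x -> is_alg_map y -> is_alg_map z ->
  related x y -> related y z -> related x z.
Proof.
move=> M M12 M23 [relm rel1] rels M13E M123 EC xa ya za [r1 _ r1E] [r2 _ r2E].
have [mA l1 u1 mC] := EC.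
pose m := mul E.
have absorb (a b : hom X E) r : r \co rel_map X = m \co (a \oxm b) ->
    m \co (a \oxm b) \co M = m \co (a \oxm b).
  by move=> <-; rewrite /M -compA (compA _ s) rels comp1m.
pose t := m \co ((m \co (x \oxm y)) \oxm z).
have tE : t = m \co (x \oxm (m \co (y \oxm z))) \co ass X X X.
  have -> : t = m \co (m \oxm idm _) \co ((x \oxm y) \oxm z).
    by rewrite -compA -tensm_comp comp1m.
  rewrite mA -!compA ass_nat !compA -(compA m (idm _ \oxm _)) -tensm_comp comp1m.
  by [].
have t12 : t \co M12 = t.
  by rewrite /t -compA -tensm_comp compm1 (absorb _ _ _ r1E).
have t23 : t \co M23 = t.
  rewrite {1}tE /M23 !compA -(compA _ (ass _ _ _)) assiK compm1.
  by rewrite -(compA m) -tensm_comp compm1 (absorb _ _ _ r2E) tE.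
have t13 : t \co M13 = t.
  by rewrite -{1}t23 -{1}t12 -(compA t) -compA M123 compA t12 t23.
pose xz := m \co (x \oxm z).
(* Along [outer13] the factor [y] is evaluated at the unit and disappears. *)
have tj : t \co outer13 X = xz.
  rewrite /t /outer13 -compA !(compA (_ \oxm z)) -!tensm_comp !compm1.
  congr (m \co (_ \oxm z)).
  rewrite -(compA m) -tensm_comp compm1; case: ya => _ ->.
  have -> : x \oxm one E = (idm _ \oxm one E) \co (x \oxm idm tunit).
    by rewrite -tensm_comp compm1 comp1m.
  by rewrite compA u1 run_nat -compA runiK compm1.
have xzM : xz \co M = xz by rewrite -tj -compA -M13E compA t13.
have rE : xz \co s \co rel_map X = xz by rewrite -compA xzM.
have [xzm xz1] := alg_map_mul EC xa za.
exists (xz \co s) => //; split; last first.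
  by rewrite -rel1 compA rE.
(* Multiplicativity is checked after precomposition with the split epimorphism
   [rel_map X \oxm rel_map X], where it becomes that of [xz]. *)
have sect : (rel_map X \oxm rel_map X) \co (s \oxm s) = idm _.
  by rewrite -tensm_comp rels tensm1.
rewrite -[LHS]compm1 -[RHS]compm1 -sect !compA; congr (_ \co _).
rewrite -(compA _ (mul _)) -relm compA rE xzm.
by rewrite -[RHS]compA -tensm_comp rE.
Qed.

End TensorAlgebra.

(** * The algebras C(X) *)

Section PermTranspose.
Variables (R : realType) (k : fieldType) (mu : gmeasure R k).
Implicit Types X Y Z W : sset R.

Definition perm_tr X Y (A : perm_hom k X Y) : perm_hom k Y X :=
  ifun_pull (gswap X Y) A.

(** Transposition reverses composition and exchanges pull-backs with push-forwards, so the rules for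
    composing with the former yield those for the latter. *)
Lemma perm_tr_comp X Y Z (B : perm_hom k Y Z) (A : perm_hom k X Y) :
  perm_tr (perm_comp mu B A) = perm_comp mu (perm_tr A) (perm_tr B).
Proof.
apply: perm_ext => x z.
pose c : gmap (triple Z Y X) (triple X Y Z) :=
  gpair (gpair (gsnd _ _) (gmap_comp (gsnd Z Y) (gfst _ _)))
    (gmap_comp (gfst Z Y) (gfst _ _)).
have cI : injective c by move=> [[? ?] ?] [[? ?] ?] /= [-> -> ->].
have cS t : exists p, c p = t by case: t => [[a b] d]; exists ((d, b), a).
have sI : injective (gswap Z X) by move=> [? ?] [? ?] /= [-> ->].
pose phi := ifun_mul (ifun_pull (t12 X Y Z) (perm_tr A)) (ifun_pull (t23 X Y Z) (perm_tr B)).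
rewrite -[RHS]/(ifun_push mu (t13 X Y Z) phi (x, z)).
rewrite -(push_bij mu (t13 X Y Z) phi cI cS).
have -> : gmap_comp (t13 X Y Z) c = gmap_comp (gswap Z X) (t13 Z Y X) by exact: gmap_eq.
rewrite -push_comp -[(x, z)]/(gswap Z X (z, x)) push_inj //.
rewrite -[LHS]/(ifun_push mu (t13 Z Y X) _ (z, x)).
congr (ifun _ _); congr ifun_push; apply: ifun_eq => -[[c1 b1] a1] /=.
by rewrite mulrC.
Qed.

Lemma perm_comp_push X Y Z (f : gmap Y X) (A : perm_hom k X Z) z y :
  perm_comp mu A (perm_push k f) (z, y) = A (z, f y).
Proof.
have := perm_tr_comp A (perm_push k f) => /(congr1 (fun B : perm_hom k Z Y => B (y, z))).
rewrite -[X in X = _]/(perm_comp mu A (perm_push k f) (z, y)) => ->.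
exact: perm_comp_pull.
Qed.

Lemma perm_pushl_inj X Y W (f : gmap Y X) (A : perm_hom k W Y) y w :
  injective f -> perm_comp mu (perm_push k f) A (f y, w) = A (y, w).
Proof.
move=> fI; have := perm_tr_comp (perm_push k f) A => /(congr1 (fun B : perm_hom k X W => B (w, f y))).
rewrite -[X in X = _]/(perm_comp mu (perm_push k f) A (f y, w)) => ->.
exact: perm_comp_pullr_inj.
Qed.

Lemma perm_pushl_notin X Y W (f : gmap Y X) (A : perm_hom k W Y) x w :
  ~ range f x -> perm_comp mu (perm_push k f) A (x, w) = 0.
Proof.
move=> fx; have := perm_tr_comp (perm_push k f) A => /(congr1 (fun B : perm_hom k X W => B (w, x))).
rewrite -[X in X = _]/(perm_comp mu (perm_push k f) A (x, w)) => ->.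
exact: perm_comp_pullr_notin.
Qed.

Lemma perm_push_comp X Y Z (f : gmap Y X) (h : gmap Z Y) :
  perm_comp mu (perm_push k f) (perm_push k h) = perm_push k (gmap_comp f h).
Proof. by apply: perm_ext => x z; rewrite perm_comp_push. Qed.

Lemma perm_push_eq X Y (f h : gmap Y X) : f =1 h -> perm_push k f = perm_push k h.
Proof. by move=> fh; congr perm_push; exact: gmap_eq. Qed.

Lemma perm_pull_push X Y (f : gmap Y X) :
  injective f -> perm_comp mu (perm_pull k f) (perm_push k f) = perm_id k Y.
Proof.
move=> fI; apply: perm_ext => y y'; rewrite perm_comp_push !perm_pullE.
by congr (nat_of_bool _)%:R; apply: asbool_equiv_eq; split=> [/fI->|->].
Qed.

Lemma perm_tensm_push X X' Y Y' (f : gmap X' X) (h : gmap Y' Y) :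
  perm_tensm (perm_push k f) (perm_push k h)
  = perm_push k (gpair (gmap_comp f (gfst X' Y')) (gmap_comp h (gsnd X' Y')) :
                gmap (prod_sset X' Y') (prod_sset X Y)).
Proof.
transitivity (perm_tr (perm_tensm (perm_pull k f) (perm_pull k h))).
  by apply: perm_ext => -[? ?] [? ?].
by rewrite perm_tensm_pull.
Qed.

Lemma perm_tensm_id X Y : perm_tensm (perm_id k X) (perm_id k Y) = perm_id k (prod_sset X Y).
Proof. by rewrite perm_tensm_pull; apply: perm_pull_eq => -[]. Qed.

End PermTranspose.

(** * Duality and étaleness of C(X) *)

Section PermAlgebras.
Variables (R : realType) (k : fieldType) (mu : gmeasure R k).
Implicit Types X Y Z W : sset R.
Local Notation P := (perm mu).
Local Notation K := (karoubi P).

Definition kperm_alg X : alg K := map_alg (kar_functor P) (perm_alg mu X).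

Definition kpull X Y (f : gmap Y X) : hom (kperm_alg X) (kperm_alg Y) :=
  @kar_embm k P X Y (perm_pull k f).

Lemma kpull_iso X Y (f : gmap Y X) :
  injective f -> (forall x, exists y, f y = x) -> is_iso (kpull f).
Proof.
move=> fI fS; have [h _ [_ [e1 e2]]] := perm_pull_iso mu fI fS.
exists (kpull h); split; apply: kar_hom_eq; first exact: e1.
exact: e2.
Qed.

Lemma kpull_alg_map X Y (f : gmap Y X) : is_alg_map (kpull f).
Proof.
split; apply: kar_hom_eq; rewrite /= /perm_id !(perm_pull_comp, perm_tensm_pull).
  exact: perm_pull_eq.
exact: perm_pull_eq.
Qed.

Lemma kperm_alg_comm X : is_comm_algebra (kperm_alg X).
Proof.
split; apply: kar_hom_eq; rewrite /= /perm_id !(perm_pull_comp, perm_tensm_pull).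
- exact: perm_pull_eq.
- exact: perm_pull_eq.
- exact: perm_pull_eq.
- exact: perm_pull_eq.
Qed.

Section Duality.
Variable X : sset R.
Local Notation pushp := (perm_push k).
Local Notation pullp := (perm_pull k).
Local Notation "B \pc A" := (perm_comp mu B A) (at level 40, left associativity).

(** C(X) is its own dual; the kernels of coevaluation and evaluation are both the indicator of the
    diagonal. *)
Definition perm_coev : perm_hom k (pt_sset R) (prod_sset X X) :=
  pushp (gdiag X) \pc pullp (to_pt X).
Definition perm_ev : perm_hom k (prod_sset X X) (pt_sset R) :=
  pushp (to_pt X) \pc pullp (gdiag X).

Lemma gdiag_inj : injective (gdiag X).
Proof. by move=> ? ? []. Qed.

Lemma perm_coevE x x' : perm_coev ((x, x'), tt) = (`[< x = x' >])%:R.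
Proof.
rewrite /perm_coev; case: asboolP => [<-|ne].
  rewrite -[(x, x)]/(gdiag X x) perm_pushl_inj; last exact: gdiag_inj.
  by rewrite perm_pullE asboolT.
by rewrite perm_pushl_notin // => -[y _ [yx yx']]; apply: ne; rewrite -yx.
Qed.

Lemma perm_evE x x' : perm_ev (tt, (x, x')) = (`[< x = x' >])%:R.
Proof.
rewrite /perm_ev; case: asboolP => [<-|ne].
  rewrite -[(x, x)]/(gdiag X x) perm_comp_pullr_inj; last exact: gdiag_inj.
  by rewrite perm_pushE asboolT.
by rewrite perm_comp_pullr_notin // => -[y _ [yx yx']]; apply: ne; rewrite -yx.
Qed.

Lemma perm_id_push Z : perm_id k Z = pushp (gmap_id Z).
Proof.
apply: perm_ext => x y; rewrite perm_pullE perm_pushE.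
by congr (nat_of_bool _)%:R; apply: asbool_equiv_eq.
Qed.

Definition gprod X1 X2 Y1 Y2 (f : gmap X1 X2) (h : gmap Y1 Y2) :
    gmap (prod_sset X1 Y1) (prod_sset X2 Y2) :=
  gpair (gmap_comp f (gfst _ _)) (gmap_comp h (gsnd _ _)).

Lemma perm_tensm_ev : perm_tensm (perm_id k X) perm_ev
  = pushp (gprod (gmap_id X) (to_pt X)) \pc pullp (gprod (gmap_id X) (gdiag X)).
Proof.
rewrite -[perm_id k X](perm_comp1m mu) /perm_ev perm_tensm_comp.
by rewrite {1}perm_id_push perm_tensm_push perm_tensm_pull.
Qed.

Lemma perm_tensm_coev : perm_tensm perm_coev (perm_id k X)
  = pushp (gprod (gdiag X) (gmap_id X)) \pc pullp (gprod (to_pt X) (gmap_id X)).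
Proof.
rewrite -[perm_id k X](perm_comp1m mu) /perm_coev perm_tensm_comp.
by rewrite {1}perm_id_push perm_tensm_push perm_tensm_pull.
Qed.

Lemma perm_tens_ev : perm_tensm perm_ev (perm_id k X)
  = pushp (gprod (to_pt X) (gmap_id X)) \pc pullp (gprod (gdiag X) (gmap_id X)).
Proof.
rewrite -[perm_id k X](perm_comp1m mu) /perm_ev perm_tensm_comp.
by rewrite {1}perm_id_push perm_tensm_push perm_tensm_pull.
Qed.

Lemma perm_tens_coev : perm_tensm (perm_id k X) perm_coev
  = pushp (gprod (gmap_id X) (gdiag X)) \pc pullp (gprod (gmap_id X) (to_pt X)).
Proof.
rewrite -[perm_id k X](perm_comp1m mu) /perm_coev perm_tensm_comp.
by rewrite {1}perm_id_push perm_tensm_push perm_tensm_pull.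
Qed.

Lemma perm_diagE x1 x2 y1 y2 :
  (pushp (gdiag X) \pc pullp (gdiag X)) ((x1, x2), (y1, y2))
  = (`[< [/\ x1 = x2, y1 = y2 & x1 = y1] >])%:R.
Proof.
case: asboolP => [[<- <- <-]|ne].
  rewrite -[(x1, x1)]/(gdiag X x1) perm_pushl_inj; last exact: gdiag_inj.
  by rewrite perm_pullE asboolT.
have [xx|nx] := pselect (x1 = x2); last first.
  by rewrite perm_pushl_notin // => -[z _ [zx zx']]; apply: nx; rewrite -zx.
rewrite -xx -[(x1, x1)]/(gdiag X x1) perm_pushl_inj; last exact: gdiag_inj.
by rewrite perm_pullE asboolF // => -[y1x y2x]; apply: ne; rewrite y1x y2x.
Qed.

(** The Frobenius identity for multiplication and its transpose. With it, the zigzag equations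
    follow from functoriality of pull-backs and push-forwards. *)
Lemma perm_frobenius :
  pullp (gprod (gmap_id X) (gdiag X))
    \pc (pullp (gassi X X X) \pc pushp (gprod (gdiag X) (gmap_id X)))
  = pushp (gdiag X) \pc pullp (gdiag X).
Proof.
rewrite perm_compA perm_pull_comp; apply: perm_ext => -[x1 x2] [y1 y2].
rewrite perm_comp_pull perm_pushE perm_diagE.
congr (nat_of_bool _)%:R; apply: asbool_equiv_eq => /=.
by split=> [[-> <- ->]|[-> -> ->]].
Qed.

Lemma perm_frobenius' :
  pullp (gprod (gdiag X) (gmap_id X))
    \pc (pullp (gass X X X) \pc pushp (gprod (gmap_id X) (gdiag X)))
  = pushp (gdiag X) \pc pullp (gdiag X).
Proof.
rewrite perm_compA perm_pull_comp; apply: perm_ext => -[x1 x2] [y1 y2].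
rewrite perm_comp_pull perm_pushE perm_diagE.
congr (nat_of_bool _)%:R; apply: asbool_equiv_eq => /=.
by split=> [[<- -> ->]|[-> -> ->]].
Qed.

Lemma perm_zigzag :
  pullp (grun X) \pc perm_tensm (perm_id k X) perm_ev \pc pullp (gassi X X X)
    \pc perm_tensm perm_coev (perm_id k X) = pullp (glun X).
Proof.
rewrite perm_tensm_ev perm_tensm_coev -!perm_compA.
rewrite !(perm_compA _ _ _ (pullp (gprod (to_pt X) (gmap_id X)))) perm_frobenius.
rewrite -!perm_compA perm_pull_comp !perm_compA.
have -> : pullp (grun X) \pc pushp (gprod (gmap_id X) (to_pt X)) = pushp (gfst X X).
  apply: perm_ext => x [x1 x2]; rewrite perm_comp_pull !perm_pushE.
  by congr (nat_of_bool _)%:R; apply: asbool_equiv_eq => /=; split=> [[->]|->].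
rewrite perm_push_comp.
rewrite (perm_push_eq k (h := gmap_id X)) // -perm_id_push perm_comp1m.
exact: perm_pull_eq.
Qed.

Lemma perm_zagzig :
  pullp (glun X) \pc perm_tensm perm_ev (perm_id k X) \pc pullp (gass X X X)
    \pc perm_tensm (perm_id k X) perm_coev = pullp (grun X).
Proof.
rewrite perm_tens_ev perm_tens_coev -!perm_compA.
rewrite !(perm_compA _ _ _ (pullp (gprod (gmap_id X) (to_pt X)))) perm_frobenius'.
rewrite -!perm_compA perm_pull_comp !perm_compA.
have -> : pullp (glun X) \pc pushp (gprod (to_pt X) (gmap_id X)) = pushp (gsnd X X).
  apply: perm_ext => x [x1 x2]; rewrite perm_comp_pull !perm_pushE.
  by congr (nat_of_bool _)%:R; apply: asbool_equiv_eq => /=; split=> [[->]|->].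
rewrite perm_push_comp.
rewrite (perm_push_eq k (h := gmap_id X)) // -perm_id_push perm_comp1m.
exact: perm_pull_eq.
Qed.

Lemma kperm_coev_subproof : kid (kar_tens (kar_emb (X : P)) (kar_emb (X : P)))
  \co (perm_coev : hom (tunit : P) ((X : P) \ox (X : P))) \co kid (kar_unit P) = perm_coev.
Proof. by rewrite /= perm_tensm_id perm_comp1m perm_compm1. Qed.
Lemma kperm_ev_subproof : kid (kar_unit P)
  \co (perm_ev : hom ((X : P) \ox (X : P)) (tunit : P))
  \co kid (kar_tens (kar_emb (X : P)) (kar_emb (X : P))) = perm_ev.
Proof. by rewrite /= perm_tensm_id perm_comp1m perm_compm1. Qed.

Definition kperm_dual : @dual k K (kperm_alg X).
Proof.
refine (@Dual k K (kperm_alg X) (kperm_alg X) (KarHom kperm_coev_subproof)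
  (KarHom kperm_ev_subproof) _ _).
- apply: kar_hom_eq; rewrite /= !perm_tensm_id !perm_compm1; exact: perm_zigzag.
- apply: kar_hom_eq; rewrite /= !perm_tensm_id !perm_compm1; exact: perm_zagzig.
Defined.

(** Under self-duality, passing to the adjoint merely moves the variable y of the kernel from the
    source to the target. *)
Lemma perm_adjointE Z (B : perm_hom k (prod_sset X X) Z) z x y :
  (perm_tensm B (perm_id k X) \pc pullp (gass X X X)
    \pc perm_tensm (perm_id k X) perm_coev \pc pullp (gfst X (pt_sset R))) ((z, y), x)
  = B (z, (x, y)).
Proof.
pose s : gmap (prod_sset X X) (prod_sset (prod_sset X X) X) :=
  gpair (gmap_id _) (gsnd X X).
have sI : injective s by move=> ? ? [].
rewrite -!perm_compA.
have -> : pullp (gass X X X) \pc (perm_tensm (perm_id k X) perm_coev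
    \pc pullp (gfst X (pt_sset R))) = pushp s \pc pullp (gfst X X).
  apply: perm_ext => -[[x1 x2] x3] x0; rewrite perm_comp_pull.
  rewrite -[x0 in LHS]/(gfst X (pt_sset R) (x0, tt)) perm_comp_pullr_inj; last first.
    by move=> [? []] [? []] /= ->.
  rewrite -[gass X X X _]/(x1, (x2, x3)) perm_tensmE perm_coevE.
  case: (asboolP (x2 = x3)) => [<-|ne]; last first.
    rewrite mulr0 perm_pushl_notin // => -[[u v] _ /= [_ uE vE]].
    by apply: ne; rewrite -uE -vE.
  by rewrite -[(x1, x2, x2)]/(s (x1, x2)) perm_pushl_inj // mulr1.
rewrite perm_compA.
pose c : gmap (prod_sset Z (prod_sset X X)) (prod_sset (prod_sset Z X) (prod_sset X X)) :=
  gpair (gpair (gfst _ _) (gmap_comp (gsnd X X) (gsnd _ _))) (gsnd _ _).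
have cI : injective c by move=> [? [? ?]] [? [? ?]] /= [-> _ -> ->].
have -> : perm_tensm B (perm_id k X) \pc pushp s = ifun_push mu c B.
  apply: perm_ext => -[z' y'] [x1 x2]; rewrite perm_comp_push.
  rewrite [LHS]/=; case: (asboolP (x2 = y')) => [->|ne].
    by rewrite mulr1 -[RHS]/(ifun_push mu c B (c (z', (x1, y')))) push_inj.
  rewrite mulr0 push_notin // => -[[z1 [u v]] _ /= [_ vy _ vx]].
  by apply: ne; rewrite -vy -vx.
rewrite perm_comp_pullr push_comp.
set d := gmap_comp _ _; have dI : injective d.
  by move=> [? [? ?]] [? [? ?]] /= [-> -> ->].
by rewrite -[((z, y), x)]/(d (z, (x, y))) push_inj.
Qed.

(** The adjoint of multiplication is the push-forward along the diagonal, and evaluation restricts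
    back to the diagonal: the trace is integration over X. *)
Lemma kperm_trace : kmor (trace_map kperm_dual) = pushp (to_pt X).
Proof.
rewrite /= !perm_tensm_id !perm_compm1.
rewrite (_ : _ \pc pullp (gfst X _) = pushp (gdiag X)); last first.
  apply: perm_ext => -[x' y] x; rewrite perm_adjointE perm_pullE perm_pushE.
  by congr (nat_of_bool _)%:R; apply: asbool_equiv_eq => /=; split=> [[-> ->]|[-> ->]].
rewrite /perm_ev -(perm_compA _ _ _ (pullp (gswap X X))) perm_pull_comp.
rewrite (_ : pullp _ = pullp (gdiag X)); last exact: perm_pull_eq.
by rewrite -perm_compA perm_pull_push ?perm_compm1 //; exact: gdiag_inj.
Qed.

(** By [kperm_trace] the trace pairing is the evaluation of the self-duality, so its adjoint is the
    identity. *)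
Lemma kperm_alg_etale : etale (kperm_alg X).
Proof.
split; first exact: kperm_alg_comm.
exists kperm_dual; rewrite /perfect_pairing.
move: (trace_map kperm_dual) kperm_trace => t tE.
suff -> : lun (kperm_dual : K) \co adjoint kperm_dual (t \co mul (kperm_alg X))
    = idm (kperm_alg X : K).
  by exists (idm _); rewrite !comp1m.
apply: kar_hom_eq; rewrite /= tE !perm_tensm_id !perm_compm1.
apply: perm_ext => x' x; rewrite perm_comp_pull perm_adjointE.
rewrite -/perm_ev perm_evE perm_pullE.
by congr (nat_of_bool _)%:R; apply: asbool_equiv_eq => /=.
Qed.

End Duality.

End PermAlgebras.

(* The relation is the image of r in X * X. *)
Definition strict_total_order (R : realType) (X Y : gset R)
    (r : gmap Y (prod_gset X X)) : Prop :=
  [/\ injective r,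
      forall p, (r p).1 <> (r p).2,
      forall p q, (r p).2 = (r q).1 -> range r ((r p).1, (r q).2)
    & forall x x', x <> x' -> range r (x, x') \/ range r (x', x)].

Lemma gcase_subproof (R : realType) (X Y Z : gset R) (f : gmap X Z) (h : gmap Y Z)
    g (t : sum_gset X Y) :
  match act g t with inl x => f x | inr y => h y end
  = act g match t with inl x => f x | inr y => h y end.
Proof. by case: t => ?; rewrite /= gfunE. Qed.
Definition gcase (R : realType) (X Y Z : gset R) (f : gmap X Z) (h : gmap Y Z) :
  gmap (sum_gset X Y) Z := GMap (gcase_subproof f h).

Lemma kar_sum_id1 (k : fieldType) (C : tensor_cat k) (X Y : kar_ob C) :
  kid X = idm (kob X) -> kid Y = idm (kob Y) -> kar_sum_id X Y = idm (kob X \op kob Y).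
Proof. by move=> X1 Y1; rewrite /kar_sum_id X1 Y1 !compm1 inj_prj. Qed.

(** * Ordered étale algebras from total orders on G-sets *)

Section OrderedPerm.
Variables (R : realType) (k : fieldType) (mu : gmeasure R k).
Variables (X Y : sset R) (r : gmap Y (prod_sset X X)).
Local Notation P := (perm mu).
Local Notation K := (karoubi P).
Local Notation pushp := (perm_push k).
Local Notation pullp := (perm_pull k).
Local Notation "B \pc A" := (perm_comp mu B A) (at level 40, left associativity).

Lemma perm_pull_case (X1 X2 Z : sset R) (f : gmap X1 Z) (h : gmap X2 Z) :
  pushp (ginl X1 X2) \pc pullp f + pushp (ginr X1 X2) \pc pullp h = pullp (gcase f h).
Proof.
have lI : injective (ginl X1 X2) by move=> ? ? [].
have rI : injective (ginr X1 X2) by move=> ? ? [].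
apply: perm_ext => -[x|x] z; rewrite [LHS]ifunD.
  rewrite [X in _ + X = _]perm_pushl_notin; last by move=> [].
  by rewrite addr0 -[inl x in LHS]/(ginl X1 X2 x) perm_pushl_inj.
rewrite [X in X + _ = _]perm_pushl_notin; last by move=> [].
by rewrite add0r -[inr x in LHS]/(ginr X1 X2 x) perm_pushl_inj.
Qed.

(** For injective [f], push-forward after pull-back is multiplication by the indicator of the image;
    such masks encode membership in a relation. *)
Lemma perm_maskE (S Z W : sset R) (f : gmap S Z) (A : perm_hom k W Z) z w :
  injective f ->
  (pushp f \pc pullp f \pc A) (z, w) = if `[< range f z >] then A (z, w) else 0.
Proof.
move=> fI; rewrite -perm_compA; case: asboolP => [[s _ <-]|nz].
  by rewrite perm_pushl_inj // perm_comp_pull.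
by rewrite perm_pushl_notin.
Qed.

Lemma perm_mask12E (S Z W V : sset R) (f : gmap S Z) (A : perm_hom k V (prod_sset Z W))
    z w v : injective f ->
  (perm_tensm (pushp f \pc pullp f) (perm_id k W) \pc A) ((z, w), v)
  = if `[< range f z >] then A ((z, w), v) else 0.
Proof.
move=> fI; rewrite -[perm_id k W](perm_comp1m mu) perm_tensm_comp.
rewrite {1}perm_id_push perm_tensm_push perm_tensm_pull perm_maskE; last first.
  by move=> [? ?] [? ?] /= [/fI-> ->].
congr (if _ then _ else _); apply: asbool_equiv_eq; split=> [[[s w'] _ /= [<- _]]|[s _ <-]].
  by exists s.
by exists (s, w).
Qed.

Lemma perm_mask23E (S Z W V : sset R) (f : gmap S Z) (A : perm_hom k V (prod_sset W Z))
    z w v : injective f ->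
  (perm_tensm (perm_id k W) (pushp f \pc pullp f) \pc A) ((w, z), v)
  = if `[< range f z >] then A ((w, z), v) else 0.
Proof.
move=> fI; rewrite -[perm_id k W](perm_comp1m mu) perm_tensm_comp.
rewrite {1}perm_id_push perm_tensm_push perm_tensm_pull perm_maskE; last first.
  by move=> [? ?] [? ?] /= [-> /fI->].
congr (if _ then _ else _); apply: asbool_equiv_eq; split=> [[[w' s] _ /= [_ <-]]|[s _ <-]].
  by exists s.
by exists (w, s).
Qed.

Definition kperm : rel_alg K := map_ordered (kar_functor P) (perm_rel_alg mu r).

Hypothesis r_order : strict_total_order r.
Let rI : injective r. Proof. by case: r_order. Qed.

(** Extension by zero from the relation to X * X, a linear section of restriction. *)
Definition ksection : hom (rel_part kperm) (kperm \ox kperm).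
Proof.
refine (@KarHom k P (kar_emb (Y : P)) (kar_tens (kar_emb (X : P)) (kar_emb (X : P)))
  (pushp r : hom (Y : P) _) _).
by rewrite /= perm_tensm_id perm_comp1m perm_compm1.
Defined.

Lemma kperm_rel_alg_map : is_alg_map (A := tens_alg kperm kperm) (rel_map kperm).
Proof.
split; apply: kar_hom_eq; rewrite /= /perm_id !(perm_pull_comp, perm_tensm_pull);
  by apply: perm_pull_eq => p //=; case: (r p).
Qed.

Lemma ksectionK : rel_map kperm \co ksection = idm _.
Proof.
apply: kar_hom_eq; rewrite /= /perm_id perm_pull_comp.
rewrite (_ : pullp _ = pullp r); last by apply: perm_pull_eq => p /=; case: (r p).
exact: perm_pull_push.
Qed.

Lemma kperm_sub (E : alg K) (f g : hom (rel_part kperm) E) :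
  f \co rel_map kperm = g \co rel_map kperm -> f = g.
Proof.
move=> fg; rewrite -[f]compm1 -[g]compm1 -ksectionK.
by rewrite (compA f (rel_map kperm)) (compA g (rel_map kperm)) fg.
Qed.

Let tot : gmap (sum_sset (sum_sset Y X) Y) (prod_sset X X) :=
  gcase (gcase r (gdiag X)) (gmap_comp (gswap X X) r).

(** The map is the pull-back along [tot], and trichotomy is exactly the bijectivity of [tot]. *)
Lemma kperm_total :
  is_iso (inj1 (rel_part kperm \op kperm) (rel_part kperm)
            \co (inj1 (rel_part kperm) kperm \co rel_map kperm
                 + inj2 (rel_part kperm) kperm \co mul kperm)
          + inj2 (rel_part kperm \op kperm) (rel_part kperm)
            \co (rel_map kperm \co sym kperm kperm)).
Proof.
set T := (X in is_iso X).
have [rirr rtr rtot] : [/\ forall p, (r p).1 <> (r p).2,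
      forall p q, (r p).2 = (r q).1 -> range r ((r p).1, (r q).2)
    & forall x x', x <> x' -> range r (x, x') \/ range r (x', x)].
  by case: r_order.
have rasym p q : (r p).1 = (r q).2 -> (r p).2 <> (r q).1.
  by move=> pq qp; have [u _ ru] := rtr _ _ qp; apply: (rirr u); rewrite ru.
have totI : injective tot.
  have e (p : prod_sset X X) : (p.1, p.2) = p by case: p.
  move=> [[p|x]|p] [[q|y]|q] //=.
  - by move=> /rI ->.
  - by move=> E; case: (rirr p); rewrite E.
  - by move=> E; case: (@rasym p q); rewrite E.
  - by move=> E; case: (rirr q); rewrite -E.
  - by move=> [->].
  - by move=> [E E']; case: (rirr q); rewrite -E -E'.
  - by move=> E; case: (@rasym q p); rewrite -E.
  - by move=> [E E']; case: (rirr p); rewrite E E'.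
  - by move=> [E E']; congr inr; apply: rI; rewrite -[r p]e -[r q]e E E'.
have totS xx : exists t, tot t = xx.
  case: xx => x x'; have [<-|/rtot[[p _ rp]|[p _ rp]]] := pselect (x = x').
  - by exists (inl (inr x)).
  - by exists (inl (inl p)).
  - by exists (inr p); rewrite /= rp.
have [h _ [_ [e1 e2]]] := perm_pull_iso mu totI totS.
have TE : kmor T = pullp tot.
  rewrite /T /= kar_sum_id1 // !perm_tensm_id !perm_compm1 perm_pull_comp.
  rewrite !perm_pull_case; apply: perm_pull_eq => -[[y|x]|y] //=.
have T'P : kid (kar_tens (kar_emb (X : P)) (kar_emb (X : P)))
    \co (pullp h : hom (sum_sset (sum_sset Y X) Y : P) (prod_sset X X : P))
    \co kid (kar_sum (kar_sum (kar_emb (Y : P)) (kar_emb (X : P))) (kar_emb (Y : P))) = pullp h.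
  rewrite /= perm_tensm_id kar_sum_id1 /= ?kar_sum_id1 //.
  by rewrite perm_comp1m perm_compm1.
exists (KarHom T'P); split; apply: kar_hom_eq.
  by rewrite -[LHS]/(pullp h \pc kmor T) TE e1 -perm_tensm_id.
rewrite -[LHS]/(kmor T \pc pullp h) TE e2.
by rewrite /= kar_sum_id1 /= ?kar_sum_id1.
Qed.

(** In [related_trans], [M13] is taken to be the mask of the triples with (x1, x3) in the relation;
    the identity M12 M23 M13 = M12 M23 of masks is transitivity of the order. *)
Lemma kperm_trans (E : alg K) (x y z : hom kperm E) :
  is_comm_algebra E -> is_alg_map x -> is_alg_map y -> is_alg_map z ->
  related x y -> related y z -> related x z.
Proof.
have rtr : forall p q, (r p).2 = (r q).1 -> range r ((r p).1, (r q).2).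
  by case: r_order.
pose X3 := prod_sset (prod_sset X X) X.
pose r13_set : set X3 := [set t | range r (t.1.1, t.2)].
have r13_inv g t : r13_set t -> r13_set (act g t).
  by move=> [y0 _ ry]; exists (act g y0) => //; rewrite gfunE ry.
pose r13 : gmap (sub_sset r13_inv) X3 := sub_incl r13_inv.
have r13I : injective r13 by move=> ? ?; exact: sval_eq.
have M13P : kid (kar_tens (kar_tens (kar_emb (X : P)) (kar_emb (X : P))) (kar_emb (X : P)))
    \co (pushp r13 \pc pullp r13 : hom (X3 : P) (X3 : P))
    \co kid (kar_tens (kar_tens (kar_emb (X : P)) (kar_emb (X : P))) (kar_emb (X : P)))
    = pushp r13 \pc pullp r13.
  by rewrite /= !perm_tensm_id perm_comp1m perm_compm1.
apply: (related_trans (s := ksection) (M13 := KarHom M13P)).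
- exact: kperm_rel_alg_map.
- exact: ksectionK.
- apply: kar_hom_eq; rewrite /= !perm_compm1 /perm_id.
  rewrite !(perm_tensm_pull, perm_pull_comp).
  apply: perm_ext => -[[x1 x2] x3] v.
  rewrite perm_maskE // perm_comp_pull -[pushp r \pc _](perm_compm1 mu) perm_maskE //.
  rewrite !perm_pullE /=; congr (if _ then _ else _); apply: asbool_equiv_eq.
  by split=> [[[t rt] _ /= tE]|rx]; [move: rt; rewrite tE|exists (exist _ ((x1, x2), x3) rx)].
- apply: kar_hom_eq; rewrite /= ?perm_tensm_id ?perm_compm1.
  rewrite -[RHS](perm_compm1 mu) -!perm_compA.
  apply: perm_ext => -[[x1 x2] x3] v.
  rewrite !perm_mask12E // !perm_comp_pull -![gass X X X _]/(x1, (x2, x3)).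
  rewrite !perm_mask23E // !perm_comp_pull -![gassi X X X _]/((x1, x2), x3).
  rewrite -[pushp r13 \pc _](perm_compm1 mu) perm_maskE //.
  case: asboolP => // r12; case: asboolP => // r23; case: asboolP => // -[].
  have [p _ rp] := r12; have [q _ rq] := r23.
  have rt : r13_set ((x1, x2), x3).
    by have := rtr p q; rewrite rp rq => /(_ erefl).
  by exists (exist _ _ rt).
Qed.

Lemma kperm_ordered : ordered_etale kperm.
Proof.
split.
- exact: kperm_alg_etale.
- exact: kperm_alg_etale.
- exact: kperm_rel_alg_map.
- by move=> E f g _ _ _; exact: kperm_sub.
- exact: kperm_total.
- by move=> E x y z [EC _]; exact: kperm_trans.
Qed.

End OrderedPerm.

Lemma rel_alg_eta (k : fieldType) (C : tensor_cat k) (A : rel_alg C) :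
  A = @RelAlg k C (Alg (mul A) (one A)) (Alg (mul (rel_part A)) (one (rel_part A)))
        (rel_map A).
Proof. by case: A => [[? ? ?] [? ? ?] ?]. Qed.

(** * Recognizing unit, sums and tensor products as algebras C(X) *)

Section KpermEq.
Variables (R : realType) (k : fieldType) (mu : gmeasure R k).
Implicit Types X Y : sset R.
Local Notation P := (perm mu).
Local Notation K := (karoubi P).
Local Notation pullp := (perm_pull k).
Local Notation "B \pc A" := (perm_comp mu B A) (at level 40, left associativity).

Definition is_perm_alg (A : alg K) : Prop :=
  [/\ kid (alg_ob A : kar_ob P) = perm_id k (kob (alg_ob A : kar_ob P)),
      kmor (mul A) = pullp (gdiag (kob (alg_ob A : kar_ob P)))
    & kmor (one A) = pullp (to_pt (kob (alg_ob A : kar_ob P)))].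

(** An object of the Karoubi envelope whose idempotent is the identity equals the embedded object by
    proof irrelevance. Comparing kernels therefore gives an equality, by which constructions can be
    rewritten. *)
Lemma kperm_eq (A : rel_alg K)
    (r : gmap (kob (alg_ob (rel_part A) : kar_ob P) : sset R)
           (prod_sset (kob (alg_ob A : kar_ob P)) (kob (alg_ob A : kar_ob P)))) :
  is_perm_alg A -> is_perm_alg (rel_part A) -> kmor (rel_map A) = pullp r ->
  A = kperm mu r.
Proof.
case: A r => [[[X i ii] m u] [[Y j jj] m' u'] rel] /= r [/= iE mE uE] [/= jE m'E u'E] relE.
move: ii jj m u m' u' rel mE uE m'E u'E relE; rewrite {}iE {}jE => ii jj.
rewrite (Prop_irrelevance ii (kar_emb_subproof (X : P))).
rewrite (Prop_irrelevance jj (kar_emb_subproof (Y : P))).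
move=> m u m' u' rel mE uE m'E u'E relE.
have -> : m = mul (kperm mu r) by apply: kar_hom_eq; rewrite mE /= perm_compm1.
have -> : u = one (kperm mu r) by apply: kar_hom_eq; rewrite uE /= perm_compm1.
have -> : m' = mul (rel_part (kperm mu r)) by apply: kar_hom_eq; rewrite m'E /= perm_compm1.
have -> : u' = one (rel_part (kperm mu r)) by apply: kar_hom_eq; rewrite u'E /= perm_compm1.
have -> : rel = rel_map (kperm mu r) by apply: kar_hom_eq; rewrite relE /= perm_compm1.
by rewrite [RHS]rel_alg_eta.
Qed.

Definition gempty X : gmap (empty_sset R) X :=
  @GMap R (empty_sset R) X (fun e => match e with end) (fun _ e => match e with end).

Lemma kperm_unit : unit_ordered = kperm mu (gempty (prod_sset (pt_sset R) (pt_sset R))).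
Proof.
apply: (@kperm_eq unit_ordered (gempty (prod_sset (pt_sset R) (pt_sset R)))).
- split=> //=; last by apply: perm_pull_eq => -[].
  by rewrite perm_tensm_id perm_compm1; apply: perm_pull_eq => -[].
- by split=> //=; apply: ifun_eq => -[[]].
- by apply: ifun_eq => -[[]].
Qed.

Definition glex X1 Y1 X2 Y2 (r : gmap Y1 (prod_sset X1 X1)) (s : gmap Y2 (prod_sset X2 X2)) :
    gmap (sum_sset (sum_sset Y1 (prod_sset X1 X2)) Y2)
      (prod_sset (sum_sset X1 X2) (sum_sset X1 X2)) :=
  gcase (gcase (gmap_comp (gprod (ginl X1 X2) (ginl X1 X2)) r)
               (gprod (ginl X1 X2) (ginr X1 X2)))
    (gmap_comp (gprod (ginr X1 X2) (ginr X1 X2)) s).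

Lemma kperm_alg_perm X : is_perm_alg (kperm_alg mu X).
Proof. by split; rewrite //= perm_compm1. Qed.

Lemma sum_alg_perm (A B : alg K) :
  is_perm_alg A -> is_perm_alg B -> is_perm_alg (sum_alg A B).
Proof.
case: A => [[X i ii] m u]; case: B => [[Y j jj] m' u'] [/= A1 Am Ao] [/= B1 Bm Bo].
have e : kar_sum_id (KarOb ii) (KarOb jj) = perm_id k (sum_sset X Y).
  by rewrite kar_sum_id1.
split=> /=; first exact: e.
  rewrite e Am Bm A1 B1 !perm_compm1 -!perm_compA.
  rewrite !(perm_tensm_pull, perm_pull_comp) perm_pull_case.
  by apply: perm_pull_eq => -[].
rewrite Ao Bo A1 B1 !perm_compm1 perm_pull_case.
by apply: perm_pull_eq => -[].
Qed.

Lemma tens_alg_perm (A B : alg K) :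
  is_perm_alg A -> is_perm_alg B -> is_perm_alg (tens_alg A B).
Proof.
case: A => [[X i ii] m u]; case: B => [[Y j jj] m' u'] [/= A1 Am Ao] [/= B1 Bm Bo].
split=> /=.
- by rewrite A1 B1 perm_tensm_id.
- rewrite Am Bm A1 B1 !perm_tensm_id !perm_compm1 /perm_id.
  by rewrite !(perm_tensm_pull, perm_pull_comp); apply: perm_pull_eq => -[].
- rewrite Ao Bo perm_compm1.
  by rewrite !(perm_tensm_pull, perm_pull_comp); exact: perm_pull_eq.
Qed.

Lemma kperm_lex X1 Y1 X2 Y2 (r : gmap Y1 (prod_sset X1 X1)) (s : gmap Y2 (prod_sset X2 X2)) :
  lex_sum (kperm mu r) (kperm mu s) = kperm mu (glex r s).
Proof.
have e1 : kar_sum_id (kar_emb (X1 : P)) (kar_emb (X2 : P)) = perm_id k (sum_sset X1 X2).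
  by rewrite kar_sum_id1.
have e2 : kar_sum_id (kar_emb (Y1 : P)) (kar_tens (kar_emb (X1 : P)) (kar_emb (X2 : P)))
    = perm_id k (sum_sset Y1 (prod_sset X1 X2)).
  by rewrite kar_sum_id1 //; exact: perm_tensm_id.
have pa := kperm_alg_perm.
apply: (@kperm_eq (lex_sum (kperm mu r) (kperm mu s)) (glex r s)).
- exact: sum_alg_perm (pa X1) (pa X2).
- exact: sum_alg_perm (sum_alg_perm (pa Y1) (tens_alg_perm (pa X1) (pa X2))) (pa Y2).
rewrite /= e1 e2 !perm_tensm_id !perm_compm1 -?perm_compA /perm_id.
rewrite !(perm_tensm_pull, perm_pull_comp) !perm_pull_case.
by apply: perm_pull_eq => -[[|[]]|].
Qed.

End KpermEq.

(** * Lexicographic sums and the four measures *)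

Section Volumes.
Variables (R : realType) (k : fieldType) (mu : gmeasure R k).
Implicit Types X Y : sset R.

(** Defined by push-forward in order to cover sets with several orbits, such as the line with
    endpoints. *)
Definition vol X : k := ifun_push mu (to_pt X : gmap X (pt_sset R)) (ifun_cst X 1) tt.

(* The measure of { x | (x, y) in the relation r } *)
Definition below X Y (r : gmap Y (prod_sset X X)) (x : X) : k :=
  ifun_push mu (gmap_comp (gsnd X X) r) (ifun_cst Y 1) x.

Lemma vol_pt : vol (pt_sset R) = 1.
Proof.
have i : injective (to_pt (pt_sset R)) by move=> [] [].
by have := push_inj mu (X := pt_sset R) (Y := pt_sset R) (ifun_cst _ 1) tt i.
Qed.

Lemma vol_sum X Y : vol (sum_sset X Y) = vol X + vol Y.
Proof.
rewrite /vol push_sum ifunD.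
rewrite (_ : gmap_comp _ (ginl X Y) = to_pt X); last exact: gmap_eq.
by rewrite (_ : gmap_comp _ (ginr X Y) = to_pt Y); last exact: gmap_eq.
Qed.

Lemma push_gsnd X Y y : ifun_push mu (gsnd X Y) (ifun_cst (prod_sset X Y) 1) y = vol X.
Proof.
rewrite -[RHS]/(ifun_pull (to_pt Y : gmap Y (pt_sset R))
  (ifun_push mu (to_pt X : gmap X (pt_sset R)) (ifun_cst X 1)) y).
rewrite (@push_cart _ _ mu (prod_sset X Y) X Y (pt_sset R) (to_pt X) (to_pt Y)
  (gfst X Y) (gsnd X Y)) //.
- by move=> [? ?] [? ?] /= -> ->.
- by move=> x y' _; exists (x, y').
Qed.

Section Lex.
Variables (X1 Y1 X2 Y2 : sset R).
Variables (r : gmap Y1 (prod_sset X1 X1)) (s : gmap Y2 (prod_sset X2 X2)).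
Let linj : injective (ginl X1 X2). Proof. by move=> ? ? []. Qed.
Let rinj : injective (ginr X1 X2). Proof. by move=> ? ? []. Qed.

Lemma below_lexE t : below (glex r s) t =
  ifun_push mu (ginl X1 X2) (ifun_push mu (gmap_comp (gsnd X1 X1) r) (ifun_cst Y1 1)) t
  + ifun_push mu (ginr X1 X2) (ifun_push mu (gsnd X1 X2) (ifun_cst _ 1)) t
  + ifun_push mu (ginr X1 X2) (ifun_push mu (gmap_comp (gsnd X2 X2) s) (ifun_cst Y2 1)) t.
Proof.
rewrite /below push_sum ifunD push_sum ifunD !push_comp.
congr (_ + _ + _).
- by rewrite (_ : gmap_comp (ginl X1 X2) _ = gmap_comp
    (gmap_comp (gmap_comp (gsnd _ _) (glex r s)) (ginl _ _)) (ginl _ _)) //; exact: gmap_eq.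
- by rewrite (_ : gmap_comp (ginr X1 X2) _ = gmap_comp
    (gmap_comp (gmap_comp (gsnd _ _) (glex r s)) (ginl _ _)) (ginr _ _)) //; exact: gmap_eq.
- by rewrite (_ : gmap_comp (ginr X1 X2) _ = gmap_comp
    (gmap_comp (gsnd _ _) (glex r s)) (ginr _ _)) //; exact: gmap_eq.
Qed.

Lemma below_lexl x : below (glex r s) (inl x) = below r x.
Proof.
rewrite below_lexE -[inl x]/(ginl X1 X2 x) push_inj //.
rewrite [X in _ + X + _]push_notin; last by move=> [].
by rewrite [X in _ + X]push_notin ?addr0 // => -[].
Qed.

Lemma below_lexr x : below (glex r s) (inr x) = vol X1 + below s x.
Proof.
rewrite below_lexE -[inr x]/(ginr X1 X2 x) !push_inj // push_gsnd.
by rewrite [X in X + _ + _]push_notin ?add0r // => -[].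
Qed.
End Lex.

Lemma below_empty X x : below (gempty (prod_sset X X)) x = 0.
Proof. by rewrite /below push_notin // => -[[]]. Qed.

Lemma vol_line : vol (line_sset R) = gval mu (to_pt (line_tset R) : gmap (line_tset R) (pt_tset R)).
Proof.
rewrite /vol (@push_tset _ _ mu (line_tset R) (pt_tset R) _ _ (0 : R)).
by rewrite mul1r.
Qed.

Lemma below_line x : below (@line2_incl R) x
  = gval mu (gmap_comp (gsnd _ _) (@line2_incl R) : gmap (line2_tset R) (line_tset R)).
Proof.
have [y _] := tset_trans (line2_tset R).
by rewrite /below (@push_tset _ _ mu (line2_tset R) (line_tset R) _ _ y) mul1r.
Qed.

End Volumes.

Section Iso.
Variables (R : realType) (k : fieldType).

Lemma kperm_iso (mu : gmeasure R k) (X Y X' Y' : sset R)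
    (r : gmap Y (prod_sset X X)) (r' : gmap Y' (prod_sset X' X'))
    (f : gmap X' X) (h : gmap Y' Y) :
  strict_total_order r -> strict_total_order r' ->
  injective f -> (forall x, exists x', f x' = x) ->
  injective h -> (forall y, exists y', h y' = y) ->
  (forall y, r (h y) = (f (r' y).1, f (r' y).2)) ->
  ordered_iso (kperm mu r) (kperm mu r').
Proof.
move=> rT r'T fI fS hI hS rh; split; try exact: kperm_ordered.
exists (kpull mu f), (kpull mu h); split.
- exact: kpull_iso.
- exact: kpull_iso.
- exact: kpull_alg_map.
- exact: kpull_alg_map.
apply: kar_hom_eq; rewrite /= !perm_compm1 perm_tensm_pull !perm_pull_comp.
by apply: perm_pull_eq => y /=; rewrite rh.
Qed.

Variables (mu mu' : gmeasure R k) (j : line_embedding R).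
Hypothesis compat : forall (X Y : sset R) (f : gmap X Y) phi, compatible mu mu' j f phi.

Lemma hat_perm_alg (X : sset R) :
  is_perm_alg (map_alg (kar_map (hat_functor compat)) (kperm_alg mu X)).
Proof.
split; rewrite /= ?perm_compm1 !hat_hom_pull ?perm_tensm_pull ?perm_pull_comp;
  by apply: perm_pull_eq => x //=; do ?congr pair; exact: sval_eq.
Qed.

Lemma map_kperm (X Y : sset R) (r : gmap Y (prod_sset X X)) :
  map_ordered (kar_map (hat_functor compat)) (kperm mu r)
  = kperm mu' (gmap_comp (@hat_pair R j X X) (hatm j r)).
Proof.
refine (@kperm_eq _ _ mu' (map_ordered (kar_map (hat_functor compat)) (kperm mu r))
  (gmap_comp (@hat_pair R j X X) (hatm j r)) _ _ _).
- exact: hat_perm_alg.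
- exact: hat_perm_alg.
- rewrite /= perm_compm1 !hat_hom_pull perm_tensm_pull !perm_pull_comp.
  by apply: perm_pull_eq => x /=; congr pair; exact: sval_eq.
Qed.

End Iso.

(** * Automorphisms supported in (-1, 1) *)

Section Shrink.
Variable R : realType.
Implicit Types x y : R.

(** An increasing bijection from the line to (-1, 1), chosen for its explicit inverse [unsquash]. *)
Definition squash x := x / (1 + `|x|).
Definition unsquash y := y / (1 - `|y|).

Lemma squash_lt1 x : `|squash x| < 1.
Proof.
have p : 0 < 1 + `|x| by rewrite ltr_pwDl.
by rewrite normrM normfV (gtr0_norm p) ltr_pdivrMr // mul1r ltrDr ltr01.
Qed.

Lemma squashK : cancel squash unsquash.
Proof.
move=> x; have p : 0 < 1 + `|x| by rewrite ltr_pwDl.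
rewrite /unsquash normrM normfV (gtr0_norm p) /squash.
by field; rewrite (gt_eqF p) /= addrK oner_neq0.
Qed.

Lemma unsquashK y : `|y| < 1 -> squash (unsquash y) = y.
Proof.
move=> y1; have p : 0 < 1 - `|y| by rewrite subr_gt0.
rewrite /squash normrM normfV (gtr0_norm p) /unsquash.
by field; rewrite (gt_eqF p) /= subrK oner_neq0.
Qed.

Lemma squash_lt x y : (squash x < squash y) = (x < y).
Proof.
have px : 0 < 1 + `|x| by rewrite ltr_pwDl.
have py : 0 < 1 + `|y| by rewrite ltr_pwDl.
rewrite /squash ltr_pdivrMr // mulrAC ltr_pdivlMr //.
case: (ltrgt0P x) => hx; case: (ltrgt0P y) => hy; rewrite ?hx ?hy; apply/idP/idP; nra.
Qed.

(** The conjugate of [g] by [squash], extended by the identity. It fixes -1 and 1, which can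
    therefore serve as the added endpoints. *)
Definition shrink_fun (g : oaut R) y :=
  if `|y| < 1 then squash (g (unsquash y)) else y.

Lemma shrink_funK g : cancel (shrink_fun g) (shrink_fun g^-1%g).
Proof.
move=> y; rewrite /shrink_fun.
have [y1|y1] := boolP (`|y| < 1); last by rewrite (negbTE y1).
by rewrite squash_lt1 squashK [X in squash X]oaut_funK unsquashK.
Qed.

Lemma shrink_funKV g : cancel (shrink_fun g^-1%g) (shrink_fun g).
Proof. by move=> y; have := shrink_funK g^-1%g y; rewrite invgK. Qed.

Lemma shrink_fun_inc g : {homo shrink_fun g : x y / x < y}.
Proof.
move=> x y xy; rewrite /shrink_fun; case: ifP => x1; case: ifP => y1 //.
- by rewrite squash_lt oaut_incE -squash_lt !unsquashK.
- have := squash_lt1 (g (unsquash x)); move: x1 y1 => + /negbT.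
  rewrite -leNgt !ltr_norml ler_normr => /andP[x1 x2] /orP[?|?] /andP[? ?]; lra.
- have := squash_lt1 (g (unsquash y)); move: x1 y1 => /negbT + +.
  rewrite -leNgt !ltr_norml ler_normr => /orP[?|?] /andP[? ?] /andP[? ?]; lra.
Qed.

Definition shrink g : oaut R :=
  OAut (shrink_funK g) (shrink_funKV g) (@shrink_fun_inc g).

Lemma shrink1 : shrink 1%g = 1%g.
Proof.
apply: oaut_eq => y; rewrite /= /shrink_fun; case: ifP => // y1.
exact: unsquashK.
Qed.

Lemma shrinkM g h : shrink (g * h)%g = (shrink g * shrink h)%g.
Proof.
apply: oaut_eq => y; rewrite [RHS]oautM /= /shrink_fun.
have [y1|y1] := boolP (`|y| < 1); last by rewrite (negbTE y1).
by rewrite squash_lt1 squashK.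
Qed.

Lemma shrink_squash g x : shrink g (squash x) = squash (g x).
Proof. by rewrite /= /shrink_fun squash_lt1 squashK. Qed.

Lemma shrink_fix g y : 1 <= `|y| -> shrink g y = y.
Proof. by rewrite /= /shrink_fun ltNge => ->. Qed.

End Shrink.

Section OrderEmbedding.
Variable R : realType.
Implicit Types X Y : sset R.

(* The relation r is the order induced by an equivariant embedding i of X in
   the closed interval [-1, 1], for the action of G through [shrink]. *)
Definition order_embedding X Y (r : gmap Y (prod_sset X X)) (i : X -> R) : Prop :=
  [/\ injective r, injective i, forall g x, shrink g (i x) = i (act g x)
    & forall x x', range r (x, x') <-> i x < i x'].

Lemma order_embedding_order X Y (r : gmap Y (prod_sset X X)) i :
  order_embedding r i -> strict_total_order r.
Proof.
move=> [rI iI _ ri].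
have rP p : i (r p).1 < i (r p).2 by apply/ri; exists p => //; case: (r p).
split=> // [p rp|p q pq|x x' xx'].
- by have := rP p; rewrite rp ltxx.
- by apply/ri; apply: lt_trans (rP p) _; rewrite pq; exact: rP.
- case: (ltgtP (i x) (i x')) => [/ri|/ri|/iI//]; by [left|right].
Qed.

Lemma order_embedding_line : order_embedding (@line2_incl R) (@squash R).
Proof.
split=> [p q| |g x|x x'].
- exact: sval_eq.
- exact: can_inj (@squashK R).
- exact: shrink_squash.
- rewrite squash_lt; split=> [[[[u v] /= uv] _ /= [<- <-]] //|xx'].
  by exists (exist _ (x, x') xx').
Qed.

Lemma order_embedding_pt (c : R) : 1 <= `|c| ->
  order_embedding (gempty (prod_sset (pt_sset R) (pt_sset R))) (fun=> c).
Proof.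
move=> c1; split=> [[]|[] []|g x|x x'] //; first exact: shrink_fix.
by rewrite ltxx; split=> // -[[]].
Qed.

Definition sum_fun (X1 X2 : Type) (i1 : X1 -> R) (i2 : X2 -> R) (t : X1 + X2) : R :=
  match t with inl x => i1 x | inr x => i2 x end.

Lemma order_embedding_lex X1 Y1 X2 Y2 (r : gmap Y1 (prod_sset X1 X1))
    (s : gmap Y2 (prod_sset X2 X2)) i1 i2 :
  order_embedding r i1 -> order_embedding s i2 -> (forall x y, i1 x < i2 y) ->
  order_embedding (glex r s) (sum_fun i1 i2).
Proof.
move=> [rI i1I i1E i1r] [sI i2I i2E i2s] i12; split.
- have e (X : Type) (p : X * X) : (p.1, p.2) = p by case: p.
  move=> [[p|[x y]]|p] [[q|[x' y']]|q] //=.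
  + by move=> [E E']; congr (inl (inl _)); apply: rI; rewrite -[r p]e -[r q]e E E'.
  + by move=> [-> ->].
  + by move=> [E E']; congr inr; apply: sI; rewrite -[s p]e -[s q]e E E'.
- move=> [x|x] [y|y] /=.
  + by move=> /i1I->.
  + by move=> E; have := i12 x y; rewrite E ltxx.
  + by move=> E; have := i12 y x; rewrite E ltxx.
  + by move=> /i2I->.
- by move=> g [x|x]; [exact: i1E|exact: i2E].
- move=> [x|x] [y|y] /=.
  + rewrite -i1r; split=> [[[[p|[? ?]]|p] _ //= [<- <-]]|[p _ rp]].
      by exists p => //; case: (r p).
    by exists (inl (inl p)); rewrite //= rp.
  + by split=> _; [exact: i12|exists (inl (inr (x, y)))].
  + rewrite ltNge ltW //; split=> // -[[[p|[? ?]]|p] _ //=].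
  + rewrite -i2s; split=> [[[[p|[? ?]]|p] _ //= [<- <-]]|[p _ rp]].
      by exists p => //; case: (s p).
    by exists (inr p); rewrite //= rp.
Qed.

End OrderEmbedding.

(** * The tensor functor attached to an extended line *)

Section DelannoyFunctor.
Variables (R : realType) (k : fieldType) (mu mu' : gmeasure R k).
Variables (L LR : sset R) (r : gmap LR (prod_sset L L)) (i : L -> R).
Hypothesis r_emb : order_embedding r i.
Hypothesis vol_line_eq : vol mu (line_sset R) = vol mu' L.
Hypothesis below_line_eq : forall x l, below mu (@line2_incl R) x = below mu' r l.
Local Notation line := (line_sset R).
Local Notation line2 := (line2_sset R).

Let iI : injective i. Proof. by case: r_emb. Qed.
Let iE g l : shrink g (i l) = i (act g l). Proof. by case: r_emb. Qed.
Let rI : injective r. Proof. by case: r_emb. Qed.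
Let ri l l' : range r (l, l') <-> i l < i l'. Proof. by case: r_emb. Qed.
Let i_lt p : i (r p).1 < i (r p).2.
Proof. by apply/ri; exists p => //; case: (r p). Qed.

Definition emb : line_embedding R :=
  LineEmbedding (@shrink1 R) (@shrinkM R) iI iE.

Let lhat_supported l : supported emb (i l : line).
Proof. by apply/supported_line; exists l. Qed.
Let lhatE g l : exist (@supported R emb line) (i (act g l)) (lhat_supported (act g l))
  = act g (exist _ (i l) (lhat_supported l) : hat emb line).
Proof. apply: sval_eq; exact/esym/iE. Qed.
(** Together with [lhat2], identifies the hats of the line and of the pairs x < y with [L] and its
    order relation; the two base cases of [all_compatible] are about these sets. *)
Definition lhat : gmap L (hat emb line) := @GMap R L (hat emb line) _ lhatE.

Lemma lhat_inj : injective lhat.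
Proof. by move=> l l' /(congr1 sval) /iI. Qed.

Lemma lhat_surj x : exists l, lhat l = x.
Proof.
have /supported_line[l _ lx] := svalP x.
by exists l; apply: sval_eq.
Qed.

Definition lhat2_val p : line2 := exist _ (i (r p).1, i (r p).2) (i_lt p).
Let lhat2_supported p : supported emb (lhat2_val p).
Proof.
apply: (@supported_inj _ _ _ _ (line2_incl R)); first by move=> ? ?; exact: sval_eq.
exact: (@supported_pair _ _ line line _ _ (lhat_supported _) (lhat_supported _)).
Qed.
Let lhat2E g p : exist (@supported R emb line2) (lhat2_val (act g p)) (lhat2_supported (act g p))
  = act g (exist _ (lhat2_val p) (lhat2_supported p) : hat emb line2).
Proof. by do 2!apply: sval_eq; rewrite [LHS]/= gfunE; congr pair; exact/esym/iE. Qed.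
Definition lhat2 : gmap LR (hat emb line2) := @GMap R LR (hat emb line2) _ lhat2E.

Lemma lhat2_inj : injective lhat2.
Proof.
move=> p q /(congr1 sval) /(congr1 sval) /= [/iI e1 /iI e2]; apply: rI.
by case: (r p) (r q) e1 e2 => [? ?] [? ?] /= -> ->.
Qed.

Lemma lhat2_surj y : exists p, lhat2 p = y.
Proof.
have sy := supported_gmap (line2_incl R) (svalP y).
have [l _ l1] : range i (sval (sval y)).1.
  exact/(supported_line emb)/(supported_gmap (gfst line line) sy).
have [l' _ l2] : range i (sval (sval y)).2.
  exact/(supported_line emb)/(supported_gmap (gsnd line line) sy).
have /ri[p _ rp] : i l < i l' by rewrite l1 l2; exact: svalP (sval y).
exists p; do 2!apply: sval_eq; rewrite /= rp /= l1 l2.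
by case: (sval (sval y)).
Qed.

Let vol_compatible : compatible mu mu' emb (to_pt line) (ifun_cst line 1).
Proof.
move=> y; rewrite /compatible_at.
pose q := to_pt (hat emb (pt_sset R)).
have qI : injective q by move=> [[] ?] [[] ?] _; exact: sval_eq.
(* The hat of the point is again a point; composing with [q] puts the push-forward in the form of a
   volume. *)
rewrite -[RHS](push_inj mu' _ _ qI) push_comp.
rewrite -(push_bij mu' _ _ lhat_inj lhat_surj).
rewrite [LHS](_ : _ = vol mu line); last by case: (sval y).
rewrite vol_line_eq /vol.
rewrite (_ : gmap_comp (gmap_comp _ _) lhat = to_pt L); last exact: gmap_eq.
rewrite (_ : ifun_pull _ _ = ifun_cst L 1) //; exact: ifun_eq.
Qed.

Let below_compatible : compatible mu mu' emb
  (gmap_comp (gsnd line line) (line2_incl R)) (ifun_cst line2 1).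
Proof.
move=> y; rewrite /compatible_at; have [l <-] := lhat_surj y.
rewrite -(push_bij mu' _ _ lhat2_inj lhat2_surj).
rewrite (_ : gmap_comp (hatm _ _) lhat2 = gmap_comp lhat (gmap_comp (gsnd L L) r)); last first.
  by apply: gmap_eq => p; exact: sval_eq.
rewrite -push_comp (push_inj mu' _ _ lhat_inj).
rewrite -[LHS]/(below mu (@line2_incl R) _) (below_line_eq _ l).
by rewrite (_ : ifun_pull _ _ = ifun_cst LR 1) //; exact: ifun_eq.
Qed.

(** Since the line is a single orbit, its initial segments have one common volume for [mu]; hence
    [below_line_eq] asks for that value at every point of [L], endpoints included. *)
Theorem delannoy_functor : exists F : tensor_functor (delannoy mu) (delannoy mu'),
  ordered_iso (map_ordered F (delannoy_line mu)) (kperm mu' r).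
Proof.
pose compat := all_compatible vol_compatible below_compatible.
exists (kar_map (hat_functor compat)).
have -> : map_ordered (kar_map (hat_functor compat)) (delannoy_line mu)
    = kperm mu' (gmap_comp (@hat_pair R emb line line) (hatm emb (line2_incl R))).
  exact: map_kperm.
apply: (@kperm_iso _ _ mu' _ _ _ _ _ _ lhat lhat2).
- apply: (order_embedding_order (i := fun x : hat emb line => sval x)).
  have incI : injective (line2_incl R) by move=> ? ?; exact: sval_eq.
  split=> [p q /= [e1 e2]|x y|//|x x'].
  + by do 2!apply: sval_eq; move: e1 e2; case: (sval (sval p)) (sval (sval q))
      => [? ?] [? ?] /= -> ->.
  + exact: sval_eq.
  + split=> [[p _ /= [<- <-]]|xx']; first exact: svalP (sval p).
    pose p : line2 := exist _ (sval x, sval x') xx'.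
    have pP : supported emb p.
      apply: (supported_inj incI).
      exact: (@supported_pair _ _ line line _ _ (svalP x) (svalP x')).
    by exists (exist _ p pP) => //; congr pair; exact: sval_eq.
- exact: order_embedding_order r_emb.
- exact: lhat_inj.
- exact: lhat_surj.
- exact: lhat2_inj.
- exact: lhat2_surj.
- by move=> p; congr pair; exact: sval_eq.
Qed.

End DelannoyFunctor.

Lemma delannoy_lineE (R : realType) (k : fieldType) (mu : gmeasure R k) :
  delannoy_line mu = kperm mu (@line2_incl R).
Proof. by []. Qed.

Lemma measure_valuesE (R : realType) (k : fieldType) (mu : gmeasure R k) a b c :
  measure_values mu a b c ->
  vol mu (line_sset R) = a /\ forall x, below mu (@line2_incl R) x = b.
Proof. by move=> [<- <- _]; split=> [|x]; rewrite ?vol_line ?below_line. Qed.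

(** * The three extended lines and the five functors *)

Section Embeddings.
Variable R : realType.
Local Notation pt_rel := (gempty (prod_sset (pt_sset R) (pt_sset R))).
Local Notation line_rel := (@line2_incl R).

Let bot := order_embedding_pt (c := -1 : R).
Let top := order_embedding_pt (c := 1 : R).

Let squash_lt (x : R) : squash x < 1.
Proof. exact: le_lt_trans (ler_norm _) (squash_lt1 x). Qed.
Let squash_gt (x : R) : -1 < squash x.
Proof. by have := squash_lt1 x; rewrite ltr_norml => /andP[]. Qed.

Lemma order_embedding_line_pt :
  order_embedding (glex line_rel pt_rel) (sum_fun (@squash R) (fun=> 1)).
Proof.
apply: order_embedding_lex; first exact: order_embedding_line.
  by apply: top; rewrite normr1.
by [].
Qed.

Lemma order_embedding_pt_line :
  order_embedding (glex pt_rel line_rel) (sum_fun (fun=> -1) (@squash R)).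
Proof.
apply: order_embedding_lex; last by [].
  by apply: bot; rewrite normrN1.
exact: order_embedding_line.
Qed.

Lemma order_embedding_pt_line_pt :
  order_embedding (glex pt_rel (glex line_rel pt_rel))
    (sum_fun (fun=> -1) (sum_fun (@squash R) (fun=> 1))).
Proof.
apply: order_embedding_lex; last by move=> _ [x|_] //=; lra.
  by apply: bot; rewrite normrN1.
exact: order_embedding_line_pt.
Qed.

End Embeddings.

Theorem theorem8p1 (R : realType) (k : fieldType)
    (mu1 mu2 mu3 mu4 : gmeasure R k)
    (hmu1 : measure_values mu1 (-1) (-1) (-1))
    (hmu2 : measure_values mu2 0 (-1) 0)
    (hmu3 : measure_values mu3 0 0 (-1))
    (hmu4 : measure_values mu4 1 0 0) :
  [/\ exists F : tensor_functor (delannoy mu2) (delannoy mu1),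
        ordered_iso (map_ordered F (delannoy_line mu2))
          (lex_sum (delannoy_line mu1) unit_ordered),
      exists F : tensor_functor (delannoy mu3) (delannoy mu1),
        ordered_iso (map_ordered F (delannoy_line mu3))
          (lex_sum unit_ordered (delannoy_line mu1)),
      exists F : tensor_functor (delannoy mu4) (delannoy mu1),
        ordered_iso (map_ordered F (delannoy_line mu4))
          (lex_sum unit_ordered (lex_sum (delannoy_line mu1) unit_ordered)),
      exists F : tensor_functor (delannoy mu4) (delannoy mu2),
        ordered_iso (map_ordered F (delannoy_line mu4))
          (lex_sum unit_ordered (delannoy_line mu2))
    & exists F : tensor_functor (delannoy mu4) (delannoy mu3),
        ordered_iso (map_ordered F (delannoy_line mu4))
          (lex_sum (delannoy_line mu3) unit_ordered)].
Proof.
have [v1 b1] := measure_valuesE hmu1; have [v2 b2] := measure_valuesE hmu2.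
have [v3 b3] := measure_valuesE hmu3; have [v4 b4] := measure_valuesE hmu4.
have l1 : forall mu : gmeasure R k, lex_sum (delannoy_line mu) unit_ordered
    = kperm mu (glex (@line2_incl R) (gempty (prod_sset (pt_sset R) (pt_sset R)))).
  by move=> mu; rewrite delannoy_lineE (kperm_unit mu) kperm_lex.
have l2 : forall mu : gmeasure R k, lex_sum unit_ordered (delannoy_line mu)
    = kperm mu (glex (gempty (prod_sset (pt_sset R) (pt_sset R))) (@line2_incl R)).
  by move=> mu; rewrite delannoy_lineE (kperm_unit mu) kperm_lex.
split.
(* Volume -1 + 1 = 0. Initial segments: -1 below a point of the line, and the whole line, again -1,
   below the top. *)
- rewrite l1; apply: (delannoy_functor (@order_embedding_line_pt R)).
    by rewrite vol_sum vol_pt v1 v2 addNr.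
  by move=> x [y|[]]; rewrite ?below_lexl ?below_lexr ?below_empty ?b1 ?b2 ?v1 ?addr0.
(* Volume 1 - 1 = 0. Initial segments: 0 below the bottom and 1 - 1 = 0 below a point of the
   line. *)
- rewrite l2; apply: (delannoy_functor (@order_embedding_pt_line R)).
    by rewrite vol_sum vol_pt v1 v3 addrN.
  by move=> x [[]|y]; rewrite ?below_lexl ?below_lexr ?below_empty ?vol_pt ?b1 ?b3 ?addrN.
(* Volume 1 - 1 + 1 = 1. Initial segments: 0 below the bottom, then 1 - 1 = 0 both below a point of
   the line and below the top. *)
- rewrite l1 (kperm_unit mu1) kperm_lex.
  apply: (delannoy_functor (@order_embedding_pt_line_pt R)).
    by rewrite !vol_sum vol_pt v1 v4 addNr addr0.
  move=> x [[]|[y|[]]]; rewrite ?below_lexr ?below_lexl ?below_lexr ?below_empty ?vol_pt;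
    by rewrite ?b1 ?b4 ?v1 ?addr0 ?addrN.
(* For [mu2] the line has volume 0 and its initial segments -1: volume 1 + 0 = 1, initial segments 0
   and 1 - 1 = 0. *)
- rewrite l2; apply: (delannoy_functor (@order_embedding_pt_line R)).
    by rewrite vol_sum vol_pt v2 v4 addr0.
  by move=> x [[]|y]; rewrite ?below_lexl ?below_lexr ?below_empty ?vol_pt ?b2 ?b4 ?addrN.
(* For [mu3] the line and its initial segments have volume 0: volume 0 + 1 = 1, and 0 below every
   point, the top included. *)
- rewrite l1; apply: (delannoy_functor (@order_embedding_line_pt R)).
    by rewrite vol_sum vol_pt v3 v4 add0r.
  by move=> x [y|[]]; rewrite ?below_lexl ?below_lexr ?below_empty ?b3 ?b4 ?v3 ?addr0.
Qed.
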